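(* Let $F$ be a number field. Let $S$ be a nonempty finite set of finite primes of $F$ such that $\mathrm{Cl}^S(F)/2=0$, where $\mathrm{Cl}^S(F)$ denotes the subgroup of $\mathrm{Cl}(\mathcal{O}_F)$ generated by the classes of the primes of $S$. Then there is a natural surjective map of $\mathbb{F}_3[\mathcal{O}_S^\times/(\mathcal{O}_S^\times)^2]$-modules $$H_3(\mathrm{SL}_2(\mathcal{O}_S),\mathbb{Z})_{(3)}\to\bigoplus_{v\in S}\mathcal{P}(k_v)_{(3)},$$ where $k_v$ is the residue field at $v$ and $a\in\mathcal{O}_S^\times$ acts on the summand $\mathcal{P}(k_v)_{(3)}$ as multiplication by $(-1)^{v(a)}$.
   Context: For an abelian group $A$, $A/2=A\otimes\mathbb{Z}/2$, and for $n\ge1$, $A_{(n)}=\{a\in A: na=0\}$. $\mathcal{O}_S=\{0\}\cup\{a\in F^\times: v(a)\ge0\text{ for all finite primes }v\notin S\}$ is the ring of $S$-integers. The group $\mathcal{O}_S^\times$ acts on $H_3(\mathrm{SL}_2(\mathcal{O}_S),\mathbb{Z})$ via conjugation by matrices of $\mathrm{GL}_2(\mathcal{O}_S)$ of given determinant; squares of units act trivially. Classical pre-Bloch group: for a field $k$ with at least $4$ elements, $\mathcal{P}(k)$ is the abelian group generated by $[x]$, $x\in k^\times\setminus\{1\}$, with relations $[x]-[y]+[y/x]-\left[\frac{1-x^{-1}}{1-y^{-1}}\right]+\left[\frac{1-x}{1-y}\right]=0$ for $x\ne y$ in $k^\times\setminus\{1\}$. $\mathcal{P}(\mathbb{F}_2)$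 is by definition cyclic of order $3$, and $\mathcal{P}(\mathbb{F}_3)$ is cyclic of order $4$ generated by $[-1]$. *)

(* Defs.v *)
From HB Require Import structures.
From mathcomp Require Import all_boot all_order all_algebra all_field.
From mathcomp Require Import ring_quotient finmap boolp classical_sets cardinality.
From mathcomp Require Import freeg.

Set Implicit Arguments.
Unset Strict Implicit.
Unset Printing Implicit Defensive.

Import Order.TTheory GRing.Theory Num.Theory.
Local Open Scope ring_scope.
Local Open Scope quotient_scope.

Section Span.
Variable A : zmodType.

Definition spanned (N : A -> Prop) : A -> Prop := fun a =>
  forall P : A -> Prop, P 0 -> (forall x y, P x -> P y -> P (x - y)) ->
    (forall x, N x -> P x) -> P a.

Definition span (N : A -> Prop) : {pred A} := fun a => `[< spanned N a >].

Fact span_zmod_closed N : zmod_closed (span N).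
Proof.
split=> [|x y /asboolP hx /asboolP hy]; apply/asboolP=> P P0 PB PN //.
exact: PB (hx P P0 PB PN) (hy P P0 PB PN).
Qed.
HB.instance Definition _ N := GRing.isZmodClosed.Build A (span N)
  (span_zmod_closed N).

Definition subgroup_of (N : A -> Prop) := {a : A | span N a}.
HB.instance Definition _ N := SubType.on (subgroup_of N).
HB.instance Definition _ N := [Choice of subgroup_of N by <:].
HB.instance Definition _ N :=
  [SubChoice_isSubZmodule of subgroup_of N by <:].

Definition quotient_by (N : A -> Prop) := Quotient.quot (span N).
HB.instance Definition _ N := ZmodQuotient.on (quotient_by N).

Definition mod2 := quotient_by (fun a : A => exists b, a = b *+ 2).
HB.instance Definition _ := GRing.Zmodule.on mod2.

Definition torsion_pred (n : nat) : {pred A} := fun a => a *+ n == 0.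
Fact torsion_zmod_closed n : zmod_closed (torsion_pred n).
Proof.
split=> [|x y]; rewrite /torsion_pred !unfold_in ?mul0rn //.
by move=> /eqP hx /eqP hy; rewrite mulrnBl hx hy subrr.
Qed.
HB.instance Definition _ n := GRing.isZmodClosed.Build A (torsion_pred n)
  (torsion_zmod_closed n).

Definition torsion (n : nat) := {a : A | torsion_pred n a}.
HB.instance Definition _ n := SubType.on (torsion n).
HB.instance Definition _ n := [Choice of torsion n by <:].
HB.instance Definition _ n := [SubChoice_isSubZmodule of torsion n by <:].
End Span.

(* The map induced on quotients, for [f] sending the subgroup generated by [N]
   into the one generated by [N'], see [quotient_mapE]. *)
Section QuotientMap.
Variables (A B : zmodType) (N : A -> Prop) (N' : B -> Prop).

Definition quotient_map (f : A -> B) (x : quotient_by N) : quotient_by N' :=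
  \pi_(quotient_by N') (f (repr x)).

Variable f : {additive A -> B}.
Hypothesis fN : forall a, N a -> spanned N' (f a).

Lemma quotient_mapE a :
  quotient_map f (\pi_(quotient_by N) a) = \pi_(quotient_by N') (f a).
Proof.
apply/eqP; rewrite /quotient_map -Quotient.idealrBE -raddfB; apply/asboolP.
have : spanned N (repr (\pi_(quotient_by N) a) - a).
  by apply/asboolP; rewrite -[asbool _]/(_ \in span N) Quotient.idealrBE reprK.
move=> /(_ (fun w => spanned N' (f w))); apply=> [|x y hx hy|]; last exact: fN.
  by move=> P P0 PB PN; rewrite raddf0.
move=> P P0 PB PN; rewrite raddfB.
exact: PB (hx P P0 PB PN) (hy P P0 PB PN).
Qed.

Fact quotient_map_additive : zmod_morphism (quotient_map f).
Proof.
by elim/quotW=> x; elim/quotW=> y; rewrite -raddfB !quotient_mapE !raddfB.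
Qed.
End QuotientMap.

Section TorsionMap.
Variables (A B : zmodType) (n : nat) (f : {additive A -> B}).
Fact torsion_map_subproof (a : torsion A n) : torsion_pred n (f (val a)).
Proof.
by case: a => a /= /eqP h; rewrite /torsion_pred -raddfMn h raddf0.
Qed.
Definition torsion_map (a : torsion A n) : torsion B n :=
  exist _ (f (val a)) (torsion_map_subproof a).
End TorsionMap.

(* The index type being finite, the direct sum is the product. *)
Section DirectSum.
Variables (I : finType) (A : I -> zmodType).
Definition dsum := forall i, A i.
HB.instance Definition _ := gen_eqMixin dsum.
HB.instance Definition _ := gen_choiceMixin dsum.
Let add (f g : dsum) : dsum := fun i => f i + g i.
Let opp (f : dsum) : dsum := fun i => - f i.
Let zero : dsum := fun i => 0.
Fact dsum_addA : associative add.
Proof. by move=> f g h; apply: functional_extensionality_dep => i; apply: addrA. Qed.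
Fact dsum_addC : commutative add.
Proof. by move=> f g; apply: functional_extensionality_dep => i; apply: addrC. Qed.
Fact dsum_add0 : left_id zero add.
Proof. by move=> f; apply: functional_extensionality_dep => i; apply: add0r. Qed.
Fact dsum_addN : left_inverse zero opp add.
Proof. by move=> f; apply: functional_extensionality_dep => i; apply: addNr. Qed.
HB.instance Definition _ :=
  GRing.isZmodule.Build dsum dsum_addA dsum_addC dsum_add0 dsum_addN.
End DirectSum.

Section FreeAbelian.
Variables (T U : choiceType) (V : lmodType int) (f : T -> V) (h : T -> U).

HB.instance Definition _ := GRing.isZmodMorphism.Build {freeg T} V (fglift f)
  (lift_is_additive f).

Lemma free_ind (P : {freeg T} -> Prop) :
  P 0 -> (forall x y, P x -> P y -> P (x - y)) -> (forall t, P << t >>) ->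
  forall x, P x.
Proof.
move=> P0 PB PU x.
have PN y : P y -> P (- y) by move=> hy; rewrite -sub0r; apply: PB.
have PD y z : P y -> P z -> P (y + z).
  by move=> hy hz; rewrite -[z]opprK; apply: PB => //; apply: PN.
rewrite -(freeg_sumE x); apply: big_ind => // t _.
have -> : << coeff t x *g t >> = << t >> *~ coeff t x :> {freeg T}.
  by rewrite freegU_mulz intz.
have PM n : P (<< t >> *+ n).
  by elim: n => [|n IH]; rewrite ?mulr0n // mulrS; apply: PD.
by case: (coeff t x) => n; rewrite ?NegzE ?mulrNz -pmulrn; [|apply: PN]; apply: PM.
Qed.

Definition free_map : {freeg T} -> {freeg U} := fglift (fun t => << h t >>).
End FreeAbelian.

Section Homology.
Variable G : groupType.

Definition chain (n : nat) := {freeg {ffun 'I_n -> G}}.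
HB.instance Definition _ n := GRing.Lmodule.on (chain n).

(* [face i] of [g_1|...|g_(n+1)] is [g_2|...|g_(n+1)] for i = 0,
   [g_1|...|g_i g_(i+1)|...|g_(n+1)] for 0 < i < n + 1, and
   [g_1|...|g_n] for i = n + 1; g_(j+1) is [g j]. *)
Definition face n (i : 'I_n.+2) (g : {ffun 'I_n.+1 -> G}) : {ffun 'I_n -> G} :=
  [ffun j : 'I_n => let x := g (widen_ord (leqnSn n) j) in
                    let y := g (fintype.lift ord0 j) in
     if (j.+1 < i)%N then x else if j.+1 == i :> nat then (x * y)%g else y].

Definition boundary n : chain n -> chain n.-1 :=
  match n return chain n -> chain n.-1 with
  | 0 => fun=> 0
  | n.+1 => fglift (fun g => \sum_(i < n.+2) (-1) ^+ i *: << face i g >>)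
  end.

Fact boundary_additive n : zmod_morphism (@boundary n).
Proof. by case: n => [|n] x y /=; rewrite ?subr0 // raddfB. Qed.
HB.instance Definition _ n :=
  GRing.isZmodMorphism.Build _ _ (@boundary n) (@boundary_additive n).

Definition cycle_pred n : {pred chain n} := fun c => boundary c == 0.
Fact cycle_zmod_closed n : zmod_closed (@cycle_pred n).
Proof.
split=> [|x y]; rewrite /cycle_pred !unfold_in ?raddf0 //.
by move=> /eqP hx /eqP hy; rewrite boundary_additive hx hy subrr.
Qed.
HB.instance Definition _ n := GRing.isZmodClosed.Build _ (@cycle_pred n)
  (@cycle_zmod_closed n).

Definition cycles n := {c : chain n | cycle_pred c}.
HB.instance Definition _ n := SubType.on (cycles n).
HB.instance Definition _ n := [Choice of cycles n by <:].
HB.instance Definition _ n := [SubChoice_isSubZmodule of cycles n by <:].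

Definition is_boundary n : cycles n -> Prop :=
  fun z => exists c : chain n.+1, val z = boundary c.

Definition homology n := quotient_by (@is_boundary n).
HB.instance Definition _ n := ZmodQuotient.on (homology n).
End Homology.

Section HomologyMap.
Variables (G K : groupType) (f : {multiplicative G -> K}).

Definition chain_map n : chain G n -> chain K n :=
  free_map (fun g : {ffun 'I_n -> G} => [ffun i => f (g i)]).
Fact chain_map_additive n : zmod_morphism (@chain_map n).
Proof. by move=> x y; rewrite /chain_map /free_map raddfB. Qed.
HB.instance Definition _ n :=
  GRing.isZmodMorphism.Build _ _ (@chain_map n) (@chain_map_additive n).

Lemma chain_mapU n g : @chain_map n << g >> = << [ffun i => f (g i)] >>.
Proof. by rewrite /chain_map /free_map liftU scale1r. Qed.

Lemma chain_map_boundary n (c : chain G n) :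
  boundary (chain_map c) = chain_map (boundary c).
Proof.
case: n c => [|n] c; first by rewrite /= raddf0.
elim/free_ind: c => [|x y hx hy|g]; first by rewrite !raddf0.
  by rewrite !(chain_map_additive, boundary_additive) hx hy.
rewrite chain_mapU /= !liftU !scale1r raddf_sum; apply: eq_bigr => i _.
have -> : face i [ffun i0 => f (g i0)] = [ffun j => f (face i g j)].
  apply/ffunP => j; rewrite !ffunE /=.
  by case: ifP => // _; case: ifP => // _; rewrite gmulfM.
rewrite -signr_odd; case: (odd i); rewrite ?expr0 ?expr1 ?scaleN1r ?scale1r.
  by rewrite raddfN /= chain_mapU.
by rewrite /= chain_mapU.
Qed.

Fact cycle_map_subproof n (z : cycles G n) : cycle_pred (chain_map (val z)).
Proof.
by case: z => z /= /eqP h; rewrite /cycle_pred chain_map_boundary h raddf0.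
Qed.
Definition cycle_map n (z : cycles G n) : cycles K n :=
  exist _ (chain_map (val z)) (cycle_map_subproof z).

Fact cycle_map_additive n : zmod_morphism (@cycle_map n).
Proof. by move=> x y; apply: val_inj; rewrite /= chain_map_additive. Qed.
HB.instance Definition _ n :=
  GRing.isZmodMorphism.Build _ _ (@cycle_map n) (@cycle_map_additive n).

Fact cycle_map_boundary n (z : cycles G n) :
  is_boundary z -> spanned (@is_boundary K n) (cycle_map z).
Proof.
case=> c hc P _ _; apply; exists (chain_map c).
by rewrite chain_map_boundary -hc.
Qed.

Definition homology_map n : homology G n -> homology K n :=
  quotient_map (@is_boundary K n) (@cycle_map n).
HB.instance Definition _ n :=
  GRing.isZmodMorphism.Build (homology G n) (homology K n) (@homology_map n)
    (quotient_map_additive (@cycle_map_boundary n)).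
End HomologyMap.

Section SL2.
Variable R : comUnitRingType.

Definition SL2 := {M : 'M[R]_2 | \det M == 1}.
HB.instance Definition _ := SubType.on SL2.
HB.instance Definition _ := [Choice of SL2 by <:].

Let SL2P (M : SL2) : \det (val M) = 1. Proof. exact/eqP/(valP M). Qed.

Definition SL2_one : SL2 := exist _ 1%:M (introT eqP (det1 R 2)).
Fact SL2_mul_subproof (M N : SL2) : \det (val M *m val N) == 1.
Proof. by rewrite det_mulmx !SL2P mulr1. Qed.
Definition SL2_mul (M N : SL2) : SL2 := exist _ (val M *m val N) (SL2_mul_subproof M N).
Fact SL2_inv_subproof (M : SL2) : \det (invmx (val M)) == 1.
Proof. by rewrite det_inv SL2P invr1. Qed.
Definition SL2_inv (M : SL2) : SL2 := exist _ (invmx (val M)) (SL2_inv_subproof M).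

Fact SL2_unit (M : SL2) : val M \in unitmx.
Proof. by rewrite unitmxE SL2P unitr1. Qed.
Fact SL2_mulA : associative SL2_mul.
Proof. by move=> x y z; apply: val_inj; rewrite /= mulmxA. Qed.
Fact SL2_mul1 : left_id SL2_one SL2_mul.
Proof. by move=> x; apply: val_inj; rewrite /= mul1mx. Qed.
Fact SL2_1mul : right_id SL2_one SL2_mul.
Proof. by move=> x; apply: val_inj; rewrite /= mulmx1. Qed.
Fact SL2_mulV : left_inverse SL2_one SL2_inv SL2_mul.
Proof. by move=> x; apply: val_inj; rewrite /= mulVmx // SL2_unit. Qed.
Fact SL2_Vmul : right_inverse SL2_one SL2_inv SL2_mul.
Proof. by move=> x; apply: val_inj; rewrite /= mulmxV // SL2_unit. Qed.
HB.instance Definition _ :=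
  isGroup.Build SL2 SL2_mulA SL2_mul1 SL2_1mul SL2_mulV SL2_Vmul.

Variables (g : 'M[R]_2) (gU : g \in unitmx).
Fact SL2_conj_subproof (M : SL2) : \det (g *m val M *m invmx g) == 1.
Proof.
by rewrite !det_mulmx SL2P mulr1 det_inv mulrV // -unitmxE.
Qed.
Definition SL2_conj (M : SL2) : SL2 :=
  exist _ (g *m val M *m invmx g) (SL2_conj_subproof M).
Fact SL2_conjM : {morph SL2_conj : M N / (M * N)%g}.
Proof.
move=> M N; apply: val_inj; rewrite /= -!mulmxA; congr (_ *m (_ *m _)).
by rewrite !mulmxA mulVmx // mul1mx.
Qed.
HB.instance Definition _ := isMultiplicative.Build SL2 SL2 SL2_conj SL2_conjM.
End SL2.

Section SL2Map.
Variables (R R' : comUnitRingType) (f : {rmorphism R -> R'}).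
Fact SL2_map_subproof (M : SL2 R) : \det (map_mx f (val M)) == 1.
Proof. by rewrite det_map_mx (eqP (valP M)) rmorph1. Qed.
Definition SL2_map (M : SL2 R) : SL2 R' :=
  exist _ (map_mx f (val M)) (SL2_map_subproof M).
Fact SL2_mapM : {morph SL2_map : M N / (M * N)%g}.
Proof. by move=> M N; apply: val_inj; rewrite /= map_mxM. Qed.
HB.instance Definition _ :=
  isMultiplicative.Build (SL2 R) (SL2 R') SL2_map SL2_mapM.
End SL2Map.

Section PreBloch.
Variable k : fieldType.

Definition has_card (n : nat) := ([set: k]%classic #= `I_n)%card.

(* One generator for each element of [k].  The generators of P(k) are
   the [x] with [x] not in {0, 1}; [0] and [1] are killed, except that for the
   field with two elements [0] is kept as a formal generator of the cyclic group
   of order 3.  Over the field with three elements the only generator is [-1].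
   In both of these fields there are no five-term relations. *)
Inductive preBloch_relation : {freeg k} -> Prop :=
| five_term x y : x != 0 -> x != 1 -> y != 0 -> y != 1 -> x != y ->
    preBloch_relation (<< x >> - << y >> + << y / x >>
      - << (1 - x^-1) / (1 - y^-1) >> + << (1 - x) / (1 - y) >>)
| kill_one : preBloch_relation << 1 >>
| kill_zero : ~ has_card 2 -> preBloch_relation << 0 >>
| order_F2 : has_card 2 -> preBloch_relation (<< 0 >> *+ 3)
| order_F3 : has_card 3 -> preBloch_relation (<< -1 >> *+ 4).

Definition preBloch := quotient_by preBloch_relation.
HB.instance Definition _ := ZmodQuotient.on preBloch.
End PreBloch.

(* The map [x] |-> [tau x], for an isomorphism tau of fields *)
Definition preBloch_map (k k' : fieldType) (tau : k -> k') :
    preBloch k -> preBloch k' :=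
  quotient_map (@preBloch_relation k') (free_map tau).

Section PreBlochMap.
Variables (k k' : fieldType) (tau : {rmorphism k -> k'}).
Hypothesis tau_bij : bijective tau.
HB.instance Definition _ := GRing.isZmodMorphism.Build {freeg k} {freeg k'}
  (free_map tau) (lift_is_additive _).

Lemma has_card_bij n : has_card k n <-> has_card k' n.
Proof.
have [g tK gK] := tau_bij.
have e : ([set: k'] #= [set: k])%card.
  have -> : [set: k']%classic = (tau @` [set: k])%classic.
    by apply/seteqP; split=> // y _; exists (g y); rewrite ?gK.
  by apply: inj_card_eq => x y _ _; exact: (can_inj tK).
rewrite /has_card; split=> h; first exact: card_eq_trans e h.
by apply: card_eq_trans h; rewrite card_eq_sym.
Qed.

Lemma preBloch_relation_map c :
  preBloch_relation c -> spanned (@preBloch_relation k') (free_map tau c).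
Proof.
have U x : free_map tau << x >> = << tau x >> by rewrite /free_map liftU scale1r.
have UN x : free_map tau (- << x >>) = - << tau x >> by rewrite raddfN /= U.
move=> h; suff : preBloch_relation (free_map tau c) by move=> r P _ _; apply.
case: h => [x y x0 x1 y0 y1 xy||h|h|h].
- rewrite !raddfD /= !UN !U !(fmorph_div, rmorphB, fmorphV) !rmorph1.
  by apply: five_term; rewrite ?fmorph_eq0 ?fmorph_eq1 ?(inj_eq (fmorph_inj tau)).
- by rewrite U rmorph1; exact: kill_one.
- by rewrite U rmorph0; apply: kill_zero => /has_card_bij.
- by rewrite raddfMn /= U rmorph0; apply: order_F2; exact/has_card_bij.
- by rewrite raddfMn /= U rmorphN1; apply: order_F3; exact/has_card_bij.
Qed.

Lemma preBloch_mapE (c : {freeg k}) :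
  preBloch_map tau (\pi_(preBloch k) c) = \pi_(preBloch k') (free_map tau c).
Proof. exact: (quotient_mapE (f := free_map tau) preBloch_relation_map). Qed.
End PreBlochMap.

Section NumberField.
Variable F : fieldExtType rat.

(* A finite prime is given by its normalized discrete valuation; the value at 0,
   which is +oo, is set to the dummy value 0. *)
Record finite_prime := FinitePrime {
  valuation :> F -> int;
  valuation0 : valuation 0 = 0;
  valuationM : forall x y, x != 0 -> y != 0 ->
    valuation (x * y) = valuation x + valuation y;
  valuationD : forall x y, x != 0 -> y != 0 -> x + y != 0 ->
    Num.min (valuation x) (valuation y) <= valuation (x + y);
  valuation_surj : exists2 x, x != 0 & valuation x = 1
}.
HB.instance Definition _ := gen_eqMixin finite_prime.
HB.instance Definition _ := gen_choiceMixin finite_prime.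

Section Residue.
Variable v : finite_prime.

Lemma valuation1 : v 1 = 0.
Proof.
have := valuationM v (oner_neq0 F) (oner_neq0 F); rewrite mulr1.
by move/eqP; rewrite -subr_eq0 opprD addrA subrr sub0r oppr_eq0 => /eqP.
Qed.
Lemma valuationN x : v (- x) = v x.
Proof.
have h1 : (- 1 : F) != 0 by rewrite oppr_eq0 oner_neq0.
have hN1 : v (- 1) = 0.
  have := valuationM v h1 h1; rewrite mulrNN mulr1 valuation1 => /esym/eqP.
  by rewrite -mulr2n mulrn_eq0 /= => /eqP.
have [->|x0] := eqVneq x 0; first by rewrite oppr0.
by rewrite -mulN1r valuationM // hN1 add0r.
Qed.
Lemma valuationV x : v x^-1 = - v x.
Proof.
have [->|x0] := eqVneq x 0; first by rewrite invr0 valuation0 oppr0.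
apply/eqP; rewrite -addr_eq0 -valuationM ?invr_eq0 // mulVf //.
by rewrite valuation1.
Qed.

(* [c <= v x], with v 0 = +oo *)
Definition valuation_ge (c : int) (x : F) := (x == 0) || (c <= v x).

Lemma valuation_geB c x y :
  valuation_ge c x -> valuation_ge c y -> valuation_ge c (x - y).
Proof.
rewrite /valuation_ge; have [->|x0] /= := eqVneq x 0.
  by rewrite sub0r oppr_eq0 valuationN.
have [->|y0] /= := eqVneq y 0; first by rewrite subr0 => ->; rewrite orbT.
have [//|xy0] /= := eqVneq (x - y) 0 => hx hy.
apply: le_trans (valuationD _ _ _ _) => //; last by rewrite oppr_eq0.
by rewrite valuationN le_min hx hy.
Qed.
Lemma valuation_geM c d x y :
  valuation_ge c x -> valuation_ge d y -> valuation_ge (c + d) (x * y).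
Proof.
rewrite /valuation_ge mulf_eq0; have [//|x0] /= := eqVneq x 0.
have [//|y0] /= := eqVneq y 0 => hx hy.
by rewrite valuationM // lerD.
Qed.

Definition valring_pred : {pred F} := valuation_ge 0.
Fact valring_subring_closed : subring_closed valring_pred.
Proof.
split=> [|x y|x y].
  by rewrite unfold_in /valring_pred /valuation_ge valuation1 lexx orbT.
  exact: valuation_geB.
exact: (@valuation_geM 0 0).
Qed.
HB.instance Definition _ :=
  GRing.isSubringClosed.Build F valring_pred valring_subring_closed.

Definition valring := {x : F | valring_pred x}.
HB.instance Definition _ := SubType.on valring.
HB.instance Definition _ := [Choice of valring by <:].
HB.instance Definition _ := [SubChoice_isSubComNzRing of valring by <:].

Definition maximal_ideal : {pred valring} := fun x => valuation_ge 1 (val x).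
Fact maximal_ideal_closed : idealr_closed maximal_ideal.
Proof.
split; rewrite ?unfold_in /maximal_ideal /valuation_ge ?eqxx //.
  by rewrite valuation1 (negPf (oner_neq0 F)).
move=> a x y hx hy; have hNy : valuation_ge 1 (- val y).
  by rewrite -sub0r; apply: valuation_geB => //; rewrite /valuation_ge eqxx.
change (valuation_ge 1 (val a * val x + val y)).
rewrite -[val y]opprK; apply: valuation_geB => //.
by rewrite -[1]add0r; apply: valuation_geM => //; exact: (valP a).
Qed.
HB.instance Definition _ :=
  isIdealr.Build valring maximal_ideal maximal_ideal_closed.

Definition residue := {ideal_quot maximal_ideal}.
HB.instance Definition _ := NzRingQuotient.on residue.
HB.instance Definition _ := GRing.ComNzRing.on residue.

Fact residue_inv_exists (x : residue) :
  exists y, (x = 0 -> y = 0) /\ (x != 0 -> y * x = 1).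
Proof.
have [->|x0] := eqVneq x 0; first by exists 0.
have hx : ~~ valuation_ge 1 (val (repr x)).
  apply: contra x0 => hx; rewrite -[x]reprK -[0](@pi_zeror _ _ _ _ _ residue).
  by rewrite -Quotient.idealrBE subr0.
have [r0 vr] : val (repr x) != 0 /\ v (val (repr x)) = 0.
  move: hx; rewrite /valuation_ge negb_or -ltNge => /andP[r0 hlt]; split=> //.
  apply/eqP; rewrite eq_le -ltzD1 add0r hlt /=.
  by have := valP (repr x); rewrite /valring_pred /valuation_ge (negPf r0).
have hV : valring_pred (val (repr x))^-1.
  by rewrite /valring_pred /valuation_ge valuationV vr oppr0 lexx orbT.
exists (\pi_residue (Sub _ hV : valring)); split=> [/eqP|_]; first by rewrite (negPf x0).
rewrite -[x in _ * x]reprK -rmorphM -[RHS](@pi_oner _ _ _ _ _ _ _ residue).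
by congr (\pi_residue _); apply: val_inj; rewrite rmorphM /= mulVf.
Qed.
Definition residue_inv (x : residue) := projT1 (cid (residue_inv_exists x)).
Fact residue_mulVf x : x != 0 -> residue_inv x * x = 1.
Proof. exact: (projT2 (cid (residue_inv_exists x))).2. Qed.
Fact residue_invr0 : residue_inv 0 = 0.
Proof. exact: (projT2 (cid (residue_inv_exists 0))).1. Qed.
HB.instance Definition _ :=
  GRing.ComNzRing_isField.Build residue residue_mulVf residue_invr0.
End Residue.

Section SIntegers.
Variable S : {fset finite_prime}.

Definition Sint_pred : {pred F} := fun x =>
  (x == 0) || `[< forall v : finite_prime, v \notin S -> 0 <= v x >].
Lemma Sint_predP x :
  reflect (forall v : finite_prime, v \notin S -> valring_pred v x) (Sint_pred x).
Proof.
rewrite /Sint_pred /valring_pred /valuation_ge.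
by have [_|_] := eqVneq x 0; [constructor|exact: asboolP].
Qed.
Fact Sint_subring_closed : subring_closed Sint_pred.
Proof.
split=> [|x y /Sint_predP hx /Sint_predP hy|x y /Sint_predP hx /Sint_predP hy];
  apply/Sint_predP => v vS.
- by case: (valring_subring_closed v).
- exact: valuation_geB (hx _ vS) (hy _ vS).
- exact: (@valuation_geM v 0 0 _ _ (hx _ vS) (hy _ vS)).
Qed.
HB.instance Definition _ :=
  GRing.isSubringClosed.Build F Sint_pred Sint_subring_closed.

Definition Sint := {x : F | Sint_pred x}.
HB.instance Definition _ := SubType.on Sint.
HB.instance Definition _ := [Choice of Sint by <:].
HB.instance Definition _ := [SubChoice_isSubComNzRing of Sint by <:].

Definition Sint_unit : {pred Sint} := fun x =>
  (val x != 0) && Sint_pred (val x)^-1.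
Definition Sint_inv (x : Sint) : Sint :=
  if Sint_unit x then insubd x (val x)^-1 else x.
Fact Sint_mulVx : {in Sint_unit, left_inverse 1 Sint_inv *%R}.
Proof.
move=> x xU; have /andP[x0 xV] : Sint_unit x := xU; apply: val_inj.
have e : val (Sint_inv x) = (val x)^-1.
  by rewrite /Sint_inv [Sint_unit x]xU val_insubd xV.
by rewrite -[LHS]/(val (Sint_inv x) * val x) e mulVf.
Qed.
Fact Sint_unitPl (x y : Sint) : y * x = 1 -> Sint_unit x.
Proof.
move=> /(congr1 val) yx; have {}yx : val y * val x = 1 := yx.
have x0 : val x != 0.
  by apply/eqP => x0; move/eqP: yx; rewrite x0 mulr0 eq_sym oner_eq0.
rewrite /Sint_unit x0 /=.
by have -> : (val x)^-1 = val y; [rewrite -[LHS]mul1r -yx mulfK|exact: (valP y)].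
Qed.
Fact Sint_invr_out : {in [predC Sint_unit], Sint_inv =1 id}.
Proof. by move=> x; rewrite inE /Sint_inv => /negPf xU; rewrite ifF. Qed.
HB.instance Definition _ := GRing.ComNzRing_hasMulInverse.Build Sint
  Sint_mulVx Sint_unitPl Sint_invr_out.
End SIntegers.

Definition ring_of_integers : set F :=
  [set x | integralOver (intr : int -> F) x]%classic.
Local Notation O := ring_of_integers.

Definition submodule (M : set F) : Prop :=
  [/\ M 0, forall x y, M x -> M y -> M (x - y)
    & forall a x, O a -> M x -> M (a * x)].

Definition ideal_product (I J : set F) : set F :=
  spanned (fun z => exists x y, [/\ I x, J y & z = x * y]).

(* Invertible O_F-submodules of F; they are automatically fractional ideals. *)
Record ideal := Ideal {
  carrier :> set F;
  ideal_submodule : submodule carrier;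
  ideal_invertible :
    exists J, submodule J /\ ideal_product carrier J = ring_of_integers
}.
HB.instance Definition _ := gen_eqMixin ideal.
HB.instance Definition _ := gen_choiceMixin ideal.

Lemma ideal_inj (I J : ideal) : carrier I = carrier J -> I = J.
Proof.
case: I J => [I hI iI] [J hJ iJ] /= IJ; case: J / IJ hJ iJ => hJ iJ.
by rewrite (Prop_irrelevance hI hJ) (Prop_irrelevance iI iJ).
Qed.

Lemma spanned0 (A : zmodType) (N : A -> Prop) : spanned N 0.
Proof. by []. Qed.
Lemma spannedB (A : zmodType) (N : A -> Prop) x y :
  spanned N x -> spanned N y -> spanned N (x - y).
Proof.
by move=> hx hy P P0 PB PN; exact: PB (hx P P0 PB PN) (hy P P0 PB PN).
Qed.
Lemma spannedG (A : zmodType) (N : A -> Prop) x : N x -> spanned N x.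
Proof. by move=> hx P _ _; apply. Qed.

Lemma ring_of_integers1 : O 1. Proof. exact: integral1. Qed.
Lemma ring_of_integers_submodule : submodule O.
Proof.
split; [exact: integral0|exact: integral_sub|exact: integral_mul].
Qed.

Lemma ideal_product_submodule I J : submodule I -> submodule (ideal_product I J).
Proof.
move=> [I0 IB IM]; split; [exact: spanned0|exact: spannedB|].
move=> a x Oa; move/(_ (fun z => ideal_product I J (a * z))); apply.
- by rewrite mulr0; exact: spanned0.
- by move=> u w; rewrite mulrBr; exact: spannedB.
move=> _ [u [w [Iu Jw ->]]]; apply: spannedG.
by exists (a * u), w; rewrite mulrA; split=> //; exact: IM.
Qed.

Lemma ideal_productC I J : ideal_product I J = ideal_product J I.
Proof.
suff h K L x : ideal_product K L x -> ideal_product L K x.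
  by apply/seteqP; split=> x; exact: h.
apply; [exact: spanned0|exact: spannedB|].
move=> _ [u [w [Ku Lw ->]]]; apply: spannedG.
by exists w, u; rewrite mulrC.
Qed.

Lemma ideal_productA I J K :
  ideal_product I (ideal_product J K) = ideal_product (ideal_product I J) K.
Proof.
have h A B C x : ideal_product A (ideal_product B C) x ->
    ideal_product (ideal_product A B) C x.
  apply; [exact: spanned0|exact: spannedB|].
  move=> _ [u [w [Au + ->]]].
  move/(_ (fun z => ideal_product (ideal_product A B) C (u * z))); apply.
  - by rewrite mulr0; exact: spanned0.
  - by move=> p q; rewrite mulrBr; exact: spannedB.
  move=> _ [p [q [Bp Cq ->]]]; apply: spannedG.
  by exists (u * p), q; rewrite mulrA; split=> //; apply: spannedG; exists u, p.
apply/seteqP; split=> x; first exact: h.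
rewrite (ideal_productC _ K) (ideal_productC I J) => /h.
by rewrite (ideal_productC _ I) (ideal_productC K J).
Qed.

Lemma ideal_product1 I : submodule I -> ideal_product O I = I.
Proof.
move=> [I0 IB IM]; apply/seteqP; split=> x.
  by apply=> // _ [u [w [Ou Iw ->]]]; exact: IM.
move=> Ix; apply: spannedG; exists 1, x; rewrite mul1r; split=> //.
exact: ring_of_integers1.
Qed.

Fact one_ideal_invertible : exists J, submodule J /\ ideal_product O J = O.
Proof.
exists O; split; first exact: ring_of_integers_submodule.
exact/ideal_product1/ring_of_integers_submodule.
Qed.
Definition one_ideal := Ideal ring_of_integers_submodule one_ideal_invertible.

Fact mul_ideal_invertible (I J : ideal) :
  exists K, submodule K /\ ideal_product (ideal_product I J) K = O.
Proof.
have [I' [sI' hI]] := ideal_invertible I.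
have [J' [sJ' hJ]] := ideal_invertible J.
exists (ideal_product I' J'); split; first exact: ideal_product_submodule.
rewrite [ideal_product I J]ideal_productC -ideal_productA.
rewrite [ideal_product I _]ideal_productA hI ideal_product1 //.
Qed.
Definition mul_ideal (I J : ideal) := Ideal
  (ideal_product_submodule J (ideal_submodule I)) (mul_ideal_invertible I J).

Let inv_carrier (I : ideal) := projT1 (cid (ideal_invertible I)).
Fact inv_carrier_submodule I : submodule (inv_carrier I).
Proof. by rewrite /inv_carrier; case: cid => J []. Qed.
Fact mul_inv_carrier I : ideal_product (inv_carrier I) I = O.
Proof. by rewrite ideal_productC /inv_carrier; case: cid => J []. Qed.
Fact inv_carrier_invertible I :
  exists J, submodule J /\ ideal_product (inv_carrier I) J = O.
Proof.
by exists I; split; [exact: ideal_submodule|exact: mul_inv_carrier].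
Qed.
Definition inv_ideal I := Ideal (inv_carrier_submodule I) (inv_carrier_invertible I).

(* The group of fractional ideals, written additively: [I + J] is the product
   ideal. *)
Fact ideal_addA : associative mul_ideal.
Proof. by move=> I J K; apply: ideal_inj; exact: ideal_productA. Qed.
Fact ideal_addC : commutative mul_ideal.
Proof. by move=> I J; apply: ideal_inj; exact: ideal_productC. Qed.
Fact ideal_add0 : left_id one_ideal mul_ideal.
Proof.
by move=> I; apply: ideal_inj; exact/ideal_product1/ideal_submodule.
Qed.
Fact ideal_addN : left_inverse one_ideal inv_ideal mul_ideal.
Proof. by move=> I; apply: ideal_inj; exact: mul_inv_carrier. Qed.
HB.instance Definition _ :=
  GRing.isZmodule.Build ideal ideal_addA ideal_addC ideal_add0 ideal_addN.

Definition principal (I : ideal) : Prop :=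
  exists2 x : F, x != 0 & carrier I = [set x * a | a in O]%classic.

Definition class_group := quotient_by principal.
HB.instance Definition _ := ZmodQuotient.on class_group.

Definition prime_ideal (v : finite_prime) : set F :=
  [set x | O x /\ valuation_ge v 1 x]%classic.

Definition class_subgroup (S : {fset finite_prime}) :=
  subgroup_of (fun c : class_group => exists2 v : finite_prime, v \in S &
    exists2 I : ideal, carrier I = prime_ideal v & c = \pi_class_group I).
HB.instance Definition _ S := GRing.Zmodule.on (class_subgroup S).
End NumberField.

Section Modules.
Variables (F : fieldExtType rat) (S : {fset finite_prime F}).

Definition H3_tors := torsion (homology (SL2 (Sint S)) 3) 3.
HB.instance Definition _ := GRing.Zmodule.on H3_tors.

Definition preBloch_sum :=
  dsum (fun v : S => torsion (preBloch (residue (val v))) 3).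
HB.instance Definition _ := GRing.Zmodule.on preBloch_sum.

(* A module map over the group algebra F_3[U/U^2], U the units of O_S, between
   groups killed by 3 is an additive map commuting with the action of U: it is
   F_3-linear, and squares act trivially on both sides.  A unit [a] acts on the
   homology of SL_2(O_S) through [SL2_conj], for any matrix [g] of GL_2(O_S) of
   determinant [a]; the choice of [g] is irrelevant, since inner automorphisms
   act trivially. *)
Definition H3_act (g : 'M[Sint S]_2) (gU : g \in unitmx) : H3_tors -> H3_tors :=
  torsion_map (@homology_map _ _ (SL2_conj gU) 3).

Definition preBloch_act (a : Sint S) (f : preBloch_sum) : preBloch_sum :=
  fun v => f v *~ ((-1) ^ (val v : finite_prime F) (val a)).
End Modules.

Definition class_subgroup_mod2_trivial (F : fieldExtType rat)
    (S : {fset finite_prime F}) : Prop :=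
  forall c : mod2 (class_subgroup S), c = 0.

Definition comparison_family :=
  forall (F : fieldExtType rat) (S : {fset finite_prime F}),
    S != fset0 -> class_subgroup_mod2_trivial S ->
    {additive H3_tors S -> preBloch_sum S}.

(* Naturality: for an isomorphism [sigma] from [F] to [F'] carrying [S] to [S'],
   inducing [rho] from O_S to O_S', and [tau] from k_v to k_v' when v in S
   corresponds to v' in S', the component at v' of the image of the transport of z
   is the transport of the component at v of the image of z. *)
Definition natural (Phi : comparison_family) : Prop :=
  forall (F F' : fieldExtType rat)
    (S : {fset finite_prime F}) (S' : {fset finite_prime F'})
    (S0 : S != fset0) (S'0 : S' != fset0)
    (hS : class_subgroup_mod2_trivial S) (hS' : class_subgroup_mod2_trivial S')
    (sigma : {rmorphism F -> F'}),
  bijective sigma ->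
  (forall (v : finite_prime F) (v' : finite_prime F'),
     (forall x, v' (sigma x) = v x) -> (v \in S) = (v' \in S')) ->
  forall rho : {rmorphism Sint S -> Sint S'},
  (forall x, val (rho x) = sigma (val x)) ->
  forall (v : S) (v' : S'),
  (forall x, (val v' : finite_prime F') (sigma x) = (val v : finite_prime F) x) ->
  forall tau : {rmorphism residue (val v) -> residue (val v')},
  (forall (x : valring (val v)) (x' : valring (val v')),
     val x' = sigma (val x) -> tau (\pi x) = \pi x') ->
  forall z : H3_tors S,
    val (Phi F' S' S'0 hS' (torsion_map (@homology_map _ _ (SL2_map rho) 3) z) v')
    = preBloch_map tau (val (Phi F S S0 hS z v)).

(* Main.v *)
Require Import Defs.
From HB Require Import structures.
From mathcomp Require Import all_boot all_order all_algebra all_field.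
From mathcomp Require Import all_fingroup cyclic.
From mathcomp Require Import finmap.
From mathcomp Require Import generic_quotient boolp classical_sets cardinality.
From mathcomp Require Import functions fsbigop.
From mathcomp Require Import freeg ring zify.

Set Implicit Arguments.
Unset Strict Implicit.
Unset Printing Implicit Defensive.

Import Order.TTheory GRing.Theory Num.Theory.
Local Open Scope ring_scope.
Local Open Scope quotient_scope.

(** The map is constructed one prime at a time, from a 3-cocycle of [SL_2(F)] that lives
    on the Bruhat-Tits tree.

    Over a field [k], the function that sends four distinct points of the projective line
    to four times the symbol of their cross ratio is invariant under [GL_2(k)], and it
    satisfies the cocycle relation on five distinct points, which is the five-term
    relation.  The element [c = 4 ([x] + [1 - x])] does not depend on [x] and is killed
    by 3, and with its help the function extends to degenerate tuples
    ([bloch_cocycle5]).  The factor 4 is harmless: it is the identity on the elements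
    killed by 3.

    Let [v] be a finite prime of [F] with residue field [k].  From each vertex of the tree
    of [v], a point of the projective line over [F] is seen as a direction, a point of the
    projective line over [k].  Summing over all vertices the residual cocycle of the four
    directions, with the sign given by the type of the vertex, yields [tree_cocycle]; the
    sum is finite, as only the branching vertices of three among the four points
    contribute ([branching_unique]).  An element [g] of [GL_2(F)] permutes the vertices
    and changes their types by the parity of [v (det g)], so that the result is a cocycle
    invariant under [SL_2(F)] and multiplied by [(-1) ^ v (det g)] under [GL_2(F)]
    ([tree_cocycle_mobius]).  It defines a homomorphism on the third homology group
    ([prime_component]), equivariant by [prime_component_act] and natural by
    [prime_component_map].

    Surjectivity rests on three facts.  The class of an element of order 3 in
    [SL_2(Z)] is killed by 3, and its component at every prime is the constant [c]
    ([prime_component_lens]).  The 3-torsion of the pre-Bloch group of a finite field is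
    generated by [c] ([finite_preBloch_torsion]): if [q] is not 2 modulo 3, averaging over
    the projective line shows that [4 (q + 1)] kills the group; otherwise, if [q] is not 2,
    a nonsplit torus acts on the projective line as a simply transitive cyclic group of
    order [q + 1], over which the cocycle can be computed, and a transfer does the rest.  Lastly, by the
    hypothesis on the class group, for each [w] in [S] there is a unit of [O_S] whose
    valuation is odd at [w] and even at the other primes of [S] ([unit_with_parity]).  If
    [a] is this unit, the operation that sends [y] to [- (y + a y)] preserves the image
    and erases the coordinate at [w] without altering the others; therefore the image
    contains the element with a single nonzero coordinate [c], at any place, and it is
    everything. *)

(** * A decision procedure for identities in abelian groups *)

Section AbelianNormalForm.
Variable A : zmodType.

Inductive zexp :=
  | ZZero | ZVar of nat | ZAdd of zexp & zexp | ZOpp of zexp | ZMuln of zexp & nat.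

Fixpoint zeval (env : seq A) e : A :=
  match e with
  | ZZero => 0
  | ZVar i => env`_i
  | ZAdd e1 e2 => zeval env e1 + zeval env e2
  | ZOpp e1 => - zeval env e1
  | ZMuln e1 n => zeval env e1 *+ n
  end.

Fixpoint zcoef e (i : nat) : int :=
  match e with
  | ZZero => 0
  | ZVar j => (j == i)%:Z
  | ZAdd e1 e2 => zcoef e1 i + zcoef e2 i
  | ZOpp e1 => - zcoef e1 i
  | ZMuln e1 n => zcoef e1 i * n%:Z
  end.

(** The coefficients are computed by [zcoef], so that an identity between reified
    expressions is decided by evaluation. *)
Lemma zeval_coef env e : zeval env e = \sum_(i < size env) env`_i *~ zcoef e i.
Proof.
elim: e => [|j|e1 IH1 e2 IH2|e1 IH|e1 IH n] /=.
- by rewrite big1.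
- have [jlt|jge] := ltnP j (size env).
    rewrite (bigD1 (Ordinal jlt)) //= eqxx mulr1z big1 ?addr0 // => i.
    by rewrite -val_eqE /= eq_sym => /negPf ->.
  rewrite nth_default // big1 // => i _.
  by have [ji|] := eqVneq j (i : nat); first by have := ltn_ord i; rewrite -ji ltnNge jge.
- by rewrite IH1 IH2 -big_split; apply: eq_bigr => i _; rewrite mulrzDr.
- by rewrite IH -sumrN; apply: eq_bigr => i _; rewrite mulrNz.
- by rewrite IH -sumrMnl; apply: eq_bigr => i _; rewrite mulrzA pmulrn.
Qed.

Lemma zexp_eq env e1 e2 :
  all (fun i => zcoef e1 i == zcoef e2 i) (iota 0 (size env)) ->
  zeval env e1 = zeval env e2.
Proof.
move=> /allP h; rewrite !zeval_coef; apply: eq_bigr => i _; congr (_ *~ _).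
by apply/eqP/h; rewrite mem_iota /= add0n.
Qed.
End AbelianNormalForm.

(* Atoms are compared up to conversion: instances of the same operation
   inferred along different paths are not syntactically equal. *)
Ltac zindex x l :=
  match l with
  | ?y :: _ => let _ := match goal with _ => unify x y end in constr:(0%N)
  | _ :: ?l' => let i := zindex x l' in constr:(S i)
  end.
Ltac zmember x l :=
  match l with
  | ?y :: _ => let _ := match goal with _ => unify x y end in constr:(true)
  | _ :: ?l' => zmember x l'
  | _ => constr:(false)
  end.
Ltac zatoms A l t :=
  lazymatch t with
  | @GRing.zero _ => l
  | @GRing.add _ ?a ?b => let l1 := zatoms A l a in zatoms A l1 b
  | @GRing.opp _ ?a => zatoms A l a
  | @GRing.natmul _ ?a _ => zatoms A l a
  | ?a => let m := zmember a l in
          lazymatch m with true => l | false => constr:(a :: l) end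
  end.
Ltac zreify l t :=
  lazymatch t with
  | @GRing.zero _ => constr:(ZZero)
  | @GRing.add _ ?a ?b => let e1 := zreify l a in let e2 := zreify l b in
                          constr:(ZAdd e1 e2)
  | @GRing.opp _ ?a => let e := zreify l a in constr:(ZOpp e)
  | @GRing.natmul _ ?a ?n => let e := zreify l a in constr:(ZMuln e n)
  | ?a => let i := zindex a l in constr:(ZVar i)
  end.
(* Coefficients [n] of [x *+ n] have to be numerals, since [zcoef] has to compute. *)
Ltac abelian :=
  lazymatch goal with
  | |- @eq ?A ?a ?b =>
    let l := zatoms A (@nil A) a in
    let l := zatoms A l b in
    let e1 := zreify l a in
    let e2 := zreify l b in
    exact (@zexp_eq _ l e1 e2 isT)
  end.

(** * Extending a cocycle to degenerate tuples *)

Section Extension.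
Variables (X : eqType) (A : zmodType) (G : X -> X -> X -> X -> A) (c : A).

(** When points collide the five-term relation involves the constant [c], up to sign
    the defect of antisymmetry of [G] in its middle arguments: these values are ones
    for which the relation persists, provided that [c] is killed by 3. *)
Definition extend_degenerate x y z w : A :=
  if [|| x == y, y == z | z == w] then 0
  else if (x == z) && (y == w) then 0
  else if [|| x == z, y == w | x == w] then c
  else G x y z w.

Hypothesis c3 : c *+ 3 = 0.
Hypothesis G01 : forall x y z w, uniq [:: x; y; z; w] -> G y x z w = - G x y z w.
Hypothesis G12 : forall x y z w, uniq [:: x; y; z; w] ->
  G x z y w = - c - G x y z w.
Hypothesis G23 : forall x y z w, uniq [:: x; y; z; w] -> G x y w z = - G x y z w.
Hypothesis G5 : forall x y z w u, uniq [:: x; y; z; w; u] ->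
  G y z w u - G x z w u + G x y w u - G x y z u + G x y z w = 0.

Ltac distinct := rewrite /= !inE !negb_or;
  repeat (apply/andP; split); rewrite ?andbT //; by rewrite eq_sym.
Local Notation E := extend_degenerate.

Let c2 : c + c = - c.
Proof. by apply/eqP; rewrite -subr_eq0 opprK -!mulr2n -mulrSr c3. Qed.

Lemma extend_degenerate_cocycle x y z w u :
  E y z w u - E x z w u + E x y w u - E x y z u + E x y z w = 0.
Proof.
rewrite /E.
(* All patterns of coincidence among the five points; seven of them do not follow
   from the relation [c + c = - c] alone. *)
repeat (match goal with |- context[?a == ?b] => case: (eqVneq a b) => [?|?]; [subst|] end; rewrite ?eqxx /=).
all: rewrite ?(subr0, sub0r, addr0, add0r, opprK, subrr, addrK, subrK, addNr) //.
all: try by match goal with H : is_true (?a != ?a) |- _ => rewrite eqxx in H end.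
all: try by rewrite c2 ?addNr ?addrN.
- rewrite (G12 (y := z) (z := w)); last by distinct.
  by rewrite -[RHS]c3; abelian.
- by rewrite (G23 (z := w) (w := u)) ?addrN //; distinct.
- rewrite (G12 (y := z) (z := u)); last by distinct.
  by rewrite (G23 (z := w) (w := u)); [abelian|distinct].
- by rewrite (G01 (x := y) (y := z)) ?addrN //; distinct.
- rewrite (G01 (x := y) (y := w)); last by distinct.
  by rewrite (G12 (y := z) (z := w)); [abelian|distinct].
- rewrite (G01 (x := y) (y := u)); last by distinct.
  rewrite (G12 (y := z) (z := u)); last by distinct.
  by rewrite (G23 (z := w) (w := u)); [abelian|distinct].
- by apply: G5; distinct.
Qed.
End Extension.

(** * The projective line and the cross ratio *)

Lemma det2E (R : comNzRingType) (M : 'M[R]_2) :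
  \det M = M ord0 ord0 * M ord_max ord_max - M ord0 ord_max * M ord_max ord0.
Proof.
rewrite (expand_det_row _ ord0) !big_ord_recl big_ord0 addr0 /cofactor !det_mx11.
rewrite !mxE /= expr0 mul1r expr1 mulN1r mulrN.
by congr (M _ _ * M _ _ - M _ _ * M _ _); apply: val_inj.
Qed.

(** A point of the projective line is an element of [option K], with [None] the
    point at infinity; [hvec] and [hpt] pass to homogeneous coordinates and back. *)
Section ProjectiveLine.
Variable K : fieldType.
Implicit Types (x y z w u : option K) (p q : K * K) (M N : 'M[K]_2).

Definition hvec x : K * K := if x is Some s then (s, 1) else (1, 0).
Definition hpt p : option K := if p.2 == 0 then None else Some (p.1 / p.2).
Definition hscale (l : K) p := (l * p.1, l * p.2).
Definition hact M p :=
  (M ord0 ord0 * p.1 + M ord0 ord_max * p.2,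
   M ord_max ord0 * p.1 + M ord_max ord_max * p.2).
Definition mobius M x := hpt (hact M (hvec x)).
Definition hdet p q := p.1 * q.2 - p.2 * q.1.
Definition pdet x y := hdet (hvec x) (hvec y).

Lemma pdet_eq0 x y : (pdet x y == 0) = (x == y).
Proof.
case: x y => [s|] [t|]; rewrite /pdet /hdet /=.
- by rewrite mulr1 mul1r subr_eq0.
- by rewrite mulr0 mul1r sub0r oppr_eq0 oner_eq0.
- by rewrite mulr1 mul0r subr0 oner_eq0.
- by rewrite mulr0 mul0r subrr !eqxx.
Qed.

Lemma hvec_neq0 x : hvec x != (0, 0).
Proof. by case: x => [s|]; rewrite /hvec xpair_eqE oner_eq0 ?andbF. Qed.

Lemma hpt_scale l p : l != 0 -> hpt (hscale l p) = hpt p.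
Proof.
move=> l0; rewrite /hpt /= mulf_eq0 (negPf l0) /=; case: eqP => // /eqP p2.
by congr Some; rewrite -mulf_div divff ?mul1r.
Qed.

Lemma hvecK x : hpt (hvec x) = x.
Proof. by case: x => [s|]; rewrite /hpt /= ?oner_eq0 ?divr1 ?eqxx. Qed.

Lemma hvec_hpt p : p != (0, 0) -> exists2 l : K, l != 0 & p = hscale l (hvec (hpt p)).
Proof.
case: p => s t; rewrite xpair_eqE /hpt /hscale /=; case: (eqVneq t 0) => [->|t0] h /=.
  by rewrite ?eqxx ?andbT in h; exists s; rewrite ?mulr1 ?mulr0.
by exists t; rewrite // mulrC divfK // mulr1.
Qed.

Lemma hact_scale M l p : hact M (hscale l p) = hscale l (hact M p).
Proof. by rewrite /hact /hscale /=; congr pair; ring. Qed.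

Lemma hactM M N p : hact (M *m N) p = hact M (hact N p).
Proof.
have e i j : (M *m N) i j = M i ord0 * N ord0 j + M i ord_max * N ord_max j.
  by rewrite mxE !big_ord_recl big_ord0 addr0; congr (_ + M _ _ * N _ _); apply: val_inj.
by rewrite /hact /= !e; congr pair; ring.
Qed.

Lemma hact_scalar (l : K) M p : hact (l *: M) p = hscale l (hact M p).
Proof. by rewrite /hact /hscale /= !mxE; congr pair; ring. Qed.

Lemma hdet_act M p q : hdet (hact M p) (hact M q) = \det M * hdet p q.
Proof. by rewrite /hdet /hact /= det2E; ring. Qed.

Lemma hdet_scale l m p q : hdet (hscale l p) (hscale m q) = l * m * hdet p q.
Proof. by rewrite /hdet /=; ring. Qed.

(** Recovers a row [(a, b)] of a matrix from its values on two independent vectors,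
    in the form in which the valuations of the entries can be read off. *)
Lemma cramer2 (a b c d l m : K) p q : l != 0 -> hdet p q != 0 ->
  a * p.1 + b * p.2 = l * c -> a * q.1 + b * q.2 = m * d ->
  l^-1 * a = (q.2 * c - p.2 * (m / l * d)) * (hdet p q)^-1 /\
  l^-1 * b = (p.1 * (m / l * d) - q.1 * c) * (hdet p q)^-1.
Proof.
move=> l0 d0 h1 h2; have -> : m / l * d = (a * q.1 + b * q.2) / l by rewrite h2 mulrAC.
have -> : c = (a * p.1 + b * p.2) / l by rewrite h1 mulrC mulKf.
by rewrite /hdet in d0 *; split; field; rewrite l0 d0.
Qed.

Lemma hact_neq0 M p : M \in unitmx -> p != (0, 0) -> hact M p != (0, 0).
Proof.
move=> Mu p0; apply/negP => /eqP h.
have h1 q : hdet p q = 0.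
  have := hdet_act M p q; rewrite h /hdet /= !mul0r subrr => /esym/eqP.
  have /negPf d0 : \det M != 0 by rewrite -unitfE.
  by rewrite mulf_eq0 d0 => /eqP.
move: p0 (h1 (0, 1)) (h1 (1, 0)); rewrite /hdet /=; case: p {h h1} => s t /=.
rewrite !mulr1 !mulr0 subr0 sub0r xpair_eqE => h s0 /eqP; rewrite oppr_eq0 => /eqP t0.
by move: h; rewrite s0 t0 eqxx.
Qed.

Lemma hact_hvec M x : M \in unitmx ->
  exists2 l : K, l != 0 & hact M (hvec x) = hscale l (hvec (mobius M x)).
Proof. by move=> Mu; apply: hvec_hpt; apply: hact_neq0 (hvec_neq0 x). Qed.

Lemma mobius_hpt M p : p != (0, 0) -> mobius M (hpt p) = hpt (hact M p).
Proof.
by move=> /hvec_hpt[l l0 e]; rewrite [in RHS]e hact_scale hpt_scale.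
Qed.

Lemma mobiusM M N x : N \in unitmx -> mobius (M *m N) x = mobius M (mobius N x).
Proof. by move=> Nu; rewrite [RHS]mobius_hpt ?hact_neq0 ?hvec_neq0 // /mobius hactM. Qed.

Lemma mobius1 x : mobius 1%:M x = x.
Proof.
rewrite /mobius (_ : hact _ _ = hvec x) ?hvecK // /hact !mxE /=.
by case: (hvec x) => s t /=; congr pair; ring.
Qed.

Lemma mobius_scale l M x : l != 0 -> mobius (l *: M) x = mobius M x.
Proof. by move=> l0; rewrite /mobius hact_scalar hpt_scale. Qed.

Lemma mobiusK M : M \in unitmx -> cancel (mobius M) (mobius (invmx M)).
Proof. by move=> Mu x; rewrite -mobiusM // mulVmx // mobius1. Qed.

Lemma mobius_inj M : M \in unitmx -> injective (mobius M).
Proof. by move=> Mu; apply: can_inj (mobiusK Mu). Qed.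

Lemma pdetC x y : pdet y x = - pdet x y.
Proof. by rewrite /pdet /hdet; ring. Qed.

(** Normalized by [cross_std]: the cross ratio of [0], [oo], [1], [s] is [s]. *)
Definition cross x y z w := pdet x w * pdet y z / (pdet x z * pdet y w).

Lemma cross_mobius M x y z w : M \in unitmx ->
  uniq [:: x; y; z; w] ->
  cross (mobius M x) (mobius M y) (mobius M z) (mobius M w) = cross x y z w.
Proof.
move=> Mu; have d0 : \det M != 0 by rewrite -unitfE.
have [lx lx0 ex] := hact_hvec x Mu; have [ly ly0 ey] := hact_hvec y Mu.
have [lz lz0 ez] := hact_hvec z Mu; have [lw lw0 ew] := hact_hvec w Mu.
have e (s t : K) a b : s != 0 -> t != 0 -> hact M (hvec a) = hscale s (hvec (mobius M a)) ->
  hact M (hvec b) = hscale t (hvec (mobius M b)) ->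
  pdet (mobius M a) (mobius M b) = \det M * pdet a b / (s * t).
  move=> s0 t0 ea eb; rewrite /pdet -hdet_act ea eb /hdet /=; field.
  by rewrite t0 s0.
rewrite /cross !(e _ _ _ _ _ _ ex ez, e _ _ _ _ _ _ ex ew, e _ _ _ _ _ _ ey ez, e _ _ _ _ _ _ ey ew) //.
rewrite /= !inE !negb_or => /and4P[/and3P[_ xz _] /andP[_ yw] _ _].
by field; rewrite lx0 ly0 lz0 lw0 d0 !pdet_eq0 xz yw.
Qed.

Lemma cross_std s : cross (Some 0) None (Some 1) (Some s) = s.
Proof.
by rewrite /cross /pdet /hdet /= !(mul0r, mulr1, mul1r, sub0r, subr0) invrN1 mulrN1 opprK.
Qed.

Lemma plucker x y z w :
  pdet x y * pdet z w - pdet x z * pdet y w + pdet x w * pdet y z = 0.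
Proof. by rewrite /pdet /hdet; ring. Qed.

Lemma cross_neq0 x y z w : uniq [:: x; y; z; w] -> cross x y z w != 0.
Proof.
rewrite /= !inE !negb_or => /and4P[/and3P[xy xz xw] /andP[yz yw] zw _].
by rewrite /cross !(mulf_neq0, invr_eq0) ?pdet_eq0.
Qed.

Lemma one_sub_cross x y z w : uniq [:: x; y; z; w] ->
  1 - cross x y z w = pdet x y * pdet z w / (pdet x z * pdet y w).
Proof.
rewrite /= !inE !negb_or => /and4P[/and3P[xy xz xw] /andP[yz yw] zw _].
have -> : pdet x y * pdet z w = pdet x z * pdet y w - pdet x w * pdet y z.
  by apply/eqP; rewrite -subr_eq0 -[X in _ == X](plucker x y z w); apply/eqP; ring.
by rewrite /cross; field; rewrite !pdet_eq0 xz yw.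
Qed.

Lemma cross_neq1 x y z w : uniq [:: x; y; z; w] -> cross x y z w != 1.
Proof.
move=> h; rewrite eq_sym -subr_eq0 one_sub_cross //.
move: h; rewrite /= !inE !negb_or => /and4P[/and3P[xy xz xw] /andP[yz yw] zw _].
by rewrite !(mulf_neq0, invr_eq0) ?pdet_eq0.
Qed.

Lemma cross01 x y z w : uniq [:: x; y; z; w] -> cross y x z w = (cross x y z w)^-1.
Proof.
rewrite /= !inE !negb_or => /and4P[/and3P[xy xz xw] /andP[yz yw] zw _].
by rewrite /cross; field; rewrite !pdet_eq0 xz yw xw yz.
Qed.

Lemma cross23 x y z w : uniq [:: x; y; z; w] -> cross x y w z = (cross x y z w)^-1.
Proof.
rewrite /= !inE !negb_or => /and4P[/and3P[xy xz xw] /andP[yz yw] zw _].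
by rewrite /cross; field; rewrite !pdet_eq0 xz yw xw yz.
Qed.

Lemma cross12 x y z w : uniq [:: x; y; z; w] ->
  cross x z y w = (1 - (cross x y z w)^-1)^-1.
Proof.
move=> h; have h0 := cross_neq0 h; have h1 := cross_neq1 h.
rewrite (_ : 1 - _ = - (1 - cross x y z w) / cross x y z w); last by field.
rewrite one_sub_cross //; move: h.
rewrite /= !inE !negb_or => /and4P[/and3P[xy xz xw] /andP[yz yw] zw _].
rewrite /cross (pdetC y z); field.
by rewrite !pdet_eq0 oppr_eq0 mulf_eq0 !pdet_eq0 negb_or xy xz yw xw yz zw.
Qed.

(** Here and in the next two lemmas, a quotient that occurs in the five-term relation is
    recognized as the cross ratio of four of the same five points. *)
Lemma cross_div x y z w u : uniq [:: x; y; z; w] -> uniq [:: x; y; z; u] ->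
  w != u -> cross x y z u / cross x y z w = cross x y w u.
Proof.
rewrite /= !inE !negb_or => /and4P[/and3P[xy xz xw] /andP[yz yw] zw _].
move=> /and4P[/and3P[_ _ xu] /andP[_ yu] zu _] wu.
by rewrite /cross; field; rewrite !pdet_eq0 xz yw xw yz yu.
Qed.

Lemma cross_div_sub x y z w u : uniq [:: x; y; z; w] -> uniq [:: x; y; z; u] ->
  w != u -> (1 - cross x y z w) / (1 - cross x y z u) = cross y z w u.
Proof.
move=> h1 h2 wu; rewrite !one_sub_cross //; move: h1 h2.
rewrite /= !inE !negb_or => /and4P[/and3P[xy xz xw] /andP[yz yw] zw _].
move=> /and4P[/and3P[_ _ xu] /andP[_ yu] zu _].
by rewrite /cross; field; rewrite !pdet_eq0 xy xz yw yu zu.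
Qed.

Lemma cross_div_subV x y z w u : uniq [:: x; y; z; w] -> uniq [:: x; y; z; u] ->
  w != u ->
  (1 - (cross x y z w)^-1) / (1 - (cross x y z u)^-1) = cross x z w u.
Proof.
move=> h1 h2 wu; have [n0 n1] := (cross_neq0 h1, cross_neq0 h2).
have [m0 m1] := (cross_neq1 h1, cross_neq1 h2).
have -> : (1 - (cross x y z w)^-1) / (1 - (cross x y z u)^-1) =
   (1 - cross x y z w) / (1 - cross x y z u) * (cross x y z u / cross x y z w).
  by field; rewrite !subr_eq0 n0 n1 m1 eq_sym m1.
rewrite cross_div_sub // cross_div //; move: h1 h2.
rewrite /= !inE !negb_or => /and4P[/and3P[xy xz xw] /andP[yz yw] zw _].
move=> /and4P[/and3P[_ _ xu] /andP[_ yu] zu _].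
by rewrite /cross; field; rewrite !pdet_eq0 ?xz ?yw ?xw ?zu ?yu ?yz ?xu.
Qed.

(** The two columns are representatives of [y] and [x], rescaled so that their sum
    represents [z]. *)
Lemma mobius_triple x y z : uniq [:: x; y; z] ->
  exists2 M : 'M[K]_2, M \in unitmx &
    [/\ mobius M (Some 0) = x, mobius M None = y & mobius M (Some 1) = z].
Proof.
rewrite /= !inE !negb_or => /and3P[/andP[xy xz] yz _].
pose a := pdet z y; pose b := pdet x z.
pose M := \matrix_(i < 2, j < 2)
  if j == ord0 then (if i == ord0 then b * (hvec y).1 else b * (hvec y).2)
  else (if i == ord0 then a * (hvec x).1 else a * (hvec x).2).
have a0 : a != 0 by rewrite pdet_eq0 eq_sym.
have b0 : b != 0 by rewrite pdet_eq0.
exists M.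
  rewrite unitmxE unitfE det2E !mxE /=.
  have -> : b * (hvec y).1 * (a * (hvec x).2) - a * (hvec x).1 * (b * (hvec y).2)
    = a * b * - pdet x y by rewrite /pdet /hdet; ring.
  by rewrite !mulf_neq0 // oppr_eq0 pdet_eq0.
split; rewrite /mobius.
- rewrite (_ : hact _ _ = hscale a (hvec x)) ?hpt_scale ?hvecK //.
  by rewrite /hact /hscale !mxE /=; congr pair; ring.
- rewrite (_ : hact _ _ = hscale b (hvec y)) ?hpt_scale ?hvecK //.
  by rewrite /hact /hscale !mxE /=; congr pair; ring.
rewrite (_ : hact _ _ = hscale (pdet x y) (hvec z)) ?hpt_scale ?hvecK ?pdet_eq0 //.
by rewrite /hact /hscale !mxE /= /a /b /pdet /hdet; congr pair; ring.
Qed.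
End ProjectiveLine.

(** * Symbols in the pre-Bloch group *)

Section QuotientLift.
Variables (A B : zmodType) (N : A -> Prop).
Local Open Scope quotient_scope.

Lemma quotient_relation a : N a -> \pi_(quotient_by N) a = 0.
Proof.
move=> Na; rewrite -[RHS](raddf0 (\pi_(quotient_by N))); apply/eqP.
by rewrite -Quotient.idealrBE subr0; apply/asboolP; apply: spannedG.
Qed.

Variable f : {additive A -> B}.
Hypothesis fN : forall a, N a -> f a = 0.

Definition quotient_lift of (forall a, N a -> f a = 0) := fun x : quotient_by N => f (repr x).

Lemma quotient_liftE a : quotient_lift fN (\pi_(quotient_by N) a) = f a.
Proof.
apply/eqP; rewrite -subr_eq0 -raddfB; apply/eqP.
have : spanned N (repr (\pi_(quotient_by N) a) - a).
  by apply/asboolP; rewrite -[asbool _]/(_ \in Defs.span N) Quotient.idealrBE reprK.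
move=> /(_ (fun w => f w = 0)); apply=> [|x y hx hy|]; rewrite ?raddf0 //.
by rewrite raddfB hx hy subrr.
Qed.

Fact quotient_lift_additive : zmod_morphism (quotient_lift fN).
Proof.
by elim/quotW=> x; elim/quotW=> y; rewrite -raddfB !quotient_liftE raddfB.
Qed.
HB.instance Definition _ :=
  GRing.isZmodMorphism.Build _ _ (quotient_lift fN) quotient_lift_additive.
End QuotientLift.

Section BlochSymbols.
Variable k : fieldType.
Implicit Types x y u w : k.
Local Open Scope quotient_scope.

Definition bloch x : preBloch k := \pi_(preBloch k) << x >>.

Lemma preBloch_ind (Q : preBloch k -> Prop) : Q 0 ->
  (forall p q, Q p -> Q q -> Q (p - q)) -> (forall x, Q (bloch x)) -> forall p, Q p.
Proof.
move=> Q0 QB Qx; elim/quotW; elim/free_ind => [|a b ha hb|x]; last exact: Qx.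
  by rewrite raddf0.
by rewrite raddfB; apply: QB.
Qed.

Lemma bloch_five_term x y : x != 0 -> x != 1 -> y != 0 -> y != 1 -> x != y ->
  bloch x - bloch y + bloch (y / x) - bloch ((1 - x^-1) / (1 - y^-1))
    + bloch ((1 - x) / (1 - y)) = 0.
Proof.
move=> x0 x1 y0 y1 xy; have := quotient_relation (five_term x0 x1 y0 y1 xy).
by rewrite !raddfD !raddfN.
Qed.

Let inv_sym w := bloch w + bloch w^-1.

(** Adding the five-term relations of [(x, y)] and of [(y, x)] leaves only the three terms [inv_sym u], [inv_sym w] and
    [inv_sym (u * w)], for the [x] and [y] with [y / x = u] and [(1 - x) / (1 - y) = w]. *)
Lemma inv_symM u w : u != 0 -> u != 1 -> w != 0 -> w != 1 -> u * w != 1 ->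
  inv_sym (u * w) = inv_sym u + inv_sym w.
Proof.
move=> u0 u1 w0 w1 uw1.
have d0 : u * w - 1 != 0 by rewrite subr_eq0.
pose x := (w - 1) / (u * w - 1); pose y := u * x.
have x0 : x != 0 by rewrite mulf_neq0 ?invr_neq0 // subr_eq0.
have y0 : y != 0 by rewrite mulf_neq0.
have e1 : x - 1 = w * (1 - u) / (u * w - 1) by rewrite /x; field.
have e2 : y - 1 = (1 - u) / (u * w - 1) by rewrite /y /x; field.
have x1 : x != 1 by rewrite -subr_eq0 e1 !mulf_neq0 ?invr_neq0 // subr_eq0 eq_sym.
have y1 : y != 1 by rewrite -subr_eq0 e2 !mulf_neq0 ?invr_neq0 // subr_eq0 eq_sym.
have xy : x != y.
  by rewrite -subr_eq0 /y -[X in X - _]mul1r -mulrBl mulf_neq0 // subr_eq0 eq_sym.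
have eu : y / x = u by rewrite /y mulfK.
have eu' : x / y = u^-1 by rewrite -eu invf_div.
have u1' : 1 - u != 0 by rewrite subr_eq0 eq_sym.
have ew : (1 - x) / (1 - y) = w.
  by rewrite -[1 - x]opprB -[1 - y]opprB e1 e2; field; rewrite d0 oppr_eq0 u1'.
have ew' : (1 - y) / (1 - x) = w^-1 by rewrite -ew invf_div.
have euw : (1 - x^-1) / (1 - y^-1) = u * w.
  rewrite -eu -ew; field.
  by rewrite x0 y0 !subr_eq0 y1 eq_sym y1.
have euw' : (1 - y^-1) / (1 - x^-1) = (u * w)^-1 by rewrite -euw [RHS]invf_div.
have r1 := bloch_five_term x0 x1 y0 y1 xy.
have r2 := bloch_five_term y0 y1 x0 x1 ltac:(by rewrite eq_sym).
rewrite eu ew euw in r1; rewrite eu' ew' euw' in r2.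
rewrite /inv_sym -[LHS]addr0 -[X in _ + X]addr0 -{1}r1 -r2; abelian.
Qed.

(** Multiplicativity for [u], [w] and for [u * w], [w^-1] gives
    [inv_sym u = inv_sym u + inv_sym w *+ 2]; an admissible [u] is missing only in the
    field with three elements. *)
Lemma inv_symK w : w != 0 -> w != 1 -> inv_sym w *+ 2 = 0.
Proof.
move=> w0 w1; have wV1 : w^-1 != 1 by rewrite invr_eq1.
have [[u [u0 u1 uw]]|no] := pselect (exists u, [/\ u != 0, u != 1 & u != w^-1]).
  have uw1 : u * w != 1.
    by apply: contra_neq uw => /(canRL (mulfK w0)); rewrite mul1r.
  have e1 := inv_symM u0 u1 w0 w1 uw1.
  have := @inv_symM (u * w) w^-1; rewrite mulfK // mulf_neq0 // invr_eq0.
  move=> /(_ isT uw1 w0 wV1 u1); rewrite e1.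
  have -> : inv_sym w^-1 = inv_sym w by rewrite /inv_sym invrK addrC.
  by rewrite -addrA -[LHS]addr0 => /addrI/esym; rewrite mulr2n.
have {}no u : [|| u == 0, u == 1 | u == w^-1].
  by apply: contra_notT no; rewrite !negb_or => /and3P[]; exists u.
have wV : w = w^-1 by move: (no w); rewrite (negPf w0) (negPf w1) => /eqP.
rewrite -wV in no.
have wN : w = -1.
  move: (no (-1)); rewrite oppr_eq0 oner_eq0 /=.
  case/orP=> [/eqP h|/eqP //].
  move: (no (w + 1)); rewrite -{1}h subr_eq0 (negPf w1) /=.
  by rewrite -subr_eq0 addrK (negPf w0) -subr_eq0 [w + 1]addrC addrK oner_eq0.
have h3 : has_card k 3.
  apply/eq_cardSP; exists 0 => //; apply/eq_cardSP; exists 1.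
    by split=> //= /eqP; rewrite oner_eq0.
  apply/eq_cardSP; exists w.
    by split; [split=> //= /eqP|move=> /= /eqP]; rewrite ?(negPf w0) ?(negPf w1).
  rewrite II0 card_eq0; apply/eqP/seteqP; split=> // u [[[_ /eqP u0] /eqP u1] /eqP uw].
  by move: (no u); rewrite (negPf u0) (negPf u1) (negPf uw).
have := quotient_relation (order_F3 h3); rewrite -wN raddfMn /= => <-.
by rewrite /inv_sym -wV -mulr2n -mulrnA.
Qed.

(** The five-term relations of [(x, y)] and of [(1 - y, 1 - x)] differ by this identity. *)
Lemma bloch_compl x y : x != 0 -> x != 1 -> y != 0 -> y != 1 ->
  bloch x + bloch (1 - x) = bloch y + bloch (1 - y).
Proof.
have [-> //|xy] := eqVneq x y; move=> x0 x1 y0 y1.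
have x1' : 1 - x != 0 by rewrite subr_eq0 eq_sym.
have y1' : 1 - y != 0 by rewrite subr_eq0 eq_sym.
have ne1 (z : k) : z != 0 -> 1 - z != 1.
  by move=> z0; rewrite -subr_eq0 addrAC subrr sub0r oppr_eq0.
have r1 := bloch_five_term x0 x1 y0 y1 xy.
have yx : 1 - y != 1 - x.
  by apply: contra_neq xy => /(congr1 (fun z => 1 - z)); rewrite !subKr.
have := bloch_five_term y1' (ne1 _ y0) x1' (ne1 _ x0) yx.
rewrite !subKr.
have -> : (1 - (1 - y)^-1) / (1 - (1 - x)^-1) = (1 - x^-1) / (1 - y^-1).
  by field; rewrite y0 x0 x1' y1' [1 - x - 1]addrAC subrr sub0r oppr_eq0 x0 subr_eq0 y1.
move=> r2; apply/eqP; rewrite -subr_eq0; apply/eqP.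
move: r1 r2; set A := bloch (_ / (1 - y^-1)); set B := bloch (_ / (1 - y)).
set C := bloch (y / x) => r1 r2.
by rewrite -[RHS](subrr 0) -{1}r1 -r2; abelian.
Qed.

(** The common value of [4 ([x] + [1 - x])], an element killed by 3.  In the
    field with two elements there is no such [x], and the generator [[0]] of
    order 3 takes its place. *)
Definition bloch_const : preBloch k :=
  if pselect (exists x : k, x != 0 /\ x != 1) is left h
  then (bloch (projT1 (cid h)) + bloch (1 - projT1 (cid h))) *+ 4 else bloch 0.

Lemma bloch_constE x : x != 0 -> x != 1 ->
  bloch_const = (bloch x + bloch (1 - x)) *+ 4.
Proof.
move=> x0 x1; rewrite /bloch_const; case: pselect => [h|[]]; last by exists x.
by case: cid => y [y0 y1] /=; rewrite (bloch_compl x0 x1 y0 y1).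
Qed.

Lemma bloch_inv x : x != 0 -> x != 1 -> bloch x^-1 *+ 4 = - (bloch x *+ 4).
Proof.
move=> x0 x1; apply/eqP; rewrite -addr_eq0 -mulrnDl addrC; apply/eqP.
by rewrite (mulrnA _ 2 2) inv_symK ?mul0rn.
Qed.

Lemma no_other_card2 : ~ (exists x : k, x != 0 /\ x != 1) -> has_card k 2.
Proof.
move=> no; apply/eq_cardSP; exists 0 => //; apply/eq_cardSP; exists 1.
  by split=> //= /eqP; rewrite oner_eq0.
rewrite II0 card_eq0; apply/eqP/seteqP; split=> // u [[_ /eqP u0] /eqP u1].
by case: no; exists u.
Qed.

(** The expressions of the constant at [x], [(1 - x)^-1] and [x^-1] add up to 0, because
    the symbols of [z] and [z^-1] cancel after multiplication by 4. *)
Lemma bloch_const3 : bloch_const *+ 3 = 0.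
Proof.
have [[x [x0 x1]]|no] := pselect (exists x : k, x != 0 /\ x != 1); last first.
  rewrite /bloch_const; case: pselect => // _.
  have := quotient_relation (order_F2 (no_other_card2 no)).
  by rewrite raddfMn.
have x1' : 1 - x != 0 by rewrite subr_eq0 eq_sym.
have ne1 (z : k) : z != 0 -> 1 - z != 1.
  by move=> z0; rewrite -subr_eq0 addrAC subrr sub0r oppr_eq0.
have e1 : 1 - (1 - x)^-1 = (1 - x^-1)^-1.
  by field; rewrite x0 x1' subr_eq0 x1.
have a0 : 1 - x^-1 != 0 by rewrite subr_eq0 eq_sym invr_eq1.
have a1 : 1 - x^-1 != 1 by rewrite ne1 // invr_eq0.
have b0 : (1 - x)^-1 != 0 by rewrite invr_eq0.
have b1 : (1 - x)^-1 != 1 by rewrite invr_eq1 ne1.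
rewrite !mulrS addr0 {1}(bloch_constE x0 x1) {1}(bloch_constE b0 b1).
rewrite (bloch_constE (x := x^-1)) ?invr_eq0 ?invr_eq1 // e1 !mulrnDl !bloch_inv ?ne1 //.
  by set b := bloch (1 - _^-1); abelian.
by rewrite invr_eq0.
Qed.

(** The factor 4 makes the symbol alternating up to [bloch_const]; on elements killed
    by 3 it is the identity. *)
Definition bloch_cocycle :=
  extend_degenerate (fun x y z w : option k => bloch (cross x y z w) *+ 4) bloch_const.

(** For five distinct points, this is the defining relation of the pre-Bloch group
    written with cross ratios. *)
Lemma bloch_cocycle5 (x y z w u : option k) :
  bloch_cocycle y z w u - bloch_cocycle x z w u + bloch_cocycle x y w u
    - bloch_cocycle x y z u + bloch_cocycle x y z w = 0.
Proof.
apply: extend_degenerate_cocycle; first exact: bloch_const3.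
- by move=> {}x {}y {}z {}w h; rewrite cross01 // bloch_inv ?cross_neq0 ?cross_neq1.
- move=> {}x {}y {}z {}w h; rewrite cross12 //.
  have n0 := cross_neq0 h; have n1 := cross_neq1 h.
  rewrite bloch_inv; first last.
  + by rewrite -subr_eq0 addrAC subrr sub0r oppr_eq0 invr_eq0.
  + by rewrite subr_eq0 eq_sym invr_eq1.
  rewrite (bloch_constE (x := (cross x y z w)^-1)) ?invr_eq0 ?invr_eq1 //.
  by rewrite mulrnDl bloch_inv //; set b := bloch (1 - _); abelian.
- by move=> {}x {}y {}z {}w h; rewrite cross23 // bloch_inv ?cross_neq0 ?cross_neq1.
move=> {}x {}y {}z {}w {}u; rewrite [uniq _]/= !inE !negb_or -!andbA.
case/and5P=> xy xz xw xu /and5P[yz yw yu zw /and3P[zu wu _]].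
have h1 : uniq [:: x; y; z; w] by rewrite /= !inE !negb_or xy xz xw yz yw zw.
have h2 : uniq [:: x; y; z; u] by rewrite /= !inE !negb_or xy xz xu yz yu zu.
have s01 : cross x y z w != cross x y z u.
  rewrite -(inj_eq (mulIf (invr_neq0 (cross_neq0 h1)))) mulfV ?cross_neq0 //.
  rewrite cross_div // eq_sym; apply: cross_neq1.
  by rewrite /= !inE !negb_or xy xw xu yw yu wu.
have := bloch_five_term (cross_neq0 h1) (cross_neq1 h1) (cross_neq0 h2) (cross_neq1 h2) s01.
rewrite cross_div // cross_div_sub // cross_div_subV // => e.
by rewrite -[RHS](mul0rn _ 4) -e; abelian.
Qed.

Lemma bloch_cocycle_mobius (M : 'M[k]_2) (x y z w : option k) : M \in unitmx ->
  bloch_cocycle (mobius M x) (mobius M y) (mobius M z) (mobius M w)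
    = bloch_cocycle x y z w.
Proof.
move=> Mu; rewrite /bloch_cocycle /extend_degenerate !(inj_eq (mobius_inj Mu)).
case: ifP => // /negbT; rewrite !negb_or => /and3P[xy yz zw].
case: ifP => // _; case: ifP => // /negbT; rewrite !negb_or => /and3P[xz yw xw].
by rewrite cross_mobius //= !inE !negb_or xy yz zw xz yw xw.
Qed.
End BlochSymbols.

Section BlochNatural.
Variables (k k' : fieldType) (tau : {rmorphism k -> k'}).
Hypothesis tau_bij : bijective tau.

Lemma preBloch_map_bloch x : preBloch_map tau (bloch x) = bloch (tau x).
Proof. by rewrite /bloch preBloch_mapE // /free_map liftU scale1r. Qed.

Lemma preBloch_mapB p q : preBloch_map tau (p - q) = preBloch_map tau p - preBloch_map tau q.
Proof.
elim/quotW: p => p; elim/quotW: q => q.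
by rewrite -raddfB !preBloch_mapE // !raddfB.
Qed.
HB.instance Definition _ :=
  GRing.isZmodMorphism.Build _ _ (preBloch_map tau) preBloch_mapB.

Lemma preBloch_mapMz n p : preBloch_map tau (p *~ n) = preBloch_map tau p *~ n.
Proof. exact: raddfMz. Qed.

Lemma preBloch_map_sum (I : Type) (r : seq I) (f : I -> preBloch k) :
  preBloch_map tau (\sum_(i <- r) f i) = \sum_(i <- r) preBloch_map tau (f i).
Proof. exact: raddf_sum. Qed.

Lemma preBloch_map_const : preBloch_map tau (bloch_const k) = bloch_const k'.
Proof.
have [g tK gK] := tau_bij.
have [[x [x0 x1]]|no] := pselect (exists x : k, x != 0 /\ x != 1).
  rewrite (bloch_constE x0 x1) (bloch_constE (x := tau x)) ?fmorph_eq0 ?fmorph_eq1 //.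
  by rewrite raddfMn raddfD /= !preBloch_map_bloch rmorphB rmorph1.
rewrite /bloch_const; case: pselect => // _; case: pselect => [[y [y0 y1]]|_].
  by case: no; exists (g y); rewrite -(fmorph_eq0 tau) -(fmorph_eq1 tau) gK.
by rewrite preBloch_map_bloch rmorph0.
Qed.

Lemma pdet_map x y : pdet (omap tau x) (omap tau y) = tau (pdet x y).
Proof.
by case: x y => [s|] [t|]; rewrite /pdet /hdet /= !(rmorphB, rmorphM) ?rmorph1 ?rmorph0.
Qed.

Lemma preBloch_map_cocycle x y z w :
  preBloch_map tau (bloch_cocycle x y z w) =
  bloch_cocycle (omap tau x) (omap tau y) (omap tau z) (omap tau w).
Proof.
have oi : injective (omap tau).
  by case=> [s|] [t|] //= [] /fmorph_inj ->.
rewrite /bloch_cocycle /extend_degenerate !(inj_eq oi).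
case: ifP => _; first by rewrite raddf0.
case: ifP => _; first by rewrite raddf0.
case: ifP => _; first exact: preBloch_map_const.
by rewrite raddfMn /= preBloch_map_bloch /cross !pdet_map fmorph_div !rmorphM.
Qed.
End BlochNatural.

(** * Reduction at a finite prime *)

Section Reduction.
Variables (F : fieldExtType rat) (v : finite_prime F).
Local Notation k := (residue v).
Local Notation Ov := (valring_pred v).
Local Open Scope quotient_scope.
Implicit Types (s t : F) (x y z w u : option F) (p q r : F * F) (g h M N : 'M[F]_2).

(** Residues of elements of the field rather than of the valuation ring, with the
    value 0 outside of it. *)
Definition residue_of s : k := if insub s is Some a then \pi_k (a : valring v) else 0.

Lemma residue_ofE (a : valring v) : residue_of (val a) = \pi_k a.
Proof. by rewrite /residue_of valK. Qed.

Lemma residue_of_lift s : Ov s -> exists2 a : valring v, val a = s & residue_of s = \pi_k a.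
Proof. by move=> Os; exists (Sub s Os); rewrite ?SubK // -residue_ofE SubK. Qed.

Lemma residue_ofB s t : Ov s -> Ov t -> residue_of (s - t) = residue_of s - residue_of t.
Proof.
move=> /residue_of_lift[a <- ->] /residue_of_lift[b <- ->].
by rewrite -[val a - val b]/(val (a - b)) residue_ofE raddfB.
Qed.

Lemma residue_ofD s t : Ov s -> Ov t -> residue_of (s + t) = residue_of s + residue_of t.
Proof.
move=> /residue_of_lift[a <- ->] /residue_of_lift[b <- ->].
by rewrite -[val a + val b]/(val (a + b)) residue_ofE raddfD.
Qed.

Lemma residue_ofM s t : Ov s -> Ov t -> residue_of (s * t) = residue_of s * residue_of t.
Proof.
move=> /residue_of_lift[a <- ->] /residue_of_lift[b <- ->].
by rewrite -[val a * val b]/(val (a * b)) residue_ofE rmorphM.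
Qed.

Lemma residue_of1 : residue_of 1 = 1.
Proof. by rewrite -[1 in LHS]/(val (1 : valring v)) residue_ofE rmorph1. Qed.

Lemma residue_of0 : residue_of 0 = 0.
Proof. by rewrite -[0 in LHS]/(val (0 : valring v)) residue_ofE raddf0. Qed.

Lemma residue_of_eq0 s : Ov s -> (residue_of s == 0) = valuation_ge v 1 s.
Proof.
move=> /residue_of_lift[a <- ->]; rewrite -[0](raddf0 \pi_k).
by rewrite -Quotient.idealrBE subr0.
Qed.

Lemma residue_of_surj (a : k) : exists2 s, Ov s & residue_of s = a.
Proof. by exists (val (repr a)); rewrite ?residue_ofE ?reprK //; exact: (valP (repr a)). Qed.

Lemma valring0 : Ov 0. Proof. by rewrite /valring_pred /valuation_ge eqxx. Qed.
Lemma valring1 : Ov 1.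
Proof. by rewrite /valring_pred /valuation_ge valuation1 lexx orbT. Qed.
Lemma valringB s t : Ov s -> Ov t -> Ov (s - t). Proof. exact: valuation_geB. Qed.
Lemma valringN s : Ov s -> Ov (- s).
Proof. by move=> Os; rewrite -sub0r; apply: valringB => //; exact: valring0. Qed.
Lemma valringD s t : Ov s -> Ov t -> Ov (s + t).
Proof. by move=> Os Ot; rewrite -[t]opprK; apply: valringB => //; exact: valringN. Qed.
Lemma valringM s t : Ov s -> Ov t -> Ov (s * t).
Proof. exact: (@valuation_geM _ v 0 0). Qed.
Lemma valringE s : s != 0 -> Ov s = (0 <= v s).
Proof. by move=> s0; rewrite /valring_pred /valuation_ge (negPf s0). Qed.

Lemma valuation_div s t : s != 0 -> t != 0 -> v (s / t) = v s - v t.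
Proof. by move=> s0 t0; rewrite valuationM ?invr_eq0 // valuationV. Qed.

Lemma residue_unit s : Ov s -> (residue_of s != 0) = (s != 0) && (v s == 0).
Proof.
move=> Os; rewrite residue_of_eq0 // /valuation_ge negb_or -ltNge.
case: (eqVneq s 0) => //= s0; rewrite valringE // in Os.
by rewrite eq_le Os andbT -ltzD1 add0r.
Qed.

(** An element of negative valuation reduces to the point at infinity. *)
Definition red x : option k :=
  if x is Some s then (if Ov s then Some (residue_of s) else None) else None.

Definition resv p : k * k := (residue_of p.1, residue_of p.2).
Definition primitive p := [&& Ov p.1, Ov p.2 & resv p != (0, 0)].

Lemma primitive_neq0 p : primitive p -> p != (0, 0).
Proof.
by case/and3P=> _ _; apply: contra_neq => ->; rewrite /resv residue_of0.
Qed.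

Lemma red_hpt p : primitive p -> red (hpt p) = hpt (resv p).
Proof.
case: p => s t /and3P[/= Os Ot]; rewrite /resv /hpt /= xpair_eqE.
have [t0 r0|t0 _] := eqVneq (residue_of t) 0.
  rewrite andbT residue_unit // in r0; case/andP: r0 => s0 /eqP vs.
  have [//|tn] := eqVneq t 0; rewrite /= valringE ?mulf_neq0 ?invr_eq0 //.
  rewrite valuation_div // vs sub0r oppr_ge0.
  move/eqP: t0; rewrite residue_of_eq0 // /valuation_ge (negPf tn) /= => t1.
  by rewrite leNgt (lt_le_trans _ t1).
have := t0; rewrite residue_unit // => /andP[tn /eqP vt].
rewrite (negPf tn) /=.
have Os' : Ov (s / t).
  by apply: valringM => //; rewrite valringE ?invr_eq0 // valuationV vt.
rewrite Os'; congr Some; apply: (mulIf t0); rewrite divfK //.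
by rewrite -residue_ofM // divfK.
Qed.

Lemma primitive_repr x : exists2 p, primitive p & hpt p = x.
Proof.
have O0 := valring0; have O1 := valring1; rewrite /primitive /resv.
case: x => [s|]; last first.
  exists (1, 0); last by rewrite /hpt /= eqxx.
  by rewrite /= O0 O1 residue_of1 residue_of0 xpair_eqE oner_eq0.
have [Os|nOs] := boolP (Ov s).
  exists (s, 1); last by rewrite /hpt /= oner_eq0 divr1.
  by rewrite /= Os O1 residue_of1 xpair_eqE oner_eq0 andbF.
have s0 : s != 0 by apply: contra nOs => /eqP ->.
exists (1, s^-1); last by rewrite /hpt /= invr_eq0 (negPf s0) invrK mul1r.
rewrite /= O1 residue_of1 xpair_eqE oner_eq0 andbT /= valringE ?invr_eq0 //.
by rewrite valuationV oppr_ge0; apply: ltW; rewrite ltNge -valringE.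
Qed.

(** [GL_2] of the valuation ring. *)
Definition integral_mx M := [&& [forall i, forall j, Ov (M i j)], \det M != 0 & v (\det M) == 0].
Definition resmx M : 'M[k]_2 := \matrix_(i, j) residue_of (M i j).

Lemma integral_mxP M : reflect [/\ forall i j, Ov (M i j), \det M != 0 & v (\det M) = 0]
  (integral_mx M).
Proof.
apply: (iffP and3P) => [[/forallP h d0 /eqP vd]|[h d0 vd]]; split=> //.
- by move=> i j; have /forallP := h i.
- by apply/forallP => i; apply/forallP.
- exact/eqP.
Qed.

Lemma hact_primitive M p : integral_mx M -> primitive p ->
  primitive (hact M p) /\ resv (hact M p) = hact (resmx M) (resv p).
Proof.
move=> /integral_mxP[OM d0 vd] /and3P[O1 O2 p0].
have e : resv (hact M p) = hact (resmx M) (resv p).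
  by rewrite /resv /hact /= !mxE !residue_ofD ?residue_ofM //; apply: valringM.
split=> //; rewrite /primitive e hact_neq0 // ?andbT.
  by rewrite /= !valringD // valringM.
rewrite unitmxE unitfE det2E !mxE -!residue_ofM // -residue_ofB; try exact: valringM.
by rewrite -det2E residue_unit ?vd ?d0 // valringE // vd.
Qed.

Lemma resmx_unit M : integral_mx M -> resmx M \in unitmx.
Proof.
move=> /integral_mxP[OM d0 vd].
rewrite unitmxE unitfE det2E !mxE -!residue_ofM // -residue_ofB; try exact: valringM.
by rewrite -det2E residue_unit ?vd ?d0 // valringE // vd.
Qed.

Lemma red_mobius M x : integral_mx M -> red (mobius M x) = mobius (resmx M) (red x).
Proof.
move=> hM; have [p pp <-] := primitive_repr x.
have [pM e] := hact_primitive hM pp.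
rewrite mobius_hpt ?primitive_neq0 // red_hpt // e red_hpt // mobius_hpt //.
by case/and3P: pp.
Qed.
End Reduction.

(** * The sum over the Bruhat-Tits tree *)

Section Tree.
Variables (F : fieldExtType rat) (v : finite_prime F).
Local Notation k := (residue v).
Local Notation Ov := (valring_pred v).
Implicit Types (s t l : F) (x y z w u : option F) (p q r : F * F) (g h M N : 'M[F]_2).

Lemma det_neq0 g : g \in unitmx -> \det g != 0.
Proof. by rewrite unitmxE unitfE. Qed.

Lemma integral_mx1 : integral_mx v 1%:M.
Proof.
apply/integral_mxP; rewrite det1 valuation1; split=> // [i j|]; last exact: oner_neq0.
by rewrite mxE; case: eqP => _; [exact: valring1|exact: valring0].
Qed.

Lemma integral_mxM M N : integral_mx v M -> integral_mx v N -> integral_mx v (M *m N).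
Proof.
move=> /integral_mxP[OM dM vM] /integral_mxP[ON dN vN]; apply/integral_mxP.
rewrite det_mulmx valuationM // vM vN mulf_neq0 //; split=> // i j.
rewrite mxE !big_ord_recl big_ord0 addr0.
by apply: valringD; apply: valringM.
Qed.

Lemma integral_mxV M : integral_mx v M -> integral_mx v (invmx M).
Proof.
move=> /integral_mxP[OM dM vM]; apply/integral_mxP.
have Mu : M \in unitmx by rewrite unitmxE unitfE.
rewrite det_inv valuationV vM invr_eq0; split=> // i j.
rewrite /invmx Mu !mxE; apply: valringM.
  by rewrite valringE ?invr_eq0 // valuationV vM.
rewrite /cofactor det_mx11 !mxE -signr_odd; apply: valringM => //.
by case: odd; rewrite ?expr0 ?expr1; [apply: valringN|]; exact: valring1.
Qed.

Lemma integral_mx_unit M : integral_mx v M -> M \in unitmx.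
Proof. by move=> /integral_mxP[OM dM vM]; rewrite unitmxE unitfE. Qed.

(** Vertices of the tree are the classes of [GL_2(F)] modulo left
    multiplication by scalars and by [GL_2] of the valuation ring: the class of
    [g] is the homothety class of the lattice that [g] carries to the standard
    one. *)
Definition same_vertex g h :=
  exists l M, [/\ l != 0, integral_mx v M & h = l *: (M *m g)].

Lemma same_vertex_refl g : same_vertex g g.
Proof. by exists 1, 1%:M; rewrite oner_neq0 integral_mx1 mul1mx scale1r. Qed.

Lemma same_vertex_sym g h : same_vertex g h -> same_vertex h g.
Proof.
move=> [l [M [l0 hM ->]]]; exists l^-1, (invmx M); rewrite invr_eq0 l0 integral_mxV //.
by rewrite -scalemxAr scalerA mulVf // scale1r mulmxA mulVmx ?mul1mx ?integral_mx_unit.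
Qed.

Lemma same_vertex_trans g h (j : 'M[F]_2) : same_vertex g h -> same_vertex h j -> same_vertex g j.
Proof.
move=> [l [M [l0 hM ->]]] [m [N [m0 hN ->]]]; exists (m * l), (N *m M).
by rewrite mulf_neq0 // integral_mxM // -scalemxAr scalerA mulmxA.
Qed.

Lemma same_vertex_unit g h : same_vertex g h -> g \in unitmx -> h \in unitmx.
Proof.
move=> [l [M [l0 hM ->]]] gu; rewrite unitmxZ ?unitfE // unitmx_mul gu andbT.
exact: integral_mx_unit.
Qed.

Lemma same_vertexM g h N : same_vertex g h -> same_vertex (g *m N) (h *m N).
Proof.
by move=> [l [M [l0 hM ->]]]; exists l, M; rewrite -scalemxAl mulmxA.
Qed.

(** A representative of each class, over which sums can range. *)
Definition canonical_vertex g : 'M[F]_2 := xget 0 [set h | same_vertex g h]%classic.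

Lemma canonical_vertexP g : same_vertex g (canonical_vertex g).
Proof.
by rewrite /canonical_vertex; apply: (@xgetPex _ 0 [set h | same_vertex g h]%classic);
  exists g; exact: same_vertex_refl.
Qed.

Lemma canonical_vertex_eq g h : same_vertex g h -> canonical_vertex g = canonical_vertex h.
Proof.
move=> gh; congr (xget 0 _); apply/seteqP; split=> j /=; last exact: same_vertex_trans.
exact/same_vertex_trans/same_vertex_sym.
Qed.

Definition vertices : set 'M[F]_2 :=
  [set g | g \in unitmx /\ canonical_vertex g = g]%classic.

Lemma canonical_vertex_in g : g \in unitmx -> vertices (canonical_vertex g).
Proof.
move=> gu; split; first exact: same_vertex_unit (canonical_vertexP g) gu.
exact/esym/canonical_vertex_eq/canonical_vertexP.
Qed.

Lemma signzD (m n : int) : (-1) ^ (m + n) = (-1) ^ m * (-1) ^ n :> int.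
Proof. by rewrite exprzDr ?unitrN1. Qed.

Lemma signz_sqr (m : int) : (-1) ^ m * (-1) ^ m = 1 :> int.
Proof. by rewrite expN1r -exprD addnn -muln2 mulnC exprM sqrrN !expr1n. Qed.

(** The type of a vertex: its parity in the bipartite tree. *)
Definition parity g : int := (-1) ^ v (\det g).

Lemma parityM g h : g \in unitmx -> h \in unitmx -> parity (g *m h) = parity g * parity h.
Proof. by move=> gu hu; rewrite /parity det_mulmx valuationM ?det_neq0 // signzD. Qed.

Lemma parity_same g h : g \in unitmx -> same_vertex g h -> parity g = parity h.
Proof.
move=> gu [l [M [l0 /integral_mxP[_ dM vM] ->]]].
have g0 := det_neq0 gu; rewrite /parity detZ det_mulmx expr2.
rewrite (valuationM v (mulf_neq0 l0 l0) (mulf_neq0 dM g0)).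
by rewrite (valuationM v l0 l0) (valuationM v dM g0) vM add0r !signzD signz_sqr mul1r.
Qed.

Lemma hpt_eq_scale (p q : F * F) : p != (0, 0) -> q != (0, 0) -> hpt p = hpt q ->
  exists2 l : F, l != 0 & p = hscale l q.
Proof.
move=> /hvec_hpt[l l0 ep] /hvec_hpt[m m0 eq] e; exists (l / m).
  by rewrite mulf_neq0 ?invr_eq0.
by rewrite ep e [in RHS]eq /hscale /=; congr pair; rewrite mulrA divfK.
Qed.

Lemma red_hdet p q : primitive v p -> primitive v q -> red v (hpt p) != red v (hpt q) ->
  hdet p q != 0 /\ v (hdet p q) = 0.
Proof.
move=> pp pq; rewrite !red_hpt //.
have /and3P[p1 p2 p0] := pp; have /and3P[q1 q2 q0] := pq => ne.
have Od : Ov (hdet p q) by apply: valringB; apply: valringM.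
have : residue_of v (hdet p q) != 0.
  rewrite residue_ofB ?residue_ofM //; try exact: valringM.
  rewrite -[_ - _]/(hdet (resv v p) (resv v q)).
  have [l l0 ->] := hvec_hpt p0; have [m m0 ->] := hvec_hpt q0.
  by rewrite hdet_scale !mulf_neq0 // -/(pdet _ _) pdet_eq0.
by rewrite residue_unit // => /andP[-> /eqP ->].
Qed.

(** Represent the three points and their images by primitive vectors, [N] acting by the
    factors [l], [m], [n].  The determinants of pairs of these vectors are units, so that
    each product of two of the factors has the valuation of [det N]: the factors have
    the same valuation, and [N] is integral once divided by [l]. *)
Lemma branching_integral N x y z : N \in unitmx ->
  uniq [seq red v i | i <- [:: x; y; z]] ->
  uniq [seq red v (mobius N i) | i <- [:: x; y; z]] ->
  exists2 l : F, l != 0 & integral_mx v (l^-1 *: N).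
Proof.
move=> Nu; rewrite /= !inE !negb_or.
have [p pp <-] := primitive_repr v x; have [q pq <-] := primitive_repr v y.
have [r pr <-] := primitive_repr v z.
have scal a : primitive v a -> exists b l, [/\ primitive v b, l != 0,
    mobius N (hpt a) = hpt b & hact N a = hscale l b].
  move=> pa; have [b pb eb] := primitive_repr v (mobius N (hpt a)); exists b.
  have [|||l l0 el] := @hpt_eq_scale (hact N a) b.
  - by rewrite hact_neq0 ?(primitive_neq0 pa).
  - exact: primitive_neq0 pb.
  - by rewrite eb mobius_hpt ?(primitive_neq0 pa).
  by exists l; rewrite eb.
have [p1 [l [pp1 l0 -> ep]]] := scal p pp.
have [q1 [m [pq1 m0 -> eq]]] := scal q pq.
have [r1 [n [pr1 n0 -> er]]] := scal r pr.
move=> /and3P[/andP[npq npr] nqr _] /and3P[/andP[npq1 npr1] nqr1 _].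
have dN := det_neq0 Nu.
have ev a b a1 b1 s t : s != 0 -> t != 0 -> primitive v a -> primitive v b ->
    primitive v a1 -> primitive v b1 -> hact N a = hscale s a1 ->
    hact N b = hscale t b1 -> red v (hpt a) != red v (hpt b) ->
    red v (hpt a1) != red v (hpt b1) -> v (\det N) = v s + v t.
  move=> s0 t0 pa pb pa1 pb1 ea eb nab nab1.
  have [d0 vd] := red_hdet pa pb nab; have [d10 vd1] := red_hdet pa1 pb1 nab1.
  have := congr1 v (hdet_act N a b); rewrite ea eb.
  by rewrite hdet_scale !valuationM ?mulf_neq0 // vd vd1 !addr0 => ->.
have v1 := ev _ _ _ _ _ _ l0 m0 pp pq pp1 pq1 ep eq npq npq1.
have v2 := ev _ _ _ _ _ _ l0 n0 pp pr pp1 pr1 ep er npr npr1.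
have v3 := ev _ _ _ _ _ _ m0 n0 pq pr pq1 pr1 eq er nqr nqr1.
have vml : v m = v l by move: v3; rewrite v2 => /addIr.
have vN : v (\det N) = v l + v l by rewrite v1 vml.
have [d0 vd] := red_hdet pp pq npq.
exists l => //.
apply/integral_mxP; rewrite detZ mulf_neq0 ?expf_neq0 ?invr_eq0 //; split=> //; last first.
  by rewrite expr2 !valuationM ?mulf_neq0 ?invr_eq0 // !valuationV vN addrACA addNr addr0.
have /and3P[Op1 Op2 _] := pp; have /and3P[Oq1 Oq2 _] := pq.
have /and3P[Op11 Op12 _] := pp1; have /and3P[Oq11 Oq12 _] := pq1.
have Om : Ov (m / l).
  by rewrite valringE ?mulf_neq0 ?invr_eq0 // valuation_div // vml subrr.
have Od : Ov (hdet p q)^-1 by rewrite valringE ?invr_eq0 // valuationV vd.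
have ep1 := congr1 fst ep; have ep2 := congr1 snd ep.
have eq1 := congr1 fst eq; have eq2 := congr1 snd eq.
rewrite /hact /hscale /= in ep1 ep2 eq1 eq2.
have solve (a b c d : F) : Ov c -> Ov d -> a * p.1 + b * p.2 = l * c ->
    a * q.1 + b * q.2 = m * d -> Ov (l^-1 * a) /\ Ov (l^-1 * b).
  move=> Oc Od1 h1 h2; have [-> ->] := cramer2 l0 d0 h1 h2.
  by split; do ?[exact: Om|apply: valringB|apply: valringM].
have [h00 h01] := solve _ _ _ _ Op11 Oq11 ep1 eq1.
have [h10 h11] := solve _ _ _ _ Op12 Oq12 ep2 eq2.
have two (i : 'I_2) : i = ord0 \/ i = ord_max.
  by case: i => [[|[|]]] //= hi; [left|right]; exact: val_inj.
by move=> i j; rewrite !mxE; case: (two i) => ->; case: (two j) => ->.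
Qed.

(** Three ends of a tree have a single branching vertex, the only one from which they
    leave in three distinct directions. *)
Lemma branching_unique g h x y z : g \in unitmx -> h \in unitmx ->
  uniq [seq red v (mobius g i) | i <- [:: x; y; z]] ->
  uniq [seq red v (mobius h i) | i <- [:: x; y; z]] -> same_vertex g h.
Proof.
move=> gu hu ug uh; pose N := h *m invmx g.
have Nu : N \in unitmx by rewrite unitmx_mul hu unitmx_inv.
have eN : h = N *m g by rewrite -mulmxA mulVmx // mulmx1.
have [||l l0 hN] := @branching_integral N (mobius g x) (mobius g y) (mobius g z) Nu.
- exact: ug.
- have e i : mobius h i = mobius N (mobius g i) by rewrite -mobiusM -?eN.
  by rewrite /= -!e.
exists l, (l^-1 *: N); split=> //.
by rewrite eN -scalemxAl scalerA mulfV // scale1r.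
Qed.
End Tree.

Lemma fsum_finite (A : zmodType) (T : choiceType) (D : set T) (f : T -> A) :
  finite_set D -> \sum_(i \in D) f i = \sum_(i <- fset_set D) f i.
Proof. by move=> fD; rewrite fsbig_finite. Qed.

Lemma sum_cocycle5 (A : zmodType) (T : Type) (r : seq T) (P : pred T)
    (f1 f2 f3 f4 f5 : T -> A) :
  (forall i, f1 i - f2 i + f3 i - f4 i + f5 i = 0) ->
  \sum_(i <- r | P i) f1 i - \sum_(i <- r | P i) f2 i + \sum_(i <- r | P i) f3 i
    - \sum_(i <- r | P i) f4 i + \sum_(i <- r | P i) f5 i = 0.
Proof.
by move=> h; rewrite -!sumrN -!big_split /=; apply: big1 => i _; exact: h.
Qed.

Section TreeCocycle.
Variables (F : fieldExtType rat) (v : finite_prime F).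
Local Notation k := (residue v).
Implicit Types (x y z w u : option F) (g h M : 'M[F]_2).

(** The contribution of the vertex [g] of the tree: the four points are seen from this
    vertex as four directions, points of the projective line over the residue field. *)
Definition local_term g x y z w : preBloch k :=
  bloch_cocycle (red v (mobius g x)) (red v (mobius g y)) (red v (mobius g z))
    (red v (mobius g w)) *~ parity v g.

Lemma local_term_same g h x y z w : g \in unitmx -> same_vertex v g h ->
  local_term g x y z w = local_term h x y z w.
Proof.
move=> gu gh; have e := parity_same gu gh; have [l [M [l0 hM eh]]] := gh.
have em i : red v (mobius h i) = mobius (resmx v M) (red v (mobius g i)).
  by rewrite eh mobius_scale // mobiusM // red_mobius.
rewrite /local_term !em bloch_cocycle_mobius ?resmx_unit //.
by move: (bloch_cocycle _ _ _ _) => t; rewrite e.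
Qed.

Lemma local_term_canonical g x y z w : g \in unitmx ->
  local_term (canonical_vertex v g) x y z w = local_term g x y z w.
Proof. by move=> gu; rewrite -(local_term_same _ _ _ _ gu (canonical_vertexP v g)). Qed.

Lemma local_term5 g x y z w u :
  local_term g y z w u - local_term g x z w u + local_term g x y w u
    - local_term g x y z u + local_term g x y z w = 0.
Proof. by rewrite /local_term -!(mulrzBl, mulrzDl) bloch_cocycle5 mul0rz. Qed.

(** This is what makes the sum over the tree finite: a vertex contributes only if it
    is the branching vertex of three of the four points. *)
Lemma bloch_cocycle_support (K : fieldType) (x y z w : option K) :
  bloch_cocycle x y z w != 0 ->
  [|| uniq [:: x; y; z], uniq [:: x; y; w], uniq [:: x; z; w] | uniq [:: y; z; w]].
Proof.
rewrite /bloch_cocycle /extend_degenerate /= !inE !andbT !negb_or.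
case: (eqVneq x y) => [_|xy]; first by rewrite eqxx.
case: (eqVneq y z) => [_|yz]; first by rewrite eqxx.
case: (eqVneq z w) => [_|zw]; first by rewrite eqxx.
have [->|xz] := eqVneq x z => //=.
by have [_|yw] := eqVneq y w; rewrite ?eqxx //= ?andbT ?orbT.
Qed.

Definition branching x y z : set 'M[F]_2 :=
  [set g | vertices v g /\ uniq [seq red v (mobius g i) | i <- [:: x; y; z]]]%classic.

Lemma finite_branching x y z : finite_set (branching x y z).
Proof.
have [[g [[gu ga] gb]]|no] := pselect (exists g, branching x y z g); last first.
  suff -> : branching x y z = set0 by exact: finite_set0.
  by apply/seteqP; split=> // g hg; apply: no; exists g.
suff -> : branching x y z = [set g]%classic by exact: finite_set1.
apply/seteqP; split=> [h [[hu ha] hb]|_ ->] //=.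
by rewrite -ga -ha; apply/esym/canonical_vertex_eq/(branching_unique gu hu gb hb).
Qed.

Definition term_support x y z w : set 'M[F]_2 :=
  (branching x y z `|` branching x y w `|` (branching x z w `|` branching y z w))%classic.

Lemma finite_term_support x y z w : finite_set (term_support x y z w).
Proof. by rewrite /term_support !finite_setU; split; split; exact: finite_branching. Qed.

Lemma term_supportP x y z w g : vertices v g -> ~ term_support x y z w g ->
  local_term g x y z w = 0.
Proof.
move=> vg; apply: contra_notP => /eqP h.
have : bloch_cocycle (red v (mobius g x)) (red v (mobius g y)) (red v (mobius g z))
    (red v (mobius g w)) != 0.
  by apply: contra_neq h => h; rewrite /local_term h mul0rz.
case/bloch_cocycle_support/or4P => h'; [left; left|left; right|right; left|right; right];
  by split.
Qed.

Definition tree_cocycle x y z w : preBloch k :=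
  \sum_(g \in vertices v) local_term g x y z w.

Lemma tree_cocycle_widen (D : set 'M[F]_2) x y z w : (D `<=` vertices v)%classic ->
  (term_support x y z w `<=` D)%classic ->
  tree_cocycle x y z w = \sum_(g \in D) local_term g x y z w.
Proof.
move=> DV SD; apply/esym/fsbig_widen => // g [Vg nDg] /=.
by apply: term_supportP => // /SD.
Qed.

Lemma tree_cocycle_finite (D : set 'M[F]_2) x y z w : (D `<=` vertices v)%classic ->
  finite_set D -> (term_support x y z w `<=` D)%classic ->
  tree_cocycle x y z w = \sum_(g <- fset_set D) local_term g x y z w.
Proof. by move=> DV fD SD; rewrite (tree_cocycle_widen DV SD) fsum_finite. Qed.

Lemma term_support_sub x y z w : (term_support x y z w `<=` vertices v)%classic.
Proof. by move=> g [[|]|[|]] []. Qed.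

Lemma tree_cocycle5 x y z w u :
  tree_cocycle y z w u - tree_cocycle x z w u + tree_cocycle x y w u
    - tree_cocycle x y z u + tree_cocycle x y z w = 0.
Proof.
pose D := (term_support y z w u `|` (term_support x z w u `|` (term_support x y w u
  `|` (term_support x y z u `|` term_support x y z w))))%classic.
have DV : (D `<=` vertices v)%classic.
  by move=> g [|[|[|[|]]]]; apply: term_support_sub.
have fD : finite_set D by do 4![rewrite finite_setU; split; first exact: finite_term_support]; exact: finite_term_support.
rewrite (tree_cocycle_finite DV fD (x := y) (y := z) (z := w) (w := u)); last by move=> g ?; left.
rewrite (tree_cocycle_finite DV fD (x := x) (y := z) (z := w) (w := u)); last by move=> g ?; right; left.
rewrite (tree_cocycle_finite DV fD (x := x) (y := y) (z := w) (w := u)); last by move=> g ?; do 2!right; left.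
rewrite (tree_cocycle_finite DV fD (x := x) (y := y) (z := z) (w := u)); last by move=> g ?; do 3!right; left.
rewrite (tree_cocycle_finite DV fD (x := x) (y := y) (z := z) (w := w)); last by move=> g ?; do 4!right.
apply: sum_cocycle5 => g; exact: local_term5.
Qed.

(** Translation by [M] permutes the vertices and changes their types by the parity of
    the valuation of [det M]. *)
Lemma tree_cocycle_mobius M x y z w : M \in unitmx ->
  tree_cocycle (mobius M x) (mobius M y) (mobius M z) (mobius M w)
    = tree_cocycle x y z w *~ parity v M.
Proof.
move=> Mu; have MVu : invmx M \in unitmx by rewrite unitmx_inv.
have -> : tree_cocycle x y z w =
    \sum_(g \in vertices v) local_term (canonical_vertex v (g *m M)) x y z w.
  apply: (reindex_fsbig (fun g => canonical_vertex v (g *m M))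
    (vertices v) (vertices v)); split.
  - by move=> g [gu _] /=; apply: canonical_vertex_in; rewrite unitmx_mul gu.
  - move=> g h /set_mem[gu ga] /set_mem[hu ha] e; rewrite -ga -ha.
    apply: canonical_vertex_eq; rewrite -[g](mulmxK Mu) -[h](mulmxK Mu).
    apply: same_vertexM; apply: same_vertex_trans (canonical_vertexP v _) _.
    by rewrite e; apply/same_vertex_sym/canonical_vertexP.
  move=> h [hu ha] /=; exists (canonical_vertex v (h *m invmx M)).
    by apply: canonical_vertex_in; rewrite unitmx_mul hu.
  rewrite -[RHS]ha; apply/esym/canonical_vertex_eq.
  rewrite -[X in same_vertex _ X _](mulmxKV Mu h).
  by apply: same_vertexM; apply: canonical_vertexP.
have e g : vertices v g -> local_term g (mobius M x) (mobius M y) (mobius M z) (mobius M w)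
    = local_term (canonical_vertex v (g *m M)) x y z w *~ parity v M.
  move=> [gu _]; have gMu : g *m M \in unitmx by rewrite unitmx_mul gu.
  rewrite local_term_canonical // /local_term !mobiusM //.
  move: (bloch_cocycle _ _ _ _) => t; rewrite parityM //.
  by rewrite -mulrzA -mulrA [parity v M]/parity signz_sqr mulr1.
pose D := term_support (mobius M x) (mobius M y) (mobius M z) (mobius M w).
have DV : (D `<=` vertices v)%classic by exact: term_support_sub.
have fD : finite_set D by exact: finite_term_support.
rewrite (tree_cocycle_finite DV fD) //.
have -> : \sum_(g \in vertices v) local_term (canonical_vertex v (g *m M)) x y z w =
    \sum_(g <- fset_set D) local_term (canonical_vertex v (g *m M)) x y z w.
  transitivity (\sum_(g \in D) local_term (canonical_vertex v (g *m M)) x y z w).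
    apply/esym/fsbig_widen => // g [Vg nDg] /=; have := e _ Vg.
    rewrite (term_supportP Vg nDg) => /(congr1 (fun t => t *~ parity v M)).
    move: (local_term _ _ _ _ _) => t; rewrite mul0rz -mulrzA [parity v M]/parity.
    by rewrite signz_sqr mulr1z.
  exact: fsum_finite.
rewrite mulrz_suml; apply: eq_big_seq => g; rewrite in_fset_set // => /set_mem /DV.
exact: e.
Qed.
End TreeCocycle.

(** * Classes of cocycles on the homology of a group *)

Section Cochains.
Variables (G : groupType) (A : zmodType).

Definition cochain_eval n (phi : {ffun 'I_n -> G} -> A) (c : chain G n) : A :=
  fglift (phi : _ -> zmodule A) c.

Fact cochain_eval_additive n phi : zmod_morphism (@cochain_eval n phi).
Proof. by move=> x y; rewrite /cochain_eval raddfB. Qed.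
HB.instance Definition _ n phi :=
  GRing.isZmodMorphism.Build (chain G n) A (@cochain_eval n phi) (@cochain_eval_additive n phi).

Lemma cochain_evalU n phi g : @cochain_eval n phi << g >> = phi g.
Proof. by rewrite /cochain_eval liftU scale1r. Qed.

Lemma eq_cochain_eval n phi psi (c : chain G n) : phi =1 psi ->
  cochain_eval phi c = cochain_eval psi c.
Proof. by move=> h; congr (cochain_eval _ c); apply: funext. Qed.

Definition coboundary n (phi : {ffun 'I_n -> G} -> A) (g : {ffun 'I_n.+1 -> G}) : A :=
  \sum_(i < n.+2) phi (face i g) *~ (-1) ^+ i.

Lemma cochain_eval_boundary n phi (c : chain G n.+1) :
  cochain_eval phi (boundary c) = cochain_eval (coboundary phi) c.
Proof.
elim/free_ind: c => [|x y hx hy|g]; first by rewrite !raddf0.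
  rewrite boundary_additive [RHS]cochain_eval_additive -hx -hy.
  exact: cochain_eval_additive.
rewrite cochain_evalU /= liftU scale1r raddf_sum; apply: eq_bigr => i _.
rewrite -signr_odd; case: (odd i); rewrite ?expr0 ?expr1 ?scaleN1r ?scale1r ?mulr1z.
  by rewrite raddfN /= cochain_evalU mulrN1z.
exact: cochain_evalU.
Qed.

Lemma cochain_evalB n phi psi (c : chain G n) :
  cochain_eval (fun g => phi g - psi g) c = cochain_eval phi c - cochain_eval psi c.
Proof.
elim/free_ind: c => [|x y hx hy|g]; first by rewrite !raddf0 addr0.
  by rewrite !cochain_eval_additive hx hy; abelian.
by rewrite !cochain_evalU.
Qed.

Lemma cochain_eval_cohomologous n phi psi (theta : {ffun 'I_n -> G} -> A) (c : chain G n.+1) :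
  (forall g, phi g - psi g = coboundary theta g) -> boundary c = 0 ->
  cochain_eval phi c = cochain_eval psi c.
Proof.
move=> h c0; apply/eqP; rewrite -subr_eq0 -cochain_evalB (eq_cochain_eval _ h).
by rewrite -cochain_eval_boundary c0 raddf0.
Qed.

Lemma cochain_evalMz n phi (m : int) (c : chain G n) :
  cochain_eval (fun g => phi g *~ m) c = cochain_eval phi c *~ m.
Proof.
elim/free_ind: c => [|x y hx hy|g]; first by rewrite !raddf0 mul0rz.
  by rewrite !cochain_eval_additive hx hy mulrzBl.
by rewrite !cochain_evalU.
Qed.

Section ClassEval.
Variables (n : nat) (phi : {ffun 'I_n -> G} -> A).
Hypothesis phi_cocycle : forall g, coboundary phi g = 0.

Definition cycle_eval (z : cycles G n) : A := cochain_eval phi (val z).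
Fact cycle_eval_additive : zmod_morphism cycle_eval.
Proof. by move=> x y; rewrite /cycle_eval raddfB. Qed.
HB.instance Definition _ := GRing.isZmodMorphism.Build _ _ cycle_eval cycle_eval_additive.

Fact cycle_eval_boundary (z : cycles G n) : is_boundary z -> cycle_eval z = 0.
Proof.
case=> c hc; rewrite /cycle_eval hc cochain_eval_boundary (eq_cochain_eval _ phi_cocycle).
by elim/free_ind: c {hc} => [|x y hx hy|g]; rewrite ?raddf0 ?cochain_eval_additive ?hx ?hy ?subrr ?cochain_evalU.
Qed.

Definition class_eval : homology G n -> A := quotient_lift cycle_eval_boundary.
HB.instance Definition _ := GRing.Additive.on class_eval.
End ClassEval.
End Cochains.

Lemma cochain_eval_map (G K : groupType) (A : zmodType) (f : {multiplicative G -> K}) n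
    (phi : {ffun 'I_n -> K} -> A) c :
  cochain_eval phi (chain_map f c) = cochain_eval (fun g => phi [ffun i => f (g i)]) c.
Proof.
elim/free_ind: c => [|x y hx hy|g]; first by rewrite !raddf0.
  by rewrite chain_map_additive !cochain_eval_additive hx hy.
by rewrite chain_mapU !cochain_evalU.
Qed.

Lemma class_evalE (G : groupType) (A : zmodType) n (phi : {ffun 'I_n -> G} -> A)
    (hphi : forall g, coboundary phi g = 0) (c : cycles G n) :
  class_eval hphi (\pi_(homology G n) c) = cochain_eval phi (val c).
Proof. by rewrite /class_eval quotient_liftE. Qed.

Lemma class_eval_map (G K : groupType) (A : zmodType) (f : {multiplicative G -> K}) n
    (phi : {ffun 'I_n -> K} -> A) (hphi : forall g, coboundary phi g = 0) (c : cycles G n) :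
  class_eval hphi (homology_map f (\pi_(homology G n) c))
    = cochain_eval (fun g => phi [ffun i => f (g i)]) (val c).
Proof.
rewrite /homology_map quotient_mapE; last exact: cycle_map_boundary.
by rewrite class_evalE cochain_eval_map.
Qed.

(** An invariant function of four points satisfying the five-term relation defines
    a 3-cocycle of the group, once a base point [b] is chosen: evaluate it on the
    vertices [b], [g1 b], [g1 g2 b], [g1 g2 g3 b] of a simplex. *)
Section PointCochain.
Variables (G : groupType) (A : zmodType) (X : Type) (act : G -> X -> X).
Variable lam : X -> X -> X -> X -> A.
Hypothesis actM : forall g h x, act (g * h)%g x = act g (act h x).
Hypothesis lam_inv : forall g x y z w,
  lam (act g x) (act g y) (act g z) (act g w) = lam x y z w.
Hypothesis lam5 : forall x y z w u,
  lam y z w u - lam x z w u + lam x y w u - lam x y z u + lam x y z w = 0.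

Definition point_cochain b (g : {ffun 'I_3 -> G}) : A :=
  let g1 := g (inord 0) in let g2 := g (inord 1) in let g3 := g (inord 2) in
  lam b (act g1 b) (act (g1 * g2)%g b) (act (g1 * g2 * g3)%g b).

Lemma faceE n (i : 'I_n.+3) (g : {ffun 'I_n.+2 -> G}) j : (j < n.+1)%N ->
  face i g (inord j) = if (j.+1 < i)%N then g (inord j) else
    if j.+1 == i then (g (inord j) * g (inord j.+1))%g else g (inord j.+1).
Proof.
move=> jn; rewrite ffunE /= inordK //.
have -> : widen_ord (leqnSn n.+1) (inord j) = inord j.
  by apply: val_inj; rewrite /= !inordK // ltnW.
have -> // : fintype.lift ord0 (inord j : 'I_n.+1) = inord j.+1.
by apply: val_inj; rewrite /= /bump /= !inordK.
Qed.

Lemma point_cochain_cocycle b g : coboundary (point_cochain b) g = 0.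
Proof.
rewrite /coboundary !big_ord_recl big_ord0 /point_cochain !faceE //=.
rewrite expr0 (_ : (-1) ^+ bump 0 0 = -1 :> int) // (_ : (-1) ^+ bump 0 (bump 0 0) = 1 :> int) //.
rewrite (_ : (-1) ^+ bump 0 (bump 0 (bump 0 0)) = -1 :> int) //.
rewrite (_ : (-1) ^+ bump 0 (bump 0 (bump 0 (bump 0 0))) = 1 :> int) // !mulr1z !mulrN1z addr0.
move: (g (inord 0)) (g (inord 1)) (g (inord 2)) (g (inord 3)) => g1 g2 g3 g4.
rewrite -(lam_inv g1 b) -!actM !mulgA; set y1 := act g1 b; set y2 := act (g1 * g2)%g b.
set y3 := act (g1 * g2 * g3)%g b; set y4 := act (g1 * g2 * g3 * g4)%g b.
by rewrite -[RHS](lam5 b y1 y2 y3 y4); abelian.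
Qed.

(** The prism between the two cochains attached to the base points [b] and
    [b'], which are therefore cohomologous. *)
Definition prism b b' (g : {ffun 'I_2 -> G}) : A :=
  let g1 := g (inord 0) in let g2 := g (inord 1) in
  lam b b' (act g1 b') (act (g1 * g2)%g b')
  - lam b (act g1 b) (act g1 b') (act (g1 * g2)%g b')
  + lam b (act g1 b) (act (g1 * g2)%g b) (act (g1 * g2)%g b').

Lemma point_cochain_base b b' g :
  point_cochain b' g - point_cochain b g = coboundary (prism b b') g.
Proof.
rewrite /coboundary !big_ord_recl big_ord0 /point_cochain /prism !faceE //=.
rewrite expr0 (_ : (-1) ^+ bump 0 0 = -1 :> int) // (_ : (-1) ^+ bump 0 (bump 0 0) = 1 :> int) //.
rewrite (_ : (-1) ^+ bump 0 (bump 0 (bump 0 0)) = -1 :> int) // !mulr1z !mulrN1z addr0.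
move: (g (inord 0)) (g (inord 1)) (g (inord 2)) => g1 g2 g3.
rewrite -(lam_inv g1 b b') -(lam_inv g1 b (act g2 b)) -(lam_inv g1 b (act g2 b)).
rewrite -!actM !mulgA; set y1 := act g1 b; set y2 := act (g1 * g2)%g b.
set y3 := act (g1 * g2 * g3)%g b; set y1' := act g1 b'; set y2' := act (g1 * g2)%g b'.
set y3' := act (g1 * g2 * g3)%g b'.
apply/eqP; rewrite -subr_eq0; apply/eqP.
rewrite -[RHS](subrr 0) -{1}(lam5 b b' y1' y2' y3') -{1}(lam5 b y1 y1' y2' y3').
rewrite -[RHS]addr0 -{1}(lam5 b y1 y2 y2' y3') -[RHS]subr0 -{1}(lam5 b y1 y2 y3 y3').
by abelian.
Qed.
End PointCochain.

(** * The component of the comparison map at a finite prime *)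

Section PrimeComponent.
Variables (F : fieldExtType rat) (S : {fset finite_prime F}) (v : finite_prime F).
Local Open Scope quotient_scope.
Local Notation G := (SL2 (Sint S)).
Implicit Types (x y z w : option F) (g : 'M[Sint S]_2).

Definition fracmx g : 'M[F]_2 := map_mx (val : Sint S -> F) g.

Lemma fracmx_unit g : g \in unitmx -> fracmx g \in unitmx.
Proof. by rewrite !unitmxE /fracmx det_map_mx => /(rmorph_unit (val : Sint S -> F)). Qed.

Lemma det_fracmx g : \det (fracmx g) = val (\det g).
Proof. by rewrite /fracmx -det_map_mx. Qed.

Lemma fracmxM g h : fracmx (g *m h) = fracmx g *m fracmx h.
Proof. exact: map_mxM. Qed.

Lemma fracmxV g : g \in unitmx -> fracmx (invmx g) = invmx (fracmx g).
Proof.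
move=> gu; rewrite -[LHS](mulmxK (fracmx_unit gu)) -fracmxM mulVmx //.
by rewrite [fracmx _]map_mx1 mul1mx.
Qed.

Definition sl2_act (s : G) x := mobius (fracmx (val s)) x.

Lemma sl2_frac_unit (s : G) : fracmx (val s) \in unitmx.
Proof. by rewrite fracmx_unit // SL2_unit. Qed.

Lemma sl2_actM (s t : G) x : sl2_act (s * t)%g x = sl2_act s (sl2_act t x).
Proof. by rewrite /sl2_act -mobiusM ?sl2_frac_unit // -fracmxM. Qed.

Lemma sl2_parity (s : G) : parity v (fracmx (val s)) = 1.
Proof. by rewrite /parity det_fracmx (eqP (valP s)) valuation1. Qed.

Lemma tree_cocycle_sl2 (s : G) x y z w :
  tree_cocycle v (sl2_act s x) (sl2_act s y) (sl2_act s z) (sl2_act s w)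
    = tree_cocycle v x y z w.
Proof. by rewrite tree_cocycle_mobius ?sl2_frac_unit // sl2_parity mulr1z. Qed.

Definition prime_cochain x := point_cochain sl2_act (tree_cocycle v) x.

Lemma prime_cochain_cocycle x (c : {ffun 'I_4 -> G}) :
  coboundary (prime_cochain x) c = 0.
Proof.
exact: (point_cochain_cocycle sl2_actM tree_cocycle_sl2 (@tree_cocycle5 F v)).
Qed.

(** Independent of the base point, by [prime_componentE]. *)
Definition prime_component : homology G 3 -> preBloch (residue v) :=
  class_eval (prime_cochain_cocycle None).
HB.instance Definition _ := GRing.Additive.on prime_component.

Lemma prime_componentE (c : cycles G 3) x :
  prime_component (\pi c) = cochain_eval (prime_cochain x) (val c).
Proof.
rewrite /prime_component class_evalE.
apply: (cochain_eval_cohomologous (theta := prism sl2_act (tree_cocycle v) x None)).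
  exact: (point_cochain_base sl2_actM tree_cocycle_sl2 (@tree_cocycle5 F v)).
exact/eqP/(valP c).
Qed.

(** Conjugation by [g] translates the points by [g] and moves the base point, and the tree
    cocycle is multiplied by the parity of [v (det g)] under this translation. *)
Lemma prime_component_act g (gU : g \in unitmx) (z : homology G 3) :
  prime_component (homology_map (SL2_conj gU) z)
    = prime_component z *~ ((-1) ^ v (val (\det g))).
Proof.
elim/quotW: z => c; apply: etrans (class_eval_map _ _ _) _.
rewrite (prime_componentE c (mobius (invmx (fracmx g)) None)).
apply: etrans (cochain_evalMz _ _ _); apply: eq_cochain_eval => s.
have fu := fracmx_unit gU.
have e (t : G) x : sl2_act (SL2_conj gU t) x
    = mobius (fracmx g) (sl2_act t (mobius (invmx (fracmx g)) x)).
  rewrite /sl2_act /= !fracmxM fracmxV // !mobiusM ?unitmx_inv //.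
  exact: sl2_frac_unit.
rewrite /prime_cochain /point_cochain !ffunE -!gmulfM !e.
set b := mobius (invmx (fracmx g)) None.
have -> : None = mobius (fracmx g) b by rewrite /b -mobiusM ?unitmx_inv // mulmxV // mobius1.
by rewrite tree_cocycle_mobius // /parity det_fracmx.
Qed.
End PrimeComponent.

(** * Naturality *)

Section PrimeNatural.
Variables (F F' : fieldExtType rat) (sigma : {rmorphism F -> F'}).
Variables (v : finite_prime F) (v' : finite_prime F').
Variable tau : {rmorphism residue v -> residue v'}.
Local Open Scope quotient_scope.
Hypothesis sigma_bij : bijective sigma.
Hypothesis valE : forall x, v' (sigma x) = v x.
Hypothesis tauE : forall (x : valring v) (x' : valring v'),
  val x' = sigma (val x) -> tau (\pi x) = \pi x'.
Implicit Types (x y z w : option F) (g h M : 'M[F]_2).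
Local Notation smx := (@map_mx _ _ sigma 2 2).

Lemma valring_map s : valring_pred v' (sigma s) = valring_pred v s.
Proof. by rewrite /valring_pred /valuation_ge fmorph_eq0 valE. Qed.

Lemma residue_of_map s : valring_pred v s -> residue_of v' (sigma s) = tau (residue_of v s).
Proof.
move=> Os; have [a ea ->] := residue_of_lift Os.
have Os' : valring_pred v' (sigma s) by rewrite valring_map.
have [a' ea' ->] := residue_of_lift Os'.
by apply/esym/tauE; rewrite ea ea'.
Qed.

Lemma tau_bij : bijective tau.
Proof.
have [f sK fK] := sigma_bij.
have surj (b : residue v') : exists a, tau a = b.
  have [s' Os' <-] := residue_of_surj b.
  have Os : valring_pred v (f s') by rewrite -valring_map fK.
  by exists (residue_of v (f s')); rewrite -residue_of_map // fK.
exists (fun b => projT1 (cid (surj b))) => [a|b]; last by case: cid.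
by case: cid => a' /= /fmorph_inj.
Qed.

Lemma red_map x : red v' (omap sigma x) = omap tau (red v x).
Proof.
case: x => [s|] //=; rewrite valring_map; case: ifP => // Os.
by rewrite /= residue_of_map.
Qed.

Lemma mobius_map g x : mobius (smx g) (omap sigma x) = omap sigma (mobius g x).
Proof.
have e : hvec (omap sigma x) = (sigma (hvec x).1, sigma (hvec x).2).
  by case: x => [s|] /=; rewrite ?rmorph1 ?rmorph0.
rewrite /mobius /hact e !mxE /= -!rmorphM -!rmorphD /hpt /= fmorph_eq0.
by case: ifP => // _; rewrite /= fmorph_div.
Qed.

Lemma det_smx g : \det (smx g) = sigma (\det g). Proof. exact: det_map_mx. Qed.

Lemma smx_unit g : (smx g \in unitmx) = (g \in unitmx).
Proof. exact: map_unitmx. Qed.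

Lemma smx_inj : injective smx.
Proof. by move=> g h /matrixP e; apply/matrixP => i j; move: (e i j); rewrite !mxE => /fmorph_inj. Qed.

Lemma smx_surj (N : 'M[F']_2) : exists M, smx M = N.
Proof.
have [f sK fK] := sigma_bij; exists (map_mx f N).
by apply/matrixP => i j; rewrite !mxE fK.
Qed.

Lemma parity_map g : parity v' (smx g) = parity v g.
Proof. by rewrite /parity det_smx valE. Qed.

Lemma integral_mx_map M : integral_mx v' (smx M) = integral_mx v M.
Proof.
rewrite /integral_mx det_smx fmorph_eq0 valE; congr (_ && _).
by apply: eq_forallb => i; apply: eq_forallb => j; rewrite mxE valring_map.
Qed.

Lemma same_vertex_map g h : same_vertex v' (smx g) (smx h) <-> same_vertex v g h.
Proof.
have [f sK fK] := sigma_bij; split=> [[l [N [l0 hN e]]]|[l [M [l0 hM ->]]]].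
  have [M eM] := smx_surj N; exists (f l), M; split.
  - by rewrite -(fmorph_eq0 sigma) fK.
  - by rewrite -integral_mx_map eM.
  by apply: smx_inj; rewrite e map_mxZ fK map_mxM eM.
exists (sigma l), (smx M); rewrite fmorph_eq0 l0 integral_mx_map; split=> //.
by rewrite map_mxZ map_mxM.
Qed.

Lemma local_term_map g x y z w :
  local_term v' (smx g) (omap sigma x) (omap sigma y) (omap sigma z) (omap sigma w)
    = preBloch_map tau (local_term v g x y z w).
Proof.
rewrite /local_term !mobius_map !red_map parity_map -preBloch_map_cocycle; last exact: tau_bij.
by rewrite preBloch_mapMz //; exact: tau_bij.
Qed.

(* The bijection that [sigma] induces between the vertices of the two trees, in terms
   of the chosen representatives. *)
Let transport g := canonical_vertex v' (smx g).

Lemma transport_bij : set_bij (vertices v) (vertices v') transport.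
Proof.
split.
- by move=> g [gu _] /=; apply: canonical_vertex_in; rewrite smx_unit.
- move=> g h /set_mem[gu ga] /set_mem[hu ha] e; rewrite -ga -ha.
  apply/canonical_vertex_eq/same_vertex_map.
  apply: same_vertex_trans (canonical_vertexP v' _) _.
  by rewrite -/(transport g) e; apply/same_vertex_sym/canonical_vertexP.
move=> N [Nu Na] /=; have [M eM] := smx_surj N.
have Mu : M \in unitmx by rewrite -smx_unit eM.
exists (canonical_vertex v M); first exact: canonical_vertex_in.
rewrite -[RHS]Na /transport; apply/esym/canonical_vertex_eq.
by rewrite -eM; apply/same_vertex_map/canonical_vertexP.
Qed.

Lemma tree_cocycle_map x y z w :
  tree_cocycle v' (omap sigma x) (omap sigma y) (omap sigma z) (omap sigma w)
    = preBloch_map tau (tree_cocycle v x y z w).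
Proof.
have e g : vertices v g ->
    local_term v' (transport g) (omap sigma x) (omap sigma y) (omap sigma z) (omap sigma w)
    = preBloch_map tau (local_term v g x y z w).
  by move=> [gu _]; rewrite local_term_canonical ?smx_unit // local_term_map.
pose D := term_support v x y z w.
have DV : (D `<=` vertices v)%classic by exact: term_support_sub.
have fD : finite_set D by exact: finite_term_support.
rewrite (tree_cocycle_finite DV fD) // preBloch_map_sum; last exact: tau_bij.
transitivity (\sum_(g \in vertices v)
  local_term v' (transport g) (omap sigma x) (omap sigma y) (omap sigma z) (omap sigma w)).
  exact: reindex_fsbig transport_bij.
transitivity (\sum_(g \in D)
  local_term v' (transport g) (omap sigma x) (omap sigma y) (omap sigma z) (omap sigma w)).
  apply/esym/fsbig_widen => // g [Vg nDg] /=; rewrite e // (term_supportP Vg nDg).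
  by rewrite -[X in preBloch_map _ X](subrr 0) preBloch_mapB ?subrr //; exact: tau_bij.
rewrite fsum_finite //; apply: eq_big_seq => g; rewrite in_fset_set // => /set_mem /DV.
exact: e.
Qed.
End PrimeNatural.

Lemma cochain_eval_comp (G : groupType) (A B : zmodType) (f : A -> B) n
    (phi : {ffun 'I_n -> G} -> A) (c : chain G n) :
  (forall a b, f (a - b) = f a - f b) ->
  cochain_eval (fun g => f (phi g)) c = f (cochain_eval phi c).
Proof.
move=> fB; elim/free_ind: c => [|x y hx hy|g].
- by rewrite !raddf0 -[X in f X](subrr 0) fB subrr.
- by rewrite !cochain_eval_additive hx hy fB.
by rewrite !cochain_evalU.
Qed.

Section ComponentNatural.
Variables (F F' : fieldExtType rat) (S : {fset finite_prime F}) (S' : {fset finite_prime F'}).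
Variable sigma : {rmorphism F -> F'}.
Variables (v : finite_prime F) (v' : finite_prime F').
Variable tau : {rmorphism residue v -> residue v'}.
Variable rho : {rmorphism Sint S -> Sint S'}.
Hypothesis sigma_bij : bijective sigma.
Hypothesis valE : forall x, v' (sigma x) = v x.
Hypothesis tauE : forall (x : valring v) (x' : valring v'),
  val x' = sigma (val x) -> tau (\pi x) = \pi x'.
Hypothesis rhoE : forall x, val (rho x) = sigma (val x).

Lemma sl2_act_map (s : SL2 (Sint S)) x :
  sl2_act (SL2_map rho s) (omap sigma x) = omap sigma (sl2_act s x).
Proof.
rewrite /sl2_act -mobius_map; congr (mobius _ _).
by apply/matrixP => i j; rewrite !mxE rhoE.
Qed.

Lemma prime_component_map (z : homology (SL2 (Sint S)) 3) :
  prime_component v' (homology_map (SL2_map rho) z)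
    = preBloch_map tau (prime_component v z).
Proof.
have tb := tau_bij sigma_bij valE tauE.
elim/quotW: z => c; apply: etrans (class_eval_map _ _ _) _.
rewrite (prime_componentE v c None).
apply: etrans (cochain_eval_comp _ _ (preBloch_mapB tb)); apply: eq_cochain_eval => g.
rewrite /prime_cochain /point_cochain !ffunE -!gmulfM.
have e s : sl2_act (SL2_map rho s) None = omap sigma (sl2_act s None).
  by rewrite -sl2_act_map.
by rewrite !e -(tree_cocycle_map sigma_bij valE tauE).
Qed.
End ComponentNatural.

(** * The class of an element of order 3 *)

Section OrderThree.
Variable G : groupType.

Definition gens n (l : seq G) : {ffun 'I_n -> G} := [ffun i : 'I_n => nth 1%g l i].
Local Notation p2 a b := (<< gens 2 [:: a; b] >> : chain G 2).
Local Notation p3 a b c := (<< gens 3 [:: a; b; c] >> : chain G 3).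
Local Notation p4 a b c d := (<< gens 4 [:: a; b; c; d] >> : chain G 4).

Lemma gens_face n (i : 'I_n.+3) (l m : seq G) :
  (forall j, (j < n.+1)%N -> nth 1%g m j = if (j.+1 < i)%N then nth 1%g l j else
    if j.+1 == i then (nth 1%g l j * nth 1%g l j.+1)%g else nth 1%g l j.+1) ->
  face i (gens n.+2 l) = gens n.+1 m.
Proof.
move=> h; apply/ffunP => j; have jn := ltn_ord j.
by rewrite -[j]inord_val faceE // !ffunE !inordK ?h ?ltnS // ltnW.
Qed.

Lemma boundary_gens3 a b c :
  boundary (p3 a b c) = p2 b c - p2 (a * b)%g c + p2 a (b * c)%g - p2 a b.
Proof.
rewrite /= liftU scale1r !big_ord_recl big_ord0 addr0.
rewrite (gens_face (m := [:: b; c])); last by case=> [|[|]].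
rewrite (gens_face (m := [:: a * b; c]%g)); last by case=> [|[|]].
rewrite (gens_face (m := [:: a; b * c]%g)); last by case=> [|[|]].
rewrite (gens_face (m := [:: a; b]%g)); last by case=> [|[|]].
rewrite /= /bump /= !expr0 !exprS !expr0 !mulr1 !mulN1r !opprK !scale1r !scaleN1r.
set A := << gens 2 [:: b; c] >>; set B := << gens 2 [:: _; c] >>.
set C := << gens 2 [:: a; b * c]%g >>; set D := << gens 2 [:: a; b] >>.
by abelian.
Qed.

Lemma boundary_gens4 a b c d :
  boundary (p4 a b c d) =
  p3 b c d - p3 (a * b)%g c d + p3 a (b * c)%g d - p3 a b (c * d)%g + p3 a b c.
Proof.
rewrite /= liftU scale1r !big_ord_recl big_ord0 addr0.
rewrite (gens_face (m := [:: b; c; d])); last by case=> [|[|[|]]].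
rewrite (gens_face (m := [:: a * b; c; d]%g)); last by case=> [|[|[|]]].
rewrite (gens_face (m := [:: a; b * c; d]%g)); last by case=> [|[|[|]]].
rewrite (gens_face (m := [:: a; b; c * d]%g)); last by case=> [|[|[|]]].
rewrite (gens_face (m := [:: a; b; c]%g)); last by case=> [|[|[|]]].
rewrite /= /bump /= !expr0 !exprS !expr0 !mulr1 !mulN1r !opprK !scale1r !scaleN1r.
set A := << gens 3 [:: b; c; d] >>; set B := << gens 3 [:: _; c; d] >>.
set C := << gens 3 [:: a; _; d] >>; set D := << gens 3 [:: a; b; _] >>.
set E := << gens 3 [:: a; b; c] >>.
by abelian.
Qed.

Lemma boundaryD n (x y : chain G n) : boundary (x + y) = boundary x + boundary y.
Proof. exact: raddfD. Qed.

Variable s : G.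
Hypothesis s3 : (s * (s * s) = 1)%g.

(** The standard generator of the third homology of a cyclic group of order 3, the
    fundamental class of a lens space. *)
Definition lens_chain : chain G 3 := p3 s 1%g s + p3 s s s + p3 s (s * s)%g s.

Let s3' : (s * s * s = 1)%g. Proof. by rewrite -mulgA. Qed.

Lemma lens_chain_cycle : boundary lens_chain = 0.
Proof.
by rewrite /lens_chain !boundaryD !boundary_gens3 s3' s3 mulg1 mul1g; abelian.
Qed.

(** The witness is the sum of the [[s^j | s | s^i | s]] over all [i], [j] modulo 3:
    the terms of its boundary that involve [s^j] cancel in a telescoping sum over [j]. *)
Lemma lens_chain3 : exists c : chain G 4, lens_chain *+ 3 = boundary c.
Proof.
pose q a := p4 a s 1%g s + p4 a s s s + p4 a s (s * s)%g s.
pose r a := p3 a 1%g s + p3 a s s + p3 a (s * s)%g s.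
have hq a : boundary (q a) = lens_chain - r (a * s)%g + r a.
  rewrite /q !boundaryD !boundary_gens4 s3' s3 mulg1 mul1g /lens_chain /r.
  by abelian.
exists (q 1%g + q s + q (s * s)%g).
by rewrite 2!boundaryD !hq s3' mul1g; abelian.
Qed.

Definition lens_cycle : cycles G 3 := exist _ lens_chain (introT eqP lens_chain_cycle).

Lemma lens_class_torsion : torsion_pred 3 (\pi_(homology G 3) lens_cycle).
Proof.
rewrite /torsion_pred -raddfMn; apply/eqP/quotient_relation.
have [c hc] := lens_chain3; exists c; rewrite -hc.
by rewrite raddfMn.
Qed.
End OrderThree.

Section LensValue.
Variables (F : fieldExtType rat) (S : {fset finite_prime F}) (v : finite_prime F).
Local Notation G := (SL2 (Sint S)).

(** The homography [x |-> 1 / (1 - x)], which permutes [oo], [0], [1] cyclically: the tree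
    cocycle of its class is then supported on the standard vertex. *)
Definition order3_mx : 'M[Sint S]_2 := \matrix_(i < 2, j < 2)
  if i == ord0 then (if j == ord0 then 0 else -1) else (if j == ord0 then 1 else -1).
Fact order3_det : \det order3_mx == 1.
Proof. by rewrite det2E !mxE /= mul0r sub0r mulN1r opprK. Qed.
Definition order3 : G := exist _ order3_mx order3_det.

Lemma order3K : (order3 * (order3 * order3) = 1)%g.
Proof.
apply: val_inj; apply/matrixP => i j.
have two (l : 'I_2) : l = ord0 \/ l = ord_max.
  by case: l => [[|[|]]] //= hl; [left|right]; exact: val_inj.
rewrite !mxE !big_ord_recl big_ord0 !mxE !big_ord_recl !big_ord0 !mxE.
by case: (two i) => ->; case: (two j) => ->;
  rewrite /= ?(mul0r, mulr0, mul1r, mulr1, add0r, addr0, mulN1r, mulrN1, opprK, addrN, addNr, oppr0, mulr0n, mulr1n, subr0).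
Qed.

Local Notation act := (sl2_act (S := S)).

Lemma order3_act_oo : act order3 None = Some 0.
Proof. by rewrite /sl2_act /mobius /hact /hpt !mxE /= !mulr0 !addr0 !mulr1 oner_eq0 mul0r. Qed.

Lemma order3_act_0 : act order3 (Some 0) = Some 1.
Proof.
rewrite /sl2_act /mobius /hact /hpt !mxE /= !mulr0 !add0r !mulr1.
by rewrite oppr_eq0 oner_eq0 divff // oppr_eq0 oner_eq0.
Qed.

Lemma order3_act_1 : act order3 (Some 1) = None.
Proof.
by rewrite /sl2_act /mobius /hact /hpt !mxE /= !mulr1 addrN eqxx.
Qed.
End LensValue.

Section TreeDegenerate.
Variables (F : fieldExtType rat) (v : finite_prime F).
Implicit Types (x y z w : option F).

Lemma tree_cocycle_adjacent x y w : tree_cocycle v x y y w = 0.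
Proof.
apply: fsbig1 => g _; rewrite /local_term /bloch_cocycle /extend_degenerate eqxx orbT /=.
exact: mul0rz.
Qed.

Lemma tree_cocycle_alternate x y : tree_cocycle v x y x y = 0.
Proof.
apply: fsbig1 => g _; rewrite /local_term /bloch_cocycle /extend_degenerate !eqxx /=.
by case: ifP => _; exact: mul0rz.
Qed.

(** Only the standard vertex sees three directions among [oo], [0], [1]. *)
Lemma tree_cocycle_standard :
  tree_cocycle v None (Some 0) (Some 1) None = bloch_const (residue v).
Proof.
have r0 : red v (Some 0) = Some 0 by rewrite /= valring0 residue_of0.
have r1 : red v (Some 1) = Some 1 by rewrite /= valring1 residue_of1.
have u1 : uniq [seq red v (mobius 1%:M i) | i <- [:: None; Some 0; Some (1 : F)]].
  rewrite /= !mobius1 -/(red v (Some 0)) -/(red v (Some 1)) r0 r1.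
  by rewrite !inE /= (inj_eq Some_inj) eq_sym oner_eq0.
have V1 := canonical_vertex_in v (unitmx1 F 2).
pose D : set 'M[F]_2 := [set canonical_vertex v 1%:M]%classic.
have DV : (D `<=` vertices v)%classic by move=> g ->.
have SD g : branching v None (Some 0) (Some 1) g -> D g.
  move=> [[gu ga] ub]; rewrite /D /= -ga.
  exact/canonical_vertex_eq/(branching_unique gu (unitmx1 F 2) ub u1).
rewrite (tree_cocycle_widen DV); last first.
  move=> g [[/SD//|[_]]|[[_]|[Vg ub]]]; rewrite /= ?inE ?eqxx ?orbT ?andbF //.
  apply: SD; split=> //; move: ub; rewrite /= !inE !andbT !negb_or.
  by case/andP=> /andP[h1 h2] h3; rewrite h1 (eq_sym (red _ _)) h2 eq_sym h3.
rewrite fsbig_set1 local_term_canonical ?unitmx1 //.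
rewrite /local_term !mobius1 r0 r1 /= /parity det1 valuation1 mulr1z.
by rewrite /bloch_cocycle /extend_degenerate /= (inj_eq Some_inj) eq_sym oner_eq0.
Qed.
End TreeDegenerate.

Section LensComponent.
Variables (F : fieldExtType rat) (S : {fset finite_prime F}) (v : finite_prime F).

Definition lens_class : homology (SL2 (Sint S)) 3 :=
  \pi_(homology (SL2 (Sint S)) 3) (lens_cycle (order3K S)).

(** Of the three simplices of the lens cycle, with vertices taken among [oo], [0], [1],
    two are degenerate; the third is the closed triangle [oo], [0], [1], [oo]. *)
Lemma prime_component_lens : prime_component v lens_class = bloch_const (residue v).
Proof.
apply: etrans (prime_componentE v _ None) _.
have e (a b c : SL2 (Sint S)) : cochain_eval (prime_cochain v None)
    (<< gens 3 [:: a; b; c] >> : chain _ 3)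
    = tree_cocycle v None (sl2_act a None) (sl2_act (a * b)%g None) (sl2_act (a * b * c)%g None).
  by rewrite cochain_evalU /prime_cochain /point_cochain !ffunE !inordK.
have eD x y : cochain_eval (prime_cochain (S := S) v None) (x + y) =
  cochain_eval (prime_cochain v None) x + cochain_eval (prime_cochain v None) y.
  exact: raddfD.
rewrite -[val (lens_cycle _)]/(lens_chain (order3 S)) /lens_chain !eD !e.
rewrite !sl2_actM !order3_act_oo !order3_act_0 !order3_act_1.
have -> x : sl2_act (1 : SL2 (Sint S))%g x = x.
  by rewrite /sl2_act [fracmx _]map_mx1 mobius1.
rewrite order3_act_oo tree_cocycle_adjacent tree_cocycle_standard tree_cocycle_alternate.
by rewrite add0r addr0.
Qed.
End LensComponent.

(** * Cocycles invariant under a simply transitive cyclic group *)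

Section CyclicCocycle.
Variables (X : finType) (t : X -> X) (A : zmodType) (E : X -> X -> X -> X -> A).
Hypothesis t_inj : injective t.
Hypothesis t_trans : forall x y, fconnect t x y.
Hypothesis E5 : forall x y z w u,
  E y z w u - E x z w u + E x y w u - E x y z u + E x y z w = 0.
Hypothesis E_inv : forall x y z w, E (t x) (t y) (t z) (t w) = E x y z w.
Hypothesis E_adj : forall x z w, E x x z w = 0.
Local Notation n := #|X|.
Local Notation d := (findex t).

Lemma order_full x : fingraph.order t x = n.
Proof. by apply: eq_card => y; rewrite !inE t_trans. Qed.

Lemma cycle_lt x y : (d x y < n)%N.
Proof. by rewrite -(order_full x) findex_max ?t_trans. Qed.

Lemma iter_cycle x : iter n t x = x.
Proof. by rewrite -{1}(order_full x) iter_order. Qed.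

Lemma iter_dist x y : iter (d x y) t x = y.
Proof. by rewrite iter_findex ?t_trans. Qed.

Lemma dist_iter i x : (i < n)%N -> d x (iter i t x) = i.
Proof. by move=> ilt; rewrite findex_iter // order_full. Qed.

Lemma dist_shift x y : d (t x) (t y) = d x y.
Proof. by rewrite -{1}(iter_dist x y) -iterS iterSr dist_iter // cycle_lt. Qed.

(** The 2-cocycle of the extension of [Z / n] by [Z], in homogeneous form. *)
Definition carry x y z : bool := (n <= d x y + d y z)%N.

Lemma dist_carry x y z : (d x y + d y z = d x z + carry x y z * n)%N.
Proof.
have e : z = iter (d x y + d y z) t x by rewrite addnC iterD !iter_dist.
rewrite /carry; case: leqP => h; last first.
  have -> : d x z = (d x y + d y z)%N by rewrite [in LHS]e dist_iter.
  by rewrite addn0.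
have h2 : (d x y + d y z - n < n)%N.
  by rewrite ltn_subLR //; have := cycle_lt x y; have := cycle_lt y z; lia.
have -> : d x z = (d x y + d y z - n)%N.
  rewrite -[RHS](dist_iter x h2); congr (d x _).
  by rewrite [in LHS]e -{1}(subnK h) iterD iter_cycle.
by rewrite mul1n subnK.
Qed.

Lemma carry_shift x y z : carry (t x) (t y) (t z) = carry x y z.
Proof. by rewrite /carry !dist_shift. Qed.

Definition path_sum m x z w := \sum_(s < m) E (iter s t x) (iter s.+1 t x) z w.

Lemma path_sumD m m' x z w :
  path_sum (m + m') x z w = path_sum m x z w + path_sum m' (iter m t x) z w.
Proof.
rewrite /path_sum big_split_ord /=; congr (_ + _); apply: eq_bigr => s _.
by rewrite /= -!iterD [(s + m)%N]addnC.
Qed.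

Lemma path_sum_shift m x z w : path_sum m (t x) (t z) (t w) = path_sum m x z w.
Proof. by apply: eq_bigr => s _; rewrite -!iterSr 2!iterS E_inv. Qed.

(** The five-term relations along an arc of length [m] telescope. *)
Lemma path_sum5 m x y z w :
  path_sum m x z w - path_sum m x y w + path_sum m x y z
    = E x y z w - E (iter m t x) y z w.
Proof.
elim: m => [|m IH]; first by rewrite /path_sum !big_ord0 /= subrr subr0 addr0.
have step a b : path_sum m.+1 x a b = path_sum m x a b + E (iter m t x) (iter m.+1 t x) a b.
  by rewrite /path_sum big_ord_recr.
rewrite !step; have e := E5 (iter m t x) (iter m.+1 t x) y z w.
rewrite -[LHS]subr0 -{1}e; move: IH; set P1 := path_sum m x z w.
set P2 := path_sum m x y w; set P3 := path_sum m x y z => IH.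
by rewrite -[E x y z w](subrK (E (iter m t x) y z w)) -IH; abelian.
Qed.

Definition loop_sum z w := path_sum n z z w.

Lemma path_sum_full x z w : path_sum n x z w = loop_sum z w.
Proof.
have e y : path_sum n (t y) z w = path_sum n y z w.
  have := path_sumD 1 n y z w; rewrite addnC path_sumD iter_cycle.
  by rewrite [X in X = _]addrC => /addrI ->.
have ei i : path_sum n (iter i t x) z w = path_sum n x z w.
  by elim: i => //= i IH; rewrite e.
by rewrite /loop_sum -{2}(iter_dist x z) ei.
Qed.

Lemma loop_sum_add x y z : loop_sum x z = loop_sum x y + loop_sum y z.
Proof.
have := path_sum5 n x x y z; rewrite iter_cycle subrr !path_sum_full => /eqP.
by rewrite addrAC subr_eq0 addrC => /eqP <-.
Qed.

Lemma loop_sum_shift z w : loop_sum (t z) (t w) = loop_sum z w.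
Proof. by rewrite /loop_sum path_sum_shift. Qed.

(** The sum over the whole cycle of the edges [[t^s x, t^(s+1) x]], seen from one of them:
    the value of the cocycle on the fundamental class of the cyclic group. *)
Definition loop_gen x := loop_sum x (t x).

Lemma loop_gen_const x y : loop_gen x = loop_gen y.
Proof.
rewrite -(iter_dist y x) /loop_gen; elim: (d y x) => //= i <-.
exact: loop_sum_shift.
Qed.

Lemma loop_sum_iter x y i : loop_sum x (iter i t x) = loop_gen y *+ i.
Proof.
elim: i => [|i IH] /=.
  have /eqP := loop_sum_add x x x; rewrite -subr_eq0 opprD addNKr oppr_eq0.
  by move/eqP.
by rewrite (loop_sum_add x (iter i t x)) IH -/(loop_gen _) (loop_gen_const _ y) mulrSr.
Qed.

Lemma loop_sum_dist x y z : loop_sum x y = loop_gen z *+ d x y.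
Proof. by rewrite -{1}(iter_dist x y) (loop_sum_iter _ z). Qed.

Lemma loop_gen_order x : loop_gen x *+ n = 0.
Proof.
rewrite -(loop_sum_iter x) iter_cycle.
by have := loop_sum_iter x x 0; rewrite mulr0n.
Qed.

Definition bounding x y z := - path_sum (d x y) x y z.

Lemma bounding_shift x y z : bounding (t x) (t y) (t z) = bounding x y z.
Proof. by rewrite /bounding dist_shift path_sum_shift. Qed.

(** Summing a cocycle along the arc from [x] to [y] makes it a coboundary, up to
    the standard carry cocycle of the cyclic group. *)
Lemma cyclic_cocycle x y z w u :
  E x y z w = bounding y z w - bounding x z w + bounding x y w - bounding x y z
    + loop_gen u *+ (carry x y z * d z w).
Proof.
have e1 := path_sum5 (d x y) x y z w; rewrite iter_dist E_adj subr0 in e1.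
have e2 : path_sum (d x y) x z w + path_sum (d y z) y z w
    = path_sum (d x z) x z w + loop_gen u *+ (carry x y z * d z w).
  have := path_sumD (d x y) (d y z) x z w; rewrite iter_dist => <-.
  rewrite dist_carry path_sumD iter_dist; congr (_ + _).
  case: (carry x y z); rewrite ?mul1n ?mul0n ?mulr0n.
    by rewrite path_sum_full (loop_sum_dist _ _ u).
  by rewrite /path_sum big_ord0.
rewrite /bounding -e1.
have -> : loop_gen u *+ (carry x y z * d z w) =
  path_sum (d x y) x z w + path_sum (d y z) y z w - path_sum (d x z) x z w.
  by rewrite e2 addrAC addrN add0r.
by abelian.
Qed.

Lemma carry_cocycle x y z w : (carry y z w + carry x y w = carry x z w + carry x y z)%N.
Proof.
have n0 : (0 < n)%N by apply: leq_ltn_trans (cycle_lt x x).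
have e1 := dist_carry y z w; have e2 := dist_carry x y w.
have e3 := dist_carry x z w; have e4 := dist_carry x y z.
apply/eqP; rewrite -(eqn_pmul2r n0) !mulnDl; apply/eqP; lia.
Qed.

(** The standard 3-cocycle of a cyclic group, with values in [Z / n]. *)
Definition carry_cup x y z w : 'Z_n := (carry x y z * d z w)%:R.

Lemma carry_cup_shift x y z w : carry_cup (t x) (t y) (t z) (t w) = carry_cup x y z w.
Proof. by rewrite /carry_cup carry_shift dist_shift. Qed.

Lemma natr_card : (1 < n)%N -> n%:R = 0 :> 'Z_n.
Proof. by move=> n1; rewrite -Zp_nat_mod // modnn. Qed.

Lemma carry_cup5 x y z w u : (1 < n)%N ->
  carry_cup y z w u - carry_cup x z w u + carry_cup x y w u - carry_cup x y z u
    + carry_cup x y z w = 0.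
Proof.
move=> n1; rewrite /carry_cup.
have e1 := congr1 (fun m => m%:R : 'Z_n) (carry_cocycle x y z w).
have e2 := congr1 (fun m => m%:R : 'Z_n) (dist_carry z w u).
rewrite !natrM; rewrite !natrD in e1; rewrite !natrD natrM natr_card // mulr0 addr0 in e2.
rewrite -e2; have -> : (carry y z w)%:R = (carry x z w)%:R + (carry x y z)%:R - (carry x y w)%:R :> 'Z_n.
  by rewrite -e1 addrK.
by ring.
Qed.

(** Double counting.  The sum [Q a b] of [E a b] over the three sides of the triangle
    [x], [t^m x], [t^(2m) x] is additive in the arc from [a] to [b].  On the arc from [x]
    to [t^m x] it equals [C], as two of the three terms are degenerate; cut into [m] unit
    arcs, its three families of terms are, after rotation, the three thirds of the sum
    over the whole cycle of length [3 m], seen from one side. *)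
Lemma loop_gen_third m x (C : A) : n = (3 * m)%N ->
  (forall y z, E y z y z = 0) -> (forall y z w, E y z z w = 0) ->
  E x (iter m t x) (iter (m + m) t x) x = C ->
  loop_gen x *+ m = C.
Proof.
move=> n3 E_alt E_adj2 EC.
pose x1 := iter m t x; pose x2 := iter (m + m) t x.
have it1 : iter m t x1 = x2 by rewrite /x1 /x2 iterD.
have it2 : iter m t x2 = x.
  by rewrite /x2 -iterD -[RHS]iter_cycle; congr (iter _ t x); rewrite n3; lia.
pose Q a b := E a b x x1 + E a b x1 x2 + E a b x2 x.
have Q3 a b c : Q a c = Q a b + Q b c.
  rewrite /Q; have h1 := E5 a b c x x1; have h2 := E5 a b c x1 x2.
  have h3 := E5 a b c x2 x; apply/eqP; rewrite -subr_eq0 -[X in _ == X]addr0 -[X in _ == X + _]addr0.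
  by rewrite -{1}(oppr0) -{1}h1 -{1}(oppr0) -{1}h2 -(oppr0) -h3; apply/eqP; abelian.
have Qpath j : Q x (iter j t x) = \sum_(s < j) Q (iter s t x) (iter s.+1 t x).
  elim: j => [|j IH]; last by rewrite big_ord_recr /= -IH -Q3.
  by rewrite big_ord0; have /eqP := Q3 x x x; rewrite -subr_eq0 opprD addNKr oppr_eq0 => /eqP.
have <- : Q x x1 = C.
  by rewrite /Q E_alt E_adj2 add0r add0r.
rewrite -/x1 in Qpath *; rewrite (Qpath m) -(loop_sum_iter x x m) -/x1.
rewrite /loop_sum n3 mulSn mulSn mul1n !path_sumD.
have sh j a z w : path_sum m (iter j t a) (iter j t z) (iter j t w) = path_sum m a z w.
  by elim: j => //= j IH; rewrite path_sum_shift.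
rewrite -/x1 -[iter m t (iter m t x)]/(iter m t x1) it1.
rewrite -[path_sum m x2 x x1](sh m) it2 it1 -/x1.
rewrite -[path_sum m x1 x x1](sh m) -/x1 it1.
rewrite -[path_sum m x2 x1 x2](sh m) it1 it2.
by rewrite /path_sum -!big_split /=; apply: eq_bigr => s _; rewrite /Q; abelian.
Qed.
End CyclicCocycle.

(** * The 3-torsion of the pre-Bloch group of a finite field *)

Section CosetSum.
Variables (gT : finGroupType) (T : {group gT}) (B : zmodType) (phi : gT -> B).
Hypothesis phi_inv : forall u g, u \in T -> phi (u * g)%g = phi g.

(** The transfer from the subgroup [T] to the whole group. *)
Definition coset_sum (psi : gT -> B) : B := \sum_(C in rcosets T [set: gT]) psi (fingroup.repr C).

Lemma coset_repr g : phi (fingroup.repr (T :* g)%g) = phi g.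
Proof. by have /rcosetP[u uT ->] := mem_repr_rcoset T g; exact: phi_inv. Qed.

Lemma coset_sum_shift h : coset_sum (fun g => phi (g * h)%g) = coset_sum phi.
Proof.
rewrite [RHS]/coset_sum (reindex_inj (h := fun C : {set gT} => (C :* h)%g)); last first.
  exact: (can_inj (rcosetK h)).
apply: eq_big => C; first by apply/rcosetsP/rcosetsP => -[g _ e];
  [exists (g * h)%g; rewrite ?inE // e -rcosetM
  |exists (g * h^-1)%g; rewrite ?inE // -(rcosetK h C) e -rcosetM].
case/rcosetsP=> g _ ->; rewrite -rcosetM coset_repr.
by have /rcosetP[u uT ->] := mem_repr_rcoset T g; rewrite -mulgA phi_inv.
Qed.

Lemma coset_sum_const b : coset_sum (fun=> b) = b *+ #|[set: gT] : T|%g.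
Proof. by rewrite /coset_sum sumr_const. Qed.
End CosetSum.

Section NonsplitTorus.
Variable k : finFieldType.
Local Notation GL := {'GL_2[k]}.

(** The map [x |-> x^2 + x] takes the same value at [0] and at [-1], hence it is not
    surjective.  For such an [a], the polynomial [X^2 + X - a] is irreducible. *)
Lemma exists_irreducible : exists a : k, forall x, x ^+ 2 + x != a.
Proof.
apply: contrapT => no.
have surj a : exists x : k, x ^+ 2 + x = a.
  apply: contrapT => no'; apply: no; exists a => x; apply/eqP => e.
  by apply: no'; exists x.
have [g fg] : exists g : k -> k, cancel g (fun x => x ^+ 2 + x).
  by exists (fun a => projT1 (cid (surj a))) => a; case: cid.
have [h gh hg] := injF_bij (can_inj fg).
have e x : h x = x ^+ 2 + x by rewrite -[x in RHS]hg fg.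
have : h 0 = h (-1) by rewrite !e expr0n add0r sqrrN expr1n addrN.
by move/(congr1 g); rewrite !hg => /eqP; rewrite eq_sym oppr_eq0 oner_eq0.
Qed.

Variable a : k.
Hypothesis irr : forall x : k, x ^+ 2 + x != a.
Local Notation i0 := (ord0 : 'I_2.-1.+1).
Local Notation i1 := (ord_max : 'I_2.-1.+1).

(** The norm form of the quadratic extension, the determinant of [x + y M]. *)
Lemma norm_form_neq0 x y : (x, y) != (0, 0) -> x * (x - y) - a * y * y != 0.
Proof.
have [->|y0] := eqVneq y 0.
  by rewrite xpair_eqE eqxx andbT subr0 mulr0 subr0 mulf_eq0 orbb.
move=> _; apply: contra_neq (irr (- x / y)) => e.
apply/eqP; rewrite -subr_eq0; apply/eqP.
rewrite (_ : _ - a = (x * (x - y) - a * y * y) / y ^+ 2); last by field.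
by rewrite e mul0r.
Qed.

(** The nonsplit torus, realized as the multiplicative group of the subfield of
    matrices [x + y M] of the matrix ring, where [M] has characteristic
    polynomial [X^2 + X - a]. *)
Definition torus : {set GL} :=
  [set g : GL | (g i0 i1 == a * g i1 i0) && (g i1 i1 == g i0 i0 - g i1 i0)].

Lemma GL_coef (g h : GL) i j :
  GLval (g * h)%g i j = g i i0 * h i0 j + g i i1 * h i1 j.
Proof.
rewrite GL_MxE mxE !big_ord_recl big_ord0 addr0; congr (_ + g _ _ * h _ _); exact: val_inj.
Qed.

Lemma GL2_unit (g : GL) : (GLval g : 'M[k]_2) \in unitmx.
Proof. exact (GL_unit g). Qed.

Lemma mobius_GLM (g h : GL) (x : option k) :
  mobius (GLval (g * h)%g : 'M[k]_2) x = mobius (GLval g) (mobius (GLval h) x).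
Proof. by rewrite -mobiusM //; exact: GL2_unit. Qed.

Fact torus_group_set : group_set torus.
Proof.
apply/group_setP; split=> [|g h]; first by rewrite !inE GL_1E !mxE /= mulr0 subr0 !eqxx.
rewrite !inE !GL_coef => /andP[/eqP g01 /eqP g11] /andP[/eqP h01 /eqP h11].
by rewrite g01 g11 h01 h11; apply/andP; split; apply/eqP; ring.
Qed.
Canonical torus_group := Group torus_group_set.

Lemma torus_mx (g h : GL) : g \in torus -> h \in torus ->
  g i0 i0 = h i0 i0 -> g i1 i0 = h i1 i0 -> g = h.
Proof.
rewrite !inE => /andP[/eqP g01 /eqP g11] /andP[/eqP h01 /eqP h11] e0 e1.
have two (l : 'I_2) : l = ord0 \/ l = ord_max.
  by case: l => [[|[|]]] //= hl; [left|right]; exact: val_inj.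
apply: val_inj; apply/matrixP => i j.
by case: (two i) => ->; case: (two j) => ->; rewrite /= ?g01 ?g11 ?h01 ?h11 ?e0 ?e1.
Qed.

Lemma torus_exists x y : (x, y) != (0, 0) -> exists2 g : GL, g \in torus &
  g i0 i0 = x /\ g i1 i0 = y.
Proof.
move=> xy; pose M : 'M[k]_2 := \matrix_(i, j)
  if i == ord0 then (if j == ord0 then x else a * y) else (if j == ord0 then y else x - y).
have Mu : M \is a GRing.unit.
  by rewrite unitmxE unitfE det2E !mxE /= norm_form_neq0.
by exists (Sub M Mu : GL); rewrite ?inE !SubK !mxE /= ?eqxx.
Qed.

Lemma card_torus : #|torus| = (#|k| ^ 2).-1.
Proof.
pose f (g : GL) := (g i0 i0, g i1 i0).
have fi : {in torus &, injective f}.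
  by move=> g h gT hT [e0 e1]; exact: torus_mx.
have <- : #|[set~ (0 : k, 0 : k)]| = (#|k| ^ 2).-1.
  by rewrite cardsC1 card_prod -mulnn.
rewrite -(card_in_imset fi).
apply: eq_card => -[x y]; rewrite !inE; apply/imsetP/idP => [[g gT e]|xy].
  apply/negP => /eqP xy0; have := GL_det g; rewrite det2E.
  have [-> ->] : GLval g i0 i0 = 0 /\ GLval g i1 i0 = 0 by move: e; rewrite xy0 => -[].
  by rewrite mul0r mulr0 subrr eqxx.
by have [g gT [e0 e1]] := torus_exists xy; exists g; rewrite // /f e0 e1.
Qed.

Lemma torus_abelian : abelian torus.
Proof.
apply/centsP => g gT h hT; apply: torus_mx; rewrite ?groupM //;
  move: gT hT; rewrite !inE !GL_coef => /andP[/eqP g01 /eqP g11] /andP[/eqP h01 /eqP h11];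
  by rewrite ?g01 ?g11 ?h01 ?h11; ring.
Qed.

Lemma torus_cyclic : cyclic torus.
Proof.
apply: (div_ring_mul_group_cyclic (f := @GLval 2 k)); rewrite ?torus_abelian //.
move=> g /setD1P[g1 gT]; have xy : (GLval g i0 i0 - 1, GLval g i1 i0) != (0, 0).
  apply: contra g1 => /eqP[/eqP]; rewrite subr_eq0 => /eqP e0 e1.
  by apply/eqP/torus_mx; rewrite ?group1 // GL_1E !mxE.
rewrite unitmxE unitfE det2E !mxE /=.
move: (norm_form_neq0 xy) gT; rewrite inE => h /andP[/eqP -> /eqP ->].
apply: contra_neq h => h; rewrite -[RHS]h; ring.
Qed.

Lemma torus_transitive x y : exists2 u : GL, u \in torus & mobius u x = y.
Proof.
have key z : exists2 u : GL, u \in torus & mobius u None = z.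
  have [u uT [e0 e1]] := torus_exists (hvec_neq0 z).
  by exists u => //; rewrite /mobius /hact /= e0 e1 !mulr0 !addr0 !mulr1 -surjective_pairing hvecK.
have [[u uT <-] [w wT <-]] := (key x, key y).
exists (w * u^-1)%g; first by rewrite groupM ?groupV.
by rewrite -mobius_GLM mulgKV.
Qed.

Lemma index_torus : #|[set: GL] : torus|%g = (#|k| * #|k|.-1)%N.
Proof.
have q1 := card_finNzRing_gt1 k; have := card_GL_2 k.
rewrite -(Lagrange (finset.subsetT torus_group)) card_torus.
move: (#|_ : _|%g) (#|k|) q1 => N q q1 e.
have e2 : ((q ^ 2).-1 = q.-1 * q.+1)%N by rewrite -mulnn; case: q q1 {e} => // q _; nia.
rewrite e2 in e; apply/eqP; rewrite -(eqn_pmul2l (m := q.-1 * q.+1)); last first.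
  by rewrite muln_gt0 andbT -subn1 subn_gt0.
by apply/eqP; rewrite [LHS]e -mulnn; nia.
Qed.
End NonsplitTorus.

Section FinitePreBloch.
Variable k : finFieldType.
Local Notation E := (@bloch_cocycle k).
Local Notation X := (option k).
Implicit Types (x y z w : X).

Lemma bloch_cocycle_adjl x z w : E x x z w = 0.
Proof. by rewrite /bloch_cocycle /extend_degenerate eqxx. Qed.

Lemma bloch_cocycle_adjm x y w : E x y y w = 0.
Proof. by rewrite /bloch_cocycle /extend_degenerate eqxx orbT. Qed.

Lemma bloch_cocycle_alt x y : E x y x y = 0.
Proof. by rewrite /bloch_cocycle /extend_degenerate !eqxx; case: ifP. Qed.

Lemma bloch_cocycle_closed x y z : uniq [:: x; y; z] -> E x y z x = bloch_const k.
Proof.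
rewrite /= !inE !negb_or => /and3P[/andP[xy xz] yz _].
rewrite /bloch_cocycle /extend_degenerate (negPf xy) (negPf yz) (eq_sym z) (negPf xz) /=.
by rewrite (eq_sym y) (negPf xy) eqxx.
Qed.

Lemma bloch_cocycle_std (x : k) : x != 0 -> x != 1 ->
  E (Some 0) None (Some 1) (Some x) = bloch x *+ 4.
Proof.
move=> x0 x1; rewrite /bloch_cocycle /extend_degenerate cross_std /=.
by rewrite !(inj_eq Some_inj) !(eq_sym _ x) (negPf x0) (negPf x1) eq_sym oner_eq0.
Qed.

Lemma triple_const (A : Type) (phi : X -> X -> X -> A) :
  (forall M x y z, M \in unitmx -> phi (mobius M x) (mobius M y) (mobius M z) = phi x y z) ->
  forall x y z, uniq [:: x; y; z] -> phi x y z = phi (Some 0) None (Some 1).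
Proof. by move=> h x y z /mobius_triple[M Mu [<- <- <-]]; rewrite h. Qed.

Lemma uniq_std (x : k) : x != 0 -> x != 1 -> uniq [:: Some 0; None; Some 1; Some x].
Proof.
move=> x0 x1; have n01 : (0 == 1 :> k) = false by rewrite eq_sym oner_eq0.
by rewrite /= !inE !(inj_eq Some_inj) !(eq_sym _ x) (negPf x0) (negPf x1) n01.
Qed.

(** As [GL_2] is transitive on triples of distinct points, [phi] takes a single value on
    them, and the alternating sum of four equal terms is 0. *)
Lemma triple_coboundary (A : zmodType) (phi : X -> X -> X -> A) :
  (forall M x y z, M \in unitmx -> phi (mobius M x) (mobius M y) (mobius M z) = phi x y z) ->
  forall x y z w, uniq [:: x; y; z; w] -> phi y z w - phi x z w + phi x y w - phi x y z = 0.
Proof.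
move=> h x y z w; rewrite /= !inE !negb_or => /and4P[/and3P[xy xz xw] /andP[yz yw] zw _].
rewrite !(triple_const h) /= ?inE ?negb_or ?xy ?xz ?xw ?yz ?yw ?zw //.
by rewrite subrr add0r subrr.
Qed.

(** Summing the five-term relation over all first points [p] writes [4 (q + 1) [x]] as the
    coboundary of an invariant function of triples. *)
Lemma bloch_annihilated (x : k) : x != 0 -> x != 1 -> bloch x *+ 4 *+ #|k|.+1 = 0.
Proof.
move=> x0 x1; pose H y z w := \sum_(p : X) E p y z w.
have H_inv M y z w : M \in unitmx -> H (mobius M y) (mobius M z) (mobius M w) = H y z w.
  move=> Mu; rewrite /H (reindex_inj (mobius_inj Mu)).
  by apply: eq_bigr => p _; rewrite bloch_cocycle_mobius.
have u := uniq_std x0 x1; have := triple_coboundary H_inv u.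
rewrite -bloch_cocycle_std //; move: (Some 0) None (Some 1) (Some x) => a b c d {u} h.
have : \sum_(p : X) (E a b c d - E p b c d + E p a c d - E p a b d + E p a b c) = 0.
  by apply: big1 => p _; exact: bloch_cocycle5.
rewrite big_split sumrB big_split sumrB /= -!/(H _ _ _) sumr_const card_option => e.
by move: e; set s := E a b c d *+ _ => e; rewrite -[RHS](addr0 0) -{1}e -h; abelian.
Qed.

Lemma bloch_01 (x : k) : ~ has_card k 2 -> (x == 0) || (x == 1) -> bloch x = 0.
Proof.
move=> h2 /orP[] /eqP ->; first exact: quotient_relation (kill_zero h2).
exact: quotient_relation (kill_one k).
Qed.

Lemma preBloch_annihilated (p : preBloch k) : ~ has_card k 2 -> p *+ (4 * #|k|.+1) = 0.
Proof.
move=> h2; elim/preBloch_ind: p => [|p q hp hq|x]; first by rewrite mul0rn.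
  by rewrite mulrnBl hp hq subrr.
have [x01|] := boolP ((x == 0) || (x == 1)); first by rewrite bloch_01 // mul0rn.
by rewrite negb_or mulrnA => /andP[x0 x1]; exact: bloch_annihilated.
Qed.

Lemma has_card_fin m : has_card k m -> #|k| = m.
Proof.
have e : ([set: k] #= `I_#|k|)%card.
  apply: card_eq_trans (_ : ([set: 'I_#|k|] #= `I_#|k|)%card); last first.
    by rewrite card_eq_sym card_II.
  have -> : [set: 'I_#|k|]%classic = ((@enum_rank k) @` [set: k])%classic.
    by apply/seteqP; split=> // i _; exists (enum_val i); rewrite ?enum_valK.
  by rewrite card_eq_sym; apply: inj_card_eq => x y _ _; exact: enum_rank_inj.
rewrite /has_card card_eq_sym => h; have /card_eq_II := card_eq_trans h e.
by [].
Qed.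

(** If [q] is 2 modulo 3, the order [q + 1] of the torus modulo scalars is divisible
    by 3.  A generator [theta] of the torus acts on the projective line as a simply
    transitive cycle [t], so that the cocycle is known over the torus, and a transfer
    extends this knowledge to [GL_2]. *)
Section TwoModThree.
Hypothesis q2 : (#|k| %% 3 = 2)%N.
Hypothesis h2 : ~ has_card k 2.
Hypothesis h3 : ~ has_card k 3.
Variables (a : k).
Hypothesis irr : forall x : k, x ^+ 2 + x != a.
Variable theta : {'GL_2[k]}.
Hypothesis theta_gen : torus a = <[theta]>%g.
Local Notation T := (torus_group a).
Local Notation t := (mobius (GLval theta : 'M[k]_2)).
Local Notation n := #|{: X}|.

Lemma t_inj : injective t. Proof. exact: mobius_inj (GL2_unit theta). Qed.

Lemma iter_t i x : iter i t x = mobius (GLval (theta ^+ i)%g : 'M[k]_2) x.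
Proof.
elim: i x => [|i IH] x /=; last by rewrite IH expgS mobius_GLM.
by rewrite -[LHS]mobius1.
Qed.

Lemma t_trans x y : fconnect t x y.
Proof.
have [u + <-] := torus_transitive irr x y; rewrite theta_gen => /cycleP[i ->].
by rewrite -iter_t fconnect_iter.
Qed.

Lemma card_X : n = #|k|.+1. Proof. exact: card_option. Qed.
Lemma card_X_gt1 : (1 < n)%N.
Proof. by rewrite card_X ltnS ltnW // card_finNzRing_gt1. Qed.

Lemma torus_inv (B : Type) (phi : X -> X -> X -> X -> B) :
  (forall x y z w, phi (t x) (t y) (t z) (t w) = phi x y z w) ->
  forall (u g : {'GL_2[k]}) x y z w, u \in torus a ->
  phi (mobius (GLval (u * g)%g : 'M[k]_2) x) (mobius (GLval (u * g)%g : 'M[k]_2) y)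
    (mobius (GLval (u * g)%g : 'M[k]_2) z) (mobius (GLval (u * g)%g : 'M[k]_2) w)
  = phi (mobius (GLval g : 'M[k]_2) x) (mobius (GLval g : 'M[k]_2) y)
     (mobius (GLval g : 'M[k]_2) z) (mobius (GLval g : 'M[k]_2) w).
Proof.
move=> h u g x y z w; rewrite theta_gen => /cycleP[i ->]; rewrite !mobius_GLM -!iter_t.
move: (mobius _ x) (mobius _ y) (mobius _ z) (mobius _ w) => {}x {}y {}z {}w.
by elim: i => //= i IH; rewrite h.
Qed.

Definition torus_avg (B : zmodType) (phi : X -> X -> X -> X -> B) x y z w : B :=
  coset_sum T (fun g => phi (mobius (GLval g : 'M[k]_2) x) (mobius (GLval g : 'M[k]_2) y)
     (mobius (GLval g : 'M[k]_2) z) (mobius (GLval g : 'M[k]_2) w)).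

Lemma torus_avg_inv (B : zmodType) (phi : X -> X -> X -> X -> B) :
  (forall x y z w, phi (t x) (t y) (t z) (t w) = phi x y z w) ->
  forall (M : 'M[k]_2) x y z w, M \in unitmx ->
  torus_avg phi (mobius M x) (mobius M y) (mobius M z) (mobius M w) = torus_avg phi x y z w.
Proof.
move=> h M x y z w Mu; pose g : {'GL_2[k]} := Sub M Mu.
have e := coset_sum_shift (fun u g uT => torus_inv h g x y z w uT) g.
rewrite /torus_avg -[RHS]e; apply: eq_bigr => C _; rewrite !mobius_GLM.
by [].
Qed.

Let beta := loop_gen t E None.

Lemma E_t x y z w : E (t x) (t y) (t z) (t w) = E x y z w.
Proof. exact: bloch_cocycle_mobius (GL2_unit theta). Qed.

Lemma beta_order : beta *+ n = 0.
Proof.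
exact: (loop_gen_order t_inj t_trans (@bloch_cocycle5 k) E_t).
Qed.

Lemma beta_mod i : beta *+ (i %% n) = beta *+ i.
Proof.
by rewrite [in RHS](divn_eq i n) mulrnDr mulnC mulrnA beta_order mul0rn add0r.
Qed.

(** The orbit of a point under the subgroup of order 3 is a triangle of distinct points,
    on which the closed tuple takes the value [bloch_const]. *)
Lemma beta_third m : n = (3 * m)%N -> beta *+ m = bloch_const k.
Proof.
move=> n3; have n1 := card_X_gt1.
apply: (loop_gen_third t_inj t_trans (@bloch_cocycle5 k) E_t n3
  bloch_cocycle_alt bloch_cocycle_adjm); apply: bloch_cocycle_closed.
have di i : (i < n)%N -> findex t None (iter i t None) = i := dist_iter t_trans None.
have d0 := di 0%N; rewrite /= in d0.
have ne i j : (i < n)%N -> (j < n)%N -> i != j -> iter i t None != iter j t None.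
  by move=> hi hj; apply: contra_neq => e; rewrite -(di i hi) e di.
rewrite /= !inE negb_or (ne 0%N m) ?(ne 0%N (m + m)%N) ?(ne m (m + m)%N) //; lia.
Qed.

Local Notation cup := (torus_avg (@carry_cup X t)).

Lemma cup_inv (M : 'M[k]_2) x y z w : M \in unitmx ->
  cup (mobius M x) (mobius M y) (mobius M z) (mobius M w) = cup x y z w.
Proof.
by apply: torus_avg_inv => {}x {}y {}z {}w; exact: (carry_cup_shift t_trans).
Qed.

Lemma cup5 x y z w u : cup y z w u - cup x z w u + cup x y w u - cup x y z u + cup x y z w = 0.
Proof.
rewrite /torus_avg /coset_sum; apply: sum_cocycle5 => C.
exact: (carry_cup5 t_inj t_trans _ _ _ _ _ card_X_gt1).
Qed.

(** The transferred cup product, as a function of the cross ratio: it satisfies the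
    five-term relation, hence defines a homomorphism on the pre-Bloch group. *)
Definition cup_symbol (s : k) : 'Z_n :=
  if (s == 0) || (s == 1) then 0 else cup (Some 0) None (Some 1) (Some s).

Lemma cup_cross x y z w : uniq [:: x; y; z; w] -> cup x y z w = cup_symbol (cross x y z w).
Proof.
move=> h; have [M Mu [ex ey ez]] : exists2 M : 'M[k]_2, M \in unitmx &
    [/\ mobius M (Some 0) = x, mobius M None = y & mobius M (Some 1) = z].
  apply: mobius_triple; move: h; rewrite /= !inE !negb_or.
  by case/and4P=> /and3P[-> -> _] /andP[-> _] _ _.
have [w' ew] : exists w', mobius M w' = w.
  by exists (mobius (invmx M) w); rewrite -mobiusM ?unitmx_inv // mulmxV // mobius1.
rewrite -ex -ey -ez -ew in h *.
have h' : uniq [:: Some 0; None; Some 1; w'].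
  by rewrite -(map_inj_uniq (mobius_inj Mu)); exact: h.
rewrite cup_inv // cross_mobius //; case: w' h' {ew h} => [s|]; last by rewrite /= !inE ?eqxx ?orbT ?andbF.
move=> h'; have s0 : s != 0 by apply: contraTneq h' => ->; rewrite /= !inE eqxx ?orbT ?andbF.
have s1 : s != 1 by apply: contraTneq h' => ->; rewrite /= !inE eqxx ?orbT ?andbF.
by rewrite cross_std /cup_symbol (negPf s0) (negPf s1).
Qed.

Lemma cup_symbol5 x y z w u : uniq [:: x; y; z; w; u] ->
  cup_symbol (cross y z w u) - cup_symbol (cross x z w u) + cup_symbol (cross x y w u)
    - cup_symbol (cross x y z u) + cup_symbol (cross x y z w) = 0.
Proof.
rewrite [uniq _]/= !inE !negb_or -!andbA.
case/and5P=> xy xz xw xu /and5P[yz yw yu zw /and3P[zu wu _]].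
rewrite -!cup_cross ?cup5 //= !inE !negb_or;
  by rewrite ?xy ?xz ?xw ?xu ?yz ?yw ?yu ?zw ?zu ?wu.
Qed.

Definition cup_chain (c : {freeg k}) : 'Z_n := fglift (cup_symbol : k -> zmodule 'Z_n) c.
Fact cup_chain_additive : zmod_morphism cup_chain.
Proof. by move=> x y; rewrite /cup_chain raddfB. Qed.
HB.instance Definition _ :=
  GRing.isZmodMorphism.Build {freeg k} 'Z_n cup_chain cup_chain_additive.

Lemma cup_chainU s : cup_chain << s >> = cup_symbol s.
Proof. by rewrite /cup_chain liftU scale1r. Qed.

Lemma cup_chain_relation c : preBloch_relation c -> cup_chain c = 0.
Proof.
case=> [x y x0 x1 y0 y1 xy||h|h|h].
- rewrite !raddfD !raddfN /= !cup_chainU.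
  have n01 : (0 == 1 :> k) = false by rewrite eq_sym oner_eq0.
  have u5 : uniq [:: Some 0; None; Some 1; Some x; Some y].
    rewrite /= !inE !(inj_eq Some_inj) n01 !(eq_sym _ x) !(eq_sym _ y) (negPf x0) (negPf x1).
    by rewrite (negPf y0) (negPf y1) (eq_sym y x) (negPf xy).
  have [ux uy] := (uniq_std x0 x1, uniq_std y0 y1).
  have xy' : Some x != Some y by rewrite (inj_eq Some_inj).
  have e1 := cross_div ux uy xy'; have e2 := cross_div_sub ux uy xy'.
  have e3 := cross_div_subV ux uy xy'; rewrite !cross_std in e1 e2 e3.
  have := cup_symbol5 u5; rewrite !cross_std -e1 -e2 -e3 => <-.
  by abelian.
- by rewrite cup_chainU /cup_symbol eqxx orbT.
- by rewrite cup_chainU /cup_symbol eqxx.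
- by [].
by [].
Qed.

Definition cup_class : preBloch k -> 'Z_n := quotient_lift cup_chain_relation.
HB.instance Definition _ := GRing.Additive.on cup_class.

Lemma cup_class_bloch s : cup_class (bloch s) = cup_symbol s.
Proof. exact: etrans (quotient_liftE cup_chain_relation << s >>) (cup_chainU s). Qed.

Lemma beta_valD (z w : 'Z_n) : beta *+ (z + w)%R = beta *+ z + beta *+ w.
Proof.
rewrite -mulrnDr -[RHS]beta_mod; congr (beta *+ _).
change ((z + w) %% (Zp_trunc n).+2 = (z + w) %% n)%N.
by congr (_ %% _)%N; exact: Zp_cast card_X_gt1.
Qed.

Local Notation N := #|[set: {'GL_2[k]}] : T|%g.

(** Over the torus the cocycle is [beta] times the cup product, up to a coboundary
    [bd]; the transfer multiplies the cocycle, invariant under [GL_2], by the index [N], and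
    turns [bd] into an invariant function of triples, whose coboundary is 0. *)
Lemma bloch_transfer (s : k) : s != 0 -> s != 1 ->
  bloch s *+ 4 *+ N = beta *+ cup (Some 0) None (Some 1) (Some s).
Proof.
move=> s0 s1; have u := uniq_std s0 s1; rewrite -bloch_cocycle_std //.
move: (Some 0) None (Some 1) (Some s) u => x y z w u.
pose bd := bounding t E.
have bd_inv (p q r s' : X) : (fun x y z _ => bd x y z) (t p) (t q) (t r) (t s') = bd p q r.
  exact: (bounding_shift t_trans E_t).
pose H x y z := torus_avg (fun x y z _ => bd x y z) x y z z.
have H_inv M p q r : M \in unitmx -> H (mobius M p) (mobius M q) (mobius M r) = H p q r.
  by move=> Mu; exact: (torus_avg_inv bd_inv).
have := triple_coboundary H_inv u.
rewrite -(coset_sum_const T) /H /torus_avg /coset_sum => h.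
pose mg (g : {'GL_2[k]}) : 'M[k]_2 := GLval g.
transitivity (\sum_(C in rcosets T [set: {'GL_2[k]}])
   ((bd (mobius (mg (fingroup.repr C)) y) (mobius (mg (fingroup.repr C)) z) (mobius (mg (fingroup.repr C)) w)
   - bd (mobius (mg (fingroup.repr C)) x) (mobius (mg (fingroup.repr C)) z) (mobius (mg (fingroup.repr C)) w)
   + bd (mobius (mg (fingroup.repr C)) x) (mobius (mg (fingroup.repr C)) y) (mobius (mg (fingroup.repr C)) w)
   - bd (mobius (mg (fingroup.repr C)) x) (mobius (mg (fingroup.repr C)) y) (mobius (mg (fingroup.repr C)) z))
   + beta *+ (carry t (mobius (mg (fingroup.repr C)) x) (mobius (mg (fingroup.repr C)) y) (mobius (mg (fingroup.repr C)) z)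
      * findex t (mobius (mg (fingroup.repr C)) z) (mobius (mg (fingroup.repr C)) w)))).
  apply: eq_bigr => C _; rewrite -(bloch_cocycle_mobius x y z w (GL2_unit (fingroup.repr C))).
  exact: (cyclic_cocycle t_inj t_trans (@bloch_cocycle5 k) E_t bloch_cocycle_adjl).
rewrite big_split sumrB big_split sumrB /= [X in X + _]h add0r sumrMnr -[LHS]beta_mod.
congr (beta *+ _); rewrite /carry_cup -natr_sum.
by rewrite val_Zp_nat; last exact: card_X_gt1.
Qed.

Lemma preBloch_transfer (p : preBloch k) : p *+ (4 * N) = beta *+ cup_class p.
Proof.
elim/preBloch_ind: p => [|p q hp hq|s].
- by rewrite mul0rn raddf0.
- rewrite mulrnBl hp hq; apply/eqP; rewrite subr_eq; apply/eqP.
  by rewrite -beta_valD -raddfD /= subrK.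
rewrite cup_class_bloch /cup_symbol mulrnA.
have [s01|] := boolP ((s == 0) || (s == 1)); first by rewrite bloch_01 ?mul0rn.
by rewrite negb_or => /andP[s0 s1]; exact: bloch_transfer.
Qed.

(** If [3 p = 0], then [cup_class p] is a multiple of [n / 3] in [Z / n], so that
    [4 N p] is a multiple of [(n / 3) beta], which is [bloch_const].  Finally [4 N] is -1
    modulo 3, since [N = q (q - 1)]. *)
Lemma torsion_two_mod_three (p : preBloch k) : p *+ 3 = 0 ->
  exists r : int, p = bloch_const k *~ r.
Proof.
move=> p3; have n1 := card_X_gt1; pose m := (n %/ 3)%N.
have n3 : n = (3 * m)%N by rewrite /m card_X; move: q2; lia.
have : (cup_class p *+ 3 : 'Z_n) = 0 by rewrite -raddfMn p3 raddf0.
rewrite -[X in X *+ 3]natr_Zp -mulrnA => /(congr1 (fun z : 'Z_n => z : nat)).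
rewrite val_Zp_nat // => e.
have [r er] : exists r, (cup_class p : nat) = (r * m)%N.
  exists (cup_class p %/ m)%N; apply/esym/eqP; rewrite -dvdn_eq -(@dvdn_pmul2l 3) // -n3.
  by rewrite mulnC /dvdn; apply/eqP; exact: e.
have := preBloch_transfer p; rewrite er [(r * m)%N]mulnC [RHS]mulrnA (beta_third n3) index_torus // => ep.
exists (- r%:Z); rewrite mulrNz -pmulrn -ep.
have -> : (4 * (#|k| * #|k|.-1))%N = (3 * ((4 * (#|k| * #|k|.-1)) %/ 3) + 2)%N.
  rewrite {1}(divn_eq (4 * (#|k| * #|k|.-1)) 3) mulnC; congr (_ + _)%N.
  rewrite (divn_eq #|k| 3) q2 addn2 /=; move: (#|k| %/ 3)%N => u.
  have -> : (4 * ((u * 3).+2 * (u * 3).+1) = (12 * u * u + 12 * u + 2) * 3 + 2)%N by nia.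
  by rewrite modnMDl.
rewrite mulrnDr mulrnA p3 mul0rn add0r.
by apply/eqP; rewrite -subr_eq0 opprK -mulrS p3.
Qed.
End TwoModThree.

(** If [q] is not 2 modulo 3, then [4 (q + 1)] is prime to 3 and kills the group.  The
    field with two elements, over which there are no five-term relations, is apart. *)
Theorem finite_preBloch_torsion (p : preBloch k) : p *+ 3 = 0 ->
  exists r : int, p = bloch_const k *~ r.
Proof.
move=> p3; have [h2|h2] := pselect (has_card k 2).
  have q2 := has_card_fin h2.
  have k01 (x : k) : (x == 0) || (x == 1).
    apply/negPn/negP; rewrite negb_or => /andP[x0 x1].
    have u : uniq [:: 0; 1; x].
      by rewrite /= !inE negb_or !(eq_sym _ x) x0 x1 eq_sym oner_eq0.
    by have := max_card [in [:: 0; 1; x]]; rewrite (card_uniqP u) q2.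
  have c0 : bloch_const k = bloch 0.
    rewrite /bloch_const; case: pselect => // h; exfalso; case: h => x [x0 x1].
    by move: (k01 x); rewrite (negPf x0) (negPf x1).
  rewrite c0; elim/preBloch_ind: p {p3} => [|p q [r ->] [s ->]|x].
  - by exists 0.
  - by exists (r - s); rewrite mulrzBr.
  have /orP[/eqP ->|/eqP ->] := k01 x; first by exists 1.
  by exists 0; rewrite mulr0z; exact: quotient_relation (kill_one k).
have [q2|q2] := eqVneq (#|k| %% 3)%N 2%N.
  have h3 : ~ has_card k 3 by move=> /has_card_fin q3; rewrite q3 in q2.
  have [a irr] := exists_irreducible k.
  have /cyclicP[theta hth] := torus_cyclic irr.
  exact: (torsion_two_mod_three q2 h2 h3 irr hth p3).
exists 0; rewrite mulr0z; have := preBloch_annihilated p h2.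
have [r [e|e]] : exists r, (4 * #|k|.+1 = r * 3 + 1 \/ 4 * #|k|.+1 = r * 3 + 2)%N.
  exists ((4 * #|k|.+1) %/ 3)%N; move: q2; lia.
- by rewrite e mulrnDr mulnC mulrnA p3 mul0rn add0r.
rewrite e mulrnDr mulnC mulrnA p3 mul0rn add0r => p2.
by rewrite -[p]addr0 -p2 -mulrS p3.
Qed.
End FinitePreBloch.

(** An enumeration makes a field a [finFieldType] with the same field structure. *)
Section EnumeratedField.
Variables (K : fieldType) (s : seq K).
Hypothesis hs : forall x, x \in s.

Let code (x : K) := index x s.
Let decode n : option K := if (n < size s)%N then Some (nth 0 s n) else None.
Let codeK : pcancel code decode.
Proof. by move=> x; rewrite /decode /code index_mem hs nth_index. Qed.
Let cntM := isCountable.Build K codeK.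
Let C : countType := HB.pack K cntM.
Let axiomC : @Finite.axiom C (undup s).
Proof.
by apply: Finite.uniq_enumP => [|x]; rewrite ?undup_uniq // mem_undup hs.
Qed.
Let finM := isFinite.Build K axiomC.
Let KF : finFieldType := HB.pack K cntM finM.

(* Transporting along this equality moves statements about finite fields to [K]. *)
Let fieldE : (KF : fieldType) = K.
Proof. rewrite /KF; move: finM; rewrite /C; by move: cntM => c; case: (K) c => L []. Qed.

Lemma enumerated_preBloch_torsion (p : preBloch K) : p *+ 3 = 0 ->
  exists r : int, p = bloch_const K *~ r.
Proof.
have h := @finite_preBloch_torsion KF; rewrite fieldE in h; exact: h.
Qed.
End EnumeratedField.

(** * Finiteness in the arithmetic of number fields *)

Section ResidueCharacteristic.
Variables (F : fieldExtType rat) (v : finite_prime F).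
Local Notation Ov := (valring_pred v).
Implicit Types (x y : F).

Lemma natr_neq0 m : (0 < m)%N -> m%:R != 0 :> F.
Proof.
by move=> m0; rewrite -scaler_nat scaler_eq0 oner_eq0 orbF pnatr_eq0 -lt0n.
Qed.

Lemma valring_nat m : Ov m%:R.
Proof. by elim: m => [|m IH]; rewrite ?valring0 // mulrS valringD ?valring1. Qed.

Lemma valring_int (m : int) : Ov m%:~R.
Proof. by case: m => m; rewrite ?NegzE ?mulrNz ?valringN // valring_nat. Qed.

Lemma valring_sum (I : Type) (r : seq I) (P : pred I) (f : I -> F) :
  (forall i, P i -> Ov (f i)) -> Ov (\sum_(i <- r | P i) f i).
Proof. by move=> h; apply: (big_ind (fun x => Ov x)) => //; [exact: valring0|exact: valringD]. Qed.

Lemma valuation_ge_sum c (I : Type) (r : seq I) (P : pred I) (f : I -> F) :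
  (forall i, P i -> valuation_ge v c (f i)) -> valuation_ge v c (\sum_(i <- r | P i) f i).
Proof.
move=> h; apply: (big_ind (valuation_ge v c)) => //; first by rewrite /valuation_ge eqxx.
move=> x y hx hy; rewrite -[y]opprK; apply: valuation_geB => //.
by rewrite -sub0r; apply: valuation_geB => //; rewrite /valuation_ge eqxx.
Qed.

Lemma valring_exp x m : Ov x -> Ov (x ^+ m).
Proof. by move=> Ox; elim: m => [|m IH]; rewrite ?expr0 ?valring1 // exprS valringM. Qed.

(** The valuation ring is integrally closed: dividing the equation by the leading power
    of an element [x] of negative valuation would give [-1] a positive valuation. *)
Lemma valring_root (p : {poly F}) x : p \is monic -> (forall i, Ov p`_i) ->
  root p x -> Ov x.
Proof.
move=> pm Op /rootP; rewrite horner_coef => px.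
have [//|nOx] := boolP (Ov x).
have x0 : x != 0 by apply: contraNneq nOx => ->; exact: valring0.
have vx : 1 <= v x^-1.
  by rewrite valuationV -[1]add0r lezD1 oppr_gt0 ltNge -valringE.
have Ox' : Ov x^-1 by rewrite valringE ?invr_eq0 // (le_trans _ vx).
case sp: (size p) => [|n].
  by move: pm; rewrite monicE lead_coefE sp nth_default ?sp // eq_sym oner_eq0.
rewrite sp big_ord_recr /= in px.
have pn : p`_n = 1 by have := monicP pm; rewrite lead_coefE sp.
rewrite pn mul1r in px.
have e : \sum_(i < n) (p`_i * x ^+ i) / x ^+ n = -1.
  have xn0 : x ^+ n != 0 by rewrite expf_eq0 negb_and x0 orbT.
  rewrite -mulr_suml; apply: (mulIf xn0); rewrite divfK // mulN1r.
  by apply/eqP; rewrite -addr_eq0 px.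
have : valuation_ge v 1 (-1 : F).
  rewrite -e; apply: valuation_ge_sum => i _.
  have -> : p`_i * x ^+ i / x ^+ n = p`_i * (x^-1 * x^-1 ^+ (n - i).-1).
    rewrite -exprS prednK ?subn_gt0 // -mulrA; congr (_ * _).
    by rewrite -exprVn -[in x^-1 ^+ n](subnKC (ltnW (ltn_ord i))) exprD mulrA -exprMn mulfV // expr1n mul1r.
  rewrite mulrC -mulrA -[1]addr0; apply: valuation_geM; first by rewrite /valuation_ge vx orbT.
  by apply: valringM => //; exact: valring_exp.
by rewrite /valuation_ge oppr_eq0 oner_eq0 valuationN valuation1.
Qed.

(** Otherwise the valuation ring contains the rational numbers, and hence everything
    that is integral over them, which is the whole field. *)
Lemma residue_char_exists : exists2 m : nat, (0 < m)%N & valuation_ge v 1 (m%:R : F).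
Proof.
apply: contrapT => no.
have vn m : (0 < m)%N -> v (m%:R : F) = 0.
  move=> m0; apply/eqP; rewrite eq_le -valringE ?natr_neq0 // valring_nat andbT.
  rewrite -ltzD1 add0r ltNge; apply/negP => h; apply: no; exists m => //.
  by rewrite /valuation_ge h orbT.
have Orat (r : rat) : Ov (r%:A : F).
  have [d ed] : exists d : nat, denq r = d.+1%:Z.
    by case: (denq r) (denq_gt0 r) => [[|d]|] // _; exists d.
  have Od : Ov (d.+1%:R)^-1 by rewrite valringE ?invr_eq0 ?natr_neq0 // valuationV vn.
  have -> : r%:A = (numq r)%:~R / d.+1%:R :> F.
    rewrite -in_algE -[r in LHS]divq_num_den fmorph_div !rmorph_int ed.
    by rewrite pmulrn.
  by apply: valringM => //; exact: valring_int.
have Oall x : Ov x.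
  apply: (valring_root (monic_minPoly 1%AS x) _ (root_minPoly 1%AS x)) => i.
  by have /polyOverP/(_ i)/vlineP[r ->] := minPolyOver 1%AS x.
have [x x0 vx] := valuation_surj v.
by have := Oall x^-1; rewrite valringE ?invr_eq0 // valuationV vx.
Qed.

Definition residue_char := ex_minn (let: ex_intro2 m m0 hm := residue_char_exists in
  ex_intro (fun m => (0 < m)%N && valuation_ge v 1 (m%:R : F)) m (introT andP (conj m0 hm))).
Local Notation p := residue_char.

Lemma residue_charP : [/\ (0 < p)%N, valuation_ge v 1 (p%:R : F) &
  forall m, (0 < m)%N -> valuation_ge v 1 (m%:R : F) -> (p <= m)%N].
Proof.
rewrite /residue_char; case: ex_minnP => m /andP[m0 hm] h; split=> // m' m'0 hm'.
by apply: h; rewrite m'0.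
Qed.

Lemma valuation_ge1_unit x y : Ov x -> Ov y -> valuation_ge v 1 (x * y) ->
  valuation_ge v 1 x || valuation_ge v 1 y.
Proof.
move=> Ox Oy; apply: contraTT; rewrite negb_or -!residue_of_eq0 ?valringM //.
by rewrite residue_ofM // mulf_eq0 negb_or.
Qed.

Lemma residue_char_prime : prime p.
Proof.
have [p0 hp pmin] := residue_charP; apply/primeP; split.
  rewrite ltn_neqAle eq_sym p0 andbT; apply/eqP => p1; move: hp; rewrite p1.
  by rewrite /valuation_ge oner_eq0 valuation1.
move=> d /dvdnP[e pe]; have := hp; rewrite pe natrM => h.
have e0 : (0 < e)%N by move: p0; rewrite pe; case: (e).
have d0 : (0 < d)%N by move: p0; rewrite pe; case: (d) => //; rewrite muln0.
case/orP: (valuation_ge1_unit (valring_nat _) (valring_nat _) h) => h1.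
  have := pmin _ e0 h1; rewrite pe -[X in (_ <= X)%N]muln1 leq_pmul2l // => d1.
  by rewrite eqn_leq d1 d0.
have := pmin _ d0 h1; rewrite pe -[X in (_ <= X)%N]mul1n leq_pmul2r // => e1.
have -> : e = 1%N by apply/eqP; rewrite eqn_leq e1 e0.
by rewrite mul1n eqxx orbT.
Qed.

Lemma residue_char_dvd (m : int) : valuation_ge v 1 (m%:~R : F) = (p %| m)%Z.
Proof.
have [p0 hp pmin] := residue_charP.
have hq (a : int) : valuation_ge v 1 ((a * p)%:~R : F).
  rewrite rmorphM /= -[1]add0r; apply: valuation_geM; [exact: valring_int|exact: hp].
apply/idP/idP => [h|/dvdzP[q ->]]; last exact: hq.
rewrite (divz_eq m p); apply: rpredD; first exact: dvdz_mull.
have pn0 : (p : int) != 0 by move: p0; case: (p).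
have := ltz_mod m pn0; have := modz_ge0 m pn0; case em: (m %% p)%Z => [r|] // _.
rewrite ltz_nat => rp; have hr : valuation_ge v 1 (r%:R : F).
  have -> : (r%:R : F) = m%:~R - ((m %/ p)%Z * p)%:~R.
    by rewrite {1}(divz_eq m p) rmorphD /= em addrAC addrN add0r.
  by apply: valuation_geB.
case: (posnP r) => [->|r0]; first by rewrite dvdz0.
by have := pmin r r0 hr; rewrite leqNgt; move: rp; rewrite ?absz_nat => ->.
Qed.

(** A rational linear dependence between [d + 1] elements, where [d] is the degree of the
    field, cleared of its denominators and then divided by [p] as often as possible. *)
Lemma integer_relation (e : nat -> F) : exists c : nat -> int,
  (exists2 i, (i < (\dim {:F}).+1)%N & ~~ (p %| c i)%Z) /\
  \sum_(i < (\dim {:F}).+1) e i *~ c i = 0.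
Proof.
set d := \dim {:F}.
have [k [i0 ki0] sum0] : exists2 k : 'I_d.+1 -> rat, exists i, k i != 0 &
    \sum_(i < d.+1) k i *: e i = 0.
  have nf : ~~ free [tuple e i | i < d.+1].
    apply/negP; rewrite /free size_tuple => /eqP h.
    by have := dimvS (subvf <<[tuple e i | i < d.+1]>>%VS); rewrite h ltnn.
  apply: contrapT => no; move/negP: nf; apply; apply/freeP => k hk i.
  apply: contrapT => /eqP ki; apply: no; exists k; first by exists i.
  by rewrite -[RHS]hk; apply: eq_bigr => j _; rewrite -tnth_nth tnth_mktuple.
pose D : int := \prod_(j < d.+1) denq (k j).
have D0 : D != 0 by apply/prodf_neq0 => j _; exact: denq_neq0.
pose c0 (i : nat) : int := numq (k (inord i)) * \prod_(j < d.+1 | j != inord i) denq (k j).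
have c0E (i : 'I_d.+1) : (c0 i)%:~R = k i * D%:~R :> rat.
  rewrite /c0 inord_val /D [in RHS](bigD1 i) //= !intrM mulrA; congr (_ * _).
  exact: numqE.
have key : forall b (c : nat -> int), (exists2 i, (i < d.+1)%N & (0 < `|c i| <= b)%N) ->
    \sum_(i < d.+1) e i *~ c i = 0 ->
    exists c : nat -> int, (exists2 i, (i < d.+1)%N & ~~ (p %| c i)%Z) /\
      \sum_(i < d.+1) e i *~ c i = 0.
  elim=> [|b IH] c [i id /andP[ci0 cib]] hc; first by rewrite leqNgt ci0 in cib.
  have [pc|npc] := boolP (p %| c i)%Z; last by exists c; split=> //; exists i.
  have [[j [jd npj]]|alld] := pselect (exists j, (j < d.+1)%N /\ ~~ (p %| c j)%Z).
    by exists c; split=> //; exists j.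
  have pall j : (j < d.+1)%N -> (p %| c j)%Z.
    by move=> jd; apply/negPn/negP => npj; apply: alld; exists j.
  have p1 := prime_gt1 residue_char_prime.
  apply: (IH (fun j => (c j %/ p)%Z)).
    exists i => //; have e1 := congr1 absz (divzK pc); rewrite abszM absz_nat in e1.
    by apply/andP; split; move: ci0 cib; rewrite -e1; nia.
  have h : (\sum_(i < d.+1) e i *~ (c i %/ p)%Z) *~ p = 0.
    rewrite mulrz_suml -[RHS]hc; apply: eq_bigr => j _.
    by rewrite -mulrzA divzK // pall.
  apply/eqP; move/eqP: h; rewrite -pmulrn -mulr_natr mulf_eq0.
  by rewrite (negPf (natr_neq0 _)) ?orbF // ltnW.
apply: (key `|c0 i0|%N c0).
  exists i0 => //; rewrite leqnn andbT absz_gt0 -(intr_eq0 rat) c0E mulf_neq0 //.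
  by rewrite intr_eq0.
have e1 (i : 'I_d.+1) : e i *~ c0 i = (D%:~R * k i) *: e i.
  by rewrite mulrC -c0E scaler_int.
rewrite (eq_bigr (fun i : 'I_d.+1 => D%:~R *: (k i *: e i))) => [|i _]; last first.
  by rewrite e1 scalerA.
by rewrite -scaler_sumr sum0 scaler0.
Qed.

(** By [integer_relation], a family of [P] whose relations modulo [N] are all trivial
    modulo [p] has at most [d] elements; a maximal one generates [P] modulo [N]. *)
Lemma finitely_generated_mod (P N : F -> Prop) : N 0 ->
  (forall x y, N x -> N y -> N (x - y)) -> (forall x, P x -> N (x *+ p)) ->
  exists m (e : nat -> F), (forall i, (i < m)%N -> P (e i)) /\
    forall x, P x -> exists c : nat -> int, N (x - \sum_(i < m) e i *~ c i).
Proof.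
move=> N0 NB NP; set d := \dim {:F}.
have NN x : N x -> N (- x) by move=> Nx; rewrite -sub0r; apply: NB.
have ND x y : N x -> N y -> N (x + y) by move=> Nx Ny; rewrite -[y]opprK; apply: NB => //; exact: NN.
have NMn x m : N x -> N (x *+ m) by move=> Nx; elim: m => [|m IH]; rewrite ?mulr0n // mulrS; apply: ND.
have NMz x (m : int) : N x -> N (x *~ m).
  by move=> Nx; case: m => m; rewrite ?NegzE ?mulrNz -pmulrn; [|apply: NN]; exact: NMn.
pose indep m (e : nat -> F) := (forall i, (i < m)%N -> P (e i)) /\
  forall c : nat -> int, N (\sum_(i < m) e i *~ c i) -> forall i, (i < m)%N -> (p %| c i)%Z.
have ex0 : exists m, `[< exists e, indep m e >].
  by exists 0%N; apply/asboolP; exists (fun=> 0); split.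
have bound m : `[< exists e, indep m e >] -> (m <= d)%N.
  move=> /asboolP[e [_ he]]; rewrite leqNgt; apply/negP => dm.
  have [c [[i id ni] sum0]] := integer_relation e.
  pose c' j := if (j < d.+1)%N then c j else 0.
  have : N (\sum_(j < m) e j *~ c' j).
    rewrite -(big_mkord xpredT (fun j => e j *~ c' j)) (big_cat_nat (n := d.+1)) //=.
    rewrite big_mkord (eq_bigr (fun j : 'I_d.+1 => e j *~ c j)) => [|j _]; last by rewrite /c' ltn_ord.
    rewrite sum0 add0r big_nat big1 // => j /andP[dj _].
    by rewrite /c' ltnNge dj mulr0z.
  move/he/(_ i (leq_trans id dm)); rewrite /c' id => h; by rewrite h in ni.
case: (ex_maxnP ex0 bound) => m /asboolP[e [Pe he]] mmax.
exists m, e; split=> // x Px.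
have : ~ indep m.+1 (fun i => if i == m then x else e i).
  move=> h; have := mmax m.+1; rewrite ltnn => hm.
  by suff: false by []; apply: hm; apply/asboolP; eexists; exact: h.
move=> ni; have {ni}[c [Nc [i [im npi]]]] : exists c : nat -> int,
    N (\sum_(i < m) e i *~ c i + x *~ c m) /\ exists i, (i < m.+1)%N /\ ~~ (p %| c i)%Z.
  apply: contrapT => no; apply: ni; split=> [i im|c Nc i im].
    case: eqP => // /eqP im'; apply: Pe; by rewrite ltn_neqAle im' -ltnS.
  apply/negPn/negP => npi; apply: no; exists c; split; last by exists i.
  move: Nc; rewrite big_ord_recr /= eqxx; congr (N (_ + _)); apply: eq_bigr => j _.
  by rewrite ltn_eqF.
have Npx (a : int) : (p %| a)%Z -> N (x *~ a).
  by move=> /dvdzP[q ->]; rewrite mulrC mulrzA -pmulrn; apply/NMz/NP.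
have npm : ~~ (p %| c m)%Z.
  apply/negP => pm; have Nc' : N (\sum_(i < m) e i *~ c i).
    by rewrite -[X in N X](addrK (x *~ c m)); apply: NB => //; exact: Npx.
  have [im'|mi] := ltnP i m; first by rewrite (he _ Nc' _ im') in npi.
  have eim : i = m by apply/eqP; rewrite eqn_leq mi -ltnS im.
  by rewrite eim pm in npi.
have /coprimezP[[a b] /= ab] : coprimez (c m) p.
  by rewrite coprimezE absz_nat coprime_sym prime_coprime ?residue_char_prime // -dvdzE.
exists (fun i => - (a * c i)).
have -> : x - \sum_(i < m) e i *~ (- (a * c i))
    = (\sum_(i < m) e i *~ c i + x *~ c m) *~ a + x *~ (b * p).
  have -> : \sum_(i < m) e i *~ (- (a * c i)) = - ((\sum_(i < m) e i *~ c i) *~ a).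
    rewrite mulrz_suml -sumrN; apply: eq_bigr => j _.
    by rewrite mulrNz [(a * _)]mulrC mulrzA.
  by rewrite opprK mulrzDl -addrA -mulrzA -mulrzDr [c m * a]mulrC ab mulr1z addrC.
apply: ND; first exact: NMz.
by apply: Npx; exact: dvdz_mull.
Qed.

Lemma residue_finite : exists s : seq (residue v), forall z, z \in s.
Proof.
have [|||m [e [Pe he]]] := @finitely_generated_mod (fun x => Ov x) (fun x => valuation_ge v 1 x).
- by rewrite /valuation_ge eqxx.
- by move=> x y; exact: valuation_geB.
- move=> x Ox; rewrite -mulr_natr -[1]add0r; apply: valuation_geM => //.
  by have [_ hp _] := residue_charP.
pose val (f : {ffun 'I_m -> 'I_p}) : residue v := \sum_(i < m) residue_of v (e i) *+ f i.
exists (codom val) => z; have [x Ox <-] := residue_of_surj z.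
have [c hc] := he x Ox; have [p0 hp pmin] := residue_charP.
have pn0 : (p : int) != 0 by move: p0; case: (p).
have cp i : (`|(c i %% p)%Z| < p)%N.
  have := ltz_mod (c i) pn0; have := modz_ge0 (c i) pn0.
  by case: (c i %% p)%Z => // r _; rewrite ltz_nat.
apply/codomP; exists [ffun i : 'I_m => Ordinal (cp i)].
have Oe (i : 'I_m) : Ov (e i) by exact: Pe.
have Omz y (n : int) : Ov y -> Ov (y *~ n).
  by move=> Oy; rewrite -mulrzr; apply: valringM => //; exact: valring_int.
have resMn y n : Ov y -> residue_of v (y *+ n) = residue_of v y *+ n.
  move=> Oy; elim: n => [|n IH]; rewrite ?mulr0n ?residue_of0 // !mulrS residue_ofD ?IH //.
  by rewrite -mulr_natr; apply: valringM => //; exact: valring_nat.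
have resMz y (n : int) : Ov y -> residue_of v (y *~ n) = residue_of v y *~ n.
  move=> Oy; case: n => n; rewrite ?NegzE ?mulrNz -!pmulrn ?resMn //.
  rewrite -[- _]sub0r residue_ofB ?valring0 // ?residue_of0 ?sub0r ?resMn //.
  by rewrite -mulr_natr; apply: valringM => //; exact: valring_nat.
have resp y : Ov y -> residue_of v y *+ p = 0.
  move=> Oy; rewrite -resMn // ; apply/eqP; rewrite residue_of_eq0; last first.
    by rewrite -mulr_natr; apply: valringM => //; exact: valring_nat.
  by rewrite -mulr_natr -[1]add0r; apply: valuation_geM.
have Osum : Ov (\sum_(i < m) e i *~ c i) by apply: valring_sum => i _; exact: Omz.
have -> : residue_of v x = residue_of v (\sum_(i < m) e i *~ c i).
  apply/eqP; rewrite -subr_eq0 -residue_ofB // residue_of_eq0 //.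
  exact: valringB.
have -> : residue_of v (\sum_(i < m) e i *~ c i) = \sum_(i < m) residue_of v (e i *~ c i).
  have [] : Ov (\sum_(i < m) e i *~ c i) /\ residue_of v (\sum_(i < m) e i *~ c i)
      = \sum_(i < m) residue_of v (e i *~ c i); last by [].
  apply: (big_rec2 (fun a b => Ov a /\ residue_of v a = b)) => [|i a b _ [Ob <-]].
    by rewrite valring0 residue_of0.
  by rewrite residue_ofD ?valringD //; exact: Omz.
apply: eq_bigr => i _; rewrite ffunE /= resMz // {1}(divz_eq (c i) p) mulrzDr mulrC mulrzA.
rewrite -pmulrn resp // mul0rz add0r; have := modz_ge0 (c i) pn0.
by case: (c i %% p)%Z => // r _; rewrite -pmulrn.
Qed.

Lemma residue_preBloch_torsion (q : preBloch (residue v)) : q *+ 3 = 0 ->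
  exists r : int, q = bloch_const (residue v) *~ r.
Proof.
have [s hs] := residue_finite.
exact: (enumerated_preBloch_torsion hs).
Qed.
End ResidueCharacteristic.

(** * Ideals of the ring of integers *)

Section IntegerRing.
Variable F : fieldExtType rat.
Local Notation O := (@ring_of_integers F).
Implicit Types (x y a b : F) (v w : finite_prime F).

Lemma int_integral (m : int) : O m%:~R.
Proof. exact: integral_id. Qed.

Lemma integers_valring v x : O x -> valring_pred v x.
Proof.
case=> q qm /= hq; apply: (valring_root (p := map_poly intr q)) hq.
  exact: monic_map.
by move=> i; rewrite coef_map; exact: valring_int.
Qed.

Lemma integersB x y : O x -> O y -> O (x - y). Proof. exact: integral_sub. Qed.
Lemma integersD x y : O x -> O y -> O (x + y). Proof. exact: integral_add. Qed.
Lemma integersM x y : O x -> O y -> O (x * y). Proof. exact: integral_mul. Qed.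
Lemma integersX x m : O x -> O (x ^+ m).
Proof. by move=> Ox; elim: m => [|m IH]; rewrite ?expr0 ?exprS; [exact: integral1|exact: integersM]. Qed.

(** Multiplied by a power of its leading coefficient [c], the relation becomes a monic
    equation for [c x]. *)
Lemma lead_mul_integral (c : nat -> F) n x : (forall i, O (c i)) ->
  \sum_(i < n.+2) c i * x ^+ i = 0 -> O (c n.+1 * x).
Proof.
move=> Oc h; pose q : {poly F} := (\poly_(i < n.+1) (c i * c n.+1 ^+ (n - i))) + 'X^(n.+1).
have sq : size q = n.+2.
  by rewrite /q addrC size_polyDl size_polyXn // ltnS size_poly.
have qE i : q`_i = (if (i < n.+1)%N then c i * c n.+1 ^+ (n - i) else 0) + (i == n.+1)%:R.
  by rewrite coefD coef_poly coefXn.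
apply: (@integral_root_monic _ _ (intr : int -> F) _ q).
- by rewrite monicE lead_coefE sq /= qE ltnn add0r eqxx.
- apply/rootP; rewrite hornerD hornerXn horner_poly exprMn [c _ ^+ n.+1]exprSr -mulrA.
  have -> : \sum_(i < n.+1) c i * c n.+1 ^+ (n - i) * (c n.+1 * x) ^+ i
     = c n.+1 ^+ n * \sum_(i < n.+1) c i * x ^+ i.
    rewrite mulr_sumr; apply: eq_bigr => i _; rewrite exprMn.
    have -> : c n.+1 ^+ n = c n.+1 ^+ (n - i) * c n.+1 ^+ i.
      by rewrite -exprD subnK // -ltnS.
    by rewrite [RHS]mulrACA [c i * _]mulrC.
  by move: h; rewrite big_ord_recr /= => /(congr1 (fun t => c n.+1 ^+ n * t)); rewrite mulr0 mulrDr.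
- apply/integral_poly => i; rewrite qE; apply: integersD; last exact: integral_nat.
  by case: ifP => _; [apply: integersM => //; exact: integersX|exact: integral0].
Qed.

Lemma valring_unit v x : valring_pred v x -> ~~ valuation_ge v 1 x -> x != 0 /\ v x = 0.
Proof.
rewrite /valring_pred /valuation_ge; case: eqP => //= _ h; rewrite -ltNge => h1; split=> //.
by apply/eqP; rewrite eq_le h -ltzD1 add0r h1.
Qed.

Lemma unit_valring v x : x != 0 -> v x = 0 -> valuation_ge v 1 x = false.
Proof. by rewrite /valuation_ge => /negPf-> ->. Qed.

(** In a relation for [x] with integral coefficients, one of them prime to [v], the leading coefficient [c] can
    serve as the denominator if it is prime to [v].  Otherwise it can be absorbed in the
    next coefficient, because [c x] is an integer that is divisible by [v]. *)
Lemma valring_localization v x : valring_pred v x ->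
  exists u, [/\ O u, u != 0, v u = 0 & O (u * x)].
Proof.
move=> Ox.
suff key n (c : nat -> F) : \sum_(j < n.+1) c j * x ^+ j = 0 -> (forall j, O (c j)) ->
    (exists2 i, (i < n.+1)%N & ~~ valuation_ge v 1 (c i)) ->
    exists u, [/\ O u, u != 0, v u = 0 & O (u * x)].
  have [c [[i id ni] sum0]] := integer_relation v (fun i => x ^+ i).
  apply: (key (\dim {:F}) (fun j => (c j)%:~R)) => [|j|]; last by exists i; rewrite ?residue_char_dvd.
    by rewrite -[RHS]sum0; apply: eq_bigr => j _; rewrite mulrzl.
  exact: int_integral.
elim: n c => [|n IH] c sum0 Oc [i' i'n ni].
  move: sum0 i'n ni; rewrite big_ord1 expr0 mulr1 ltnS leqn0 => h /eqP ->.
  by rewrite /valuation_ge h eqxx.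
have Ocx := lead_mul_integral Oc sum0.
have [cn|ncn] := boolP (valuation_ge v 1 (c n.+1)); last first.
  by have [? ?] := valring_unit (integers_valring v (Oc _)) ncn; exists (c n.+1).
apply: (IH (fun i => if i == n then c n + c n.+1 * x else c i)).
- move: sum0; rewrite !big_ord_recr /= eqxx exprS mulrA -addrA -mulrDl => h.
  by rewrite -[RHS]h; congr (_ + _); apply: eq_bigr => j _; rewrite ltn_eqF.
- by move=> j; case: eqP => // _; apply: integersD.
have cnx : valuation_ge v 1 (c n.+1 * x) by rewrite -[1]addr0; apply: valuation_geM.
have i'n1 : i' != n.+1 by apply: contraNneq ni => ->.
exists i'; first by rewrite ltn_neqAle i'n1 -ltnS.
case: eqP => [e|//]; apply: contra ni => h; rewrite e -[c n](addrK (c n.+1 * x)).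
exact: valuation_geB.
Qed.

Lemma integer_uniformizer v : exists pi, [/\ O pi, pi != 0 & v pi = 1].
Proof.
have [t t0 vt] := valuation_surj v.
have Ot : valring_pred v t by rewrite valringE // vt.
have [u [Ou u0 vu Out]] := valring_localization Ot.
by exists (u * t); split; rewrite ?mulf_neq0 // valuationM // vu vt.
Qed.

(** The residue field is finite, so that a power of a unit is [1] in it. *)
Lemma integer_inverse v a : O a -> a != 0 -> v a = 0 ->
  exists b q, [/\ O b, O q, valuation_ge v 1 q & a * b + q = 1].
Proof.
move=> Oa a0 va; have Va := integers_valring v Oa.
have [s hs] := residue_finite v; set z := residue_of v a.
have z0 : z != 0 by rewrite residue_unit // a0 va eqxx.
have zE m : residue_of v (a ^+ m) = z ^+ m.
  elim: m => [|m IH]; first by rewrite !expr0 residue_of1.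
  by rewrite !exprS residue_ofM ?IH //; exact: valring_exp.
have [m hm] : exists m, z ^+ m.+1 = 1.
  apply: contrapT => no.
  have ui : uniq (mkseq (fun i => z ^+ i) (size s).+1).
    apply/(mkseq_uniqP) => i j _ _.
    wlog ij : i j / (i <= j)%N by move=> h; case: (leqP i j) => [/h//|/ltnW/h e /esym/e].
    move=> e; apply/eqP; rewrite eqn_leq ij /= leqNgt; apply/negP => lij; apply: no.
    exists (j - i).-1; rewrite prednK ?subn_gt0 //.
    apply: (mulfI (expf_neq0 i z0)).
    by rewrite -exprD subnKC // mulr1.
  by have := uniq_leq_size ui (fun t _ => hs t); rewrite size_mkseq ltnn.
exists (a ^+ m), (1 - a ^+ m.+1); rewrite -exprS subrKC.
have Oam k : O (a ^+ k) by exact: integersX.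
split=> //; first by apply: integersB => //; exact: integral1.
rewrite -residue_of_eq0; last by apply: valringB; [exact: valring1|exact: valring_exp].
by rewrite residue_ofB ?residue_of1 ?zE ?hm ?subrr //; [exact: valring1|exact: valring_exp].
Qed.

Lemma prime_ideal_submodule v : submodule (prime_ideal v).
Proof.
split=> [|x y [Ox hx] [Oy hy]|a x Oa [Ox hx]]; split.
- exact: integral0.
- by rewrite /valuation_ge eqxx.
- exact: integersB.
- exact: valuation_geB.
- exact: integersM.
- by rewrite -[1]add0r; apply: valuation_geM => //; exact: integers_valring.
Qed.

(** As [p_v] is finitely generated, a common denominator [U] prime to [v] makes
    [(U / pi) p_v] integral. *)
Lemma prime_ideal_denominator v : exists y pi,
  [/\ prime_ideal v pi, O (y * pi), y * pi != 0, v (y * pi) = 0 &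
    forall x, prime_ideal v x -> O (y * x)].
Proof.
have [pi [Opi pi0 vpi]] := integer_uniformizer v.
have [p0 hp _] := residue_charP v; set p := residue_char v in p0 hp *.
have pF0 := natr_neq0 F p0.
have [p0' pB pM] := prime_ideal_submodule v.
have Op : O p%:R by exact: integral_nat.
have clear (s : seq F) : (forall x, x \in s -> prime_ideal v x) ->
    exists u, [/\ O u, u != 0, v u = 0 & forall x, x \in s -> O (u / pi * x)].
  elim: s => [|x s IH] hs.
    by exists 1; split=> //; [exact: integral1|exact: oner_neq0|exact: valuation1].
  have [|u [Ou u0 vu hu]] := IH; first by move=> y ys; apply: hs; rewrite inE ys orbT.
  have [|Ox hx] := hs x; first exact: mem_head.
  have Vx : valring_pred v (x / pi).
    by have := @valuation_geM _ v 1 (-1) x pi^-1 hx; rewrite /valuation_ge valuationV vpi lexx orbT; apply.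
  have [u' [Ou' u'0 vu' hu']] := valring_localization Vx.
  exists (u * u'); split; rewrite ?mulf_neq0 //; first exact: integersM.
    by rewrite valuationM // vu vu'.
  move=> y; rewrite inE => /orP[/eqP->|/hu hy].
    by rewrite -!mulrA [_ * x]mulrC; apply: integersM.
  by rewrite [u * u']mulrC -!mulrA; apply: integersM => //; rewrite mulrA.
have [|||m [e [Pe he]]] := @finitely_generated_mod _ v (prime_ideal v) (fun x => O (x / p%:R)).
- by rewrite mul0r; exact: integral0.
- by move=> x y; rewrite mulrBl; exact: integersB.
- by move=> x [Ox _]; rewrite -(mulr_natr x) mulfK.
have [|u [Ou u0 vu hu]] := clear (p%:R :: mkseq e m).
  move=> x; rewrite inE => /orP[/eqP->|/mapP[i]]; first by split.
  by rewrite mem_iota => /andP[_ im] ->; apply: Pe.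
exists (u / pi), pi; rewrite divfK //; split=> //.
  by split=> //; rewrite /valuation_ge vpi lexx orbT.
move=> x Px; have [c hc] := he x Px; set z := \sum_(i < m) _ in hc.
rewrite -[x](subrK z) mulrDr; apply: integersD.
  rewrite -[x - z](divfK pF0) mulrCA; apply: integersM => //.
  by apply: hu; exact: mem_head.
rewrite /z mulr_sumr; elim/big_ind: _ => [|a b Oa Ob|i _]; [exact: integral0|exact: integersD|].
rewrite -mulrzr mulrA; apply: integersM; last exact: int_integral.
by apply: hu; rewrite inE; apply/orP; right; apply: map_f; rewrite mem_iota /=.
Qed.

(** The inverse consists of the [z] with [z p_v] integral.  It contains [1] and the
    element [y] of [prime_ideal_denominator]; as [y pi] is prime to [v], the number [1] is
    a combination of [y pi] and of an element of [p_v]. *)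
Lemma prime_ideal_invertible v :
  exists J, submodule J /\ ideal_product (prime_ideal v) J = O.
Proof.
have [y [pi [Ppi Oypi ypi0 vypi hy]]] := prime_ideal_denominator v.
exists [set z | forall x, prime_ideal v x -> O (z * x)]%classic; split.
  split=> [x _|z t hz ht x Px|a z Oa hz x Px].
  - by rewrite mul0r; exact: integral0.
  - by rewrite mulrBl; apply: integersB; [exact: hz|exact: ht].
  - by rewrite -mulrA; apply: integersM => //; exact: hz.
apply/seteqP; split=> x.
  apply; [exact: integral0|exact: integersB|].
  by move=> _ [s [t [Ps ht ->]]]; rewrite mulrC; exact: ht.
move=> Ox; have [b [q [Ob Oq hq e]]] := integer_inverse Oypi ypi0 vypi.
have [P0 PB PM] := prime_ideal_submodule v.
have -> : x = (pi * (y * (b * x))) - ((- q) * x).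
  rewrite mulNr opprK -[LHS]mul1r -e mulrDl; congr (_ + _).
  by rewrite -!mulrA mulrCA.
apply: spannedB; apply: spannedG.
  exists pi, (y * (b * x)); split=> // t Pt; rewrite mulrAC; apply: integersM; first exact: hy.
  exact: integersM.
exists (- q), x; split=> //; last by move=> t [Ot _]; exact: integersM.
by rewrite -sub0r; apply: PB.
Qed.

Definition prime_to_ideal v : ideal F :=
  Ideal (prime_ideal_submodule v) (prime_ideal_invertible v).
End IntegerRing.

(** * Orders of ideals and units with prescribed parity *)

Section IdealOrder.
Variable F : fieldExtType rat.
Local Notation O := (@ring_of_integers F).
Implicit Types (x y a b : F) (v w : finite_prime F) (I J : ideal F).

Definition is_order w (M : set F) (n : int) :=
  (forall x, M x -> valuation_ge w n x) /\ exists x, [/\ M x, x != 0 & w x = n].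

Lemma is_order_unique w M n m : is_order w M n -> is_order w M m -> n = m.
Proof.
move=> [hn [x [Mx x0 wx]]] [hm [y [My y0 wy]]].
have := hn y My; have := hm x Mx; rewrite /valuation_ge (negPf x0) (negPf y0) wx wy /=.
by move=> h1 h2; apply/le_anti; rewrite h1 h2.
Qed.

Lemma is_order_product w (M N : set F) n m : is_order w M n -> is_order w N m ->
  is_order w (ideal_product M N) (n + m).
Proof.
move=> [hn [x [Mx x0 wx]]] [hm [y [Ny y0 wy]]]; split.
  move=> z /(_ (fun z => valuation_ge w (n + m) z)); apply.
  - by rewrite /valuation_ge eqxx.
  - by move=> s t; exact: valuation_geB.
  by move=> _ [s [t [Ms Nt ->]]]; apply: valuation_geM; [exact: hn|exact: hm].
exists (x * y); rewrite mulf_neq0 ?valuationM ?wx ?wy //; split=> //.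
by apply: spannedG; exists x, y.
Qed.

(** An element [y] of an inverse of [I] bounds the valuation from below on [I],
    since [I y] consists of integers. *)
Lemma is_order_exists w I : exists n, is_order w I n.
Proof.
have [J [[J0 JB JM] IJ]] := ideal_invertible I.
have nonzero : exists x y, [/\ carrier I x, J y, x != 0 & y != 0].
  apply: contrapT => no; have : ideal_product I J 1 by rewrite IJ; exact: integral1.
  move/(_ (fun z => z = 0)) => h; move/eqP: (oner_neq0 F); apply; apply: h => //.
    by move=> s t -> ->; rewrite subr0.
  move=> _ [x [y [Ix Jy ->]]]; apply/eqP; rewrite mulf_eq0; apply/negPn/negP.
  by rewrite negb_or => /andP[x0 y0]; apply: no; exists x, y.
have [x [y [Ix Jy x0 y0]]] := nonzero.
have lower z : carrier I z -> z != 0 -> - w y <= w z.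
  move=> Iz z0; have : O (z * y) by rewrite -IJ; apply: spannedG; exists z, y.
  by move/(integers_valring w); rewrite valringE ?mulf_neq0 // valuationM // -lerBlDr sub0r.
have ex : exists k : nat, `[< exists z, [/\ carrier I z, z != 0 & w z = - w y + k%:Z] >].
  exists (absz (w x + w y)); apply/asboolP; exists x; split=> //.
  by have := lower _ Ix x0; lia.
case: (ex_minnP ex) => k /asboolP[z [Iz z0 wz]] kmin.
exists (- w y + k%:Z); split; last by exists z.
move=> t It; rewrite /valuation_ge; case: eqVneq => //= t0; have lt := lower _ It t0.
suff : (k <= absz (w t + w y)%R)%N by lia.
by apply: kmin; apply/asboolP; exists t; split=> //; lia.
Qed.

Definition ideal_order w I : int := projT1 (cid (is_order_exists w I)).

Lemma ideal_orderP w I : is_order w I (ideal_order w I).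
Proof. exact: projT2 (cid (is_order_exists w I)). Qed.

Lemma ideal_orderE w I n : is_order w I n -> ideal_order w I = n.
Proof. by move=> h; exact: is_order_unique (ideal_orderP w I) h. Qed.

Fact ideal_order_additive w : zmod_morphism (ideal_order w).
Proof.
move=> I J; apply/eqP; rewrite eq_sym subr_eq; apply/eqP.
rewrite -{1}[I](subrK J); apply: ideal_orderE.
exact: is_order_product (ideal_orderP w (I - J)) (ideal_orderP w J).
Qed.
HB.instance Definition _ w :=
  GRing.isZmodMorphism.Build (ideal F) int (ideal_order w) (ideal_order_additive w).

Lemma ideal_order_principal (I : ideal F) : spanned (@principal F) I ->
  exists2 a, a != 0 & forall w, ideal_order w I = w a.
Proof.
move/(_ (fun I => exists2 a, a != 0 & forall w, ideal_order w I = w a)); apply.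
- by exists 1; [exact: oner_neq0|move=> w; rewrite raddf0 valuation1].
- move=> K J [a a0 ha] [b b0 hb]; exists (a / b); first by rewrite mulf_neq0 ?invr_eq0.
  by move=> w; rewrite raddfB /= ha hb valuation_div.
move=> K [a a0 eK]; exists a => // w; apply: ideal_orderE; rewrite eK; split.
  move=> _ [x Ox <-]; rewrite -[w a]addr0; apply: valuation_geM.
    by rewrite /valuation_ge lexx orbT.
  exact: integers_valring.
by exists a; split=> //; exists 1; rewrite ?mulr1 //; exact: integral1.
Qed.

(** Distinct primes are incomparable: from [p_v] contained in [p_w] one gets the same
    inclusion for the valuation rings, hence the valuations are proportional. *)
Lemma finite_prime_eq v w : (forall x, prime_ideal v x -> prime_ideal w x) -> v = w.
Proof.
move=> vw.
have unit_w u : O u -> u != 0 -> v u = 0 -> w u = 0.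
  move=> Ou u0 vu; have [b [q [Ob Oq hq e]]] := integer_inverse Ou u0 vu.
  have [_ hqw] : prime_ideal w q by apply: vw.
  have [//|] := boolP (w u == 0); first by move/eqP.
  have Vu := integers_valring w Ou; move=> wu.
  have hu : valuation_ge w 1 u.
    by apply/negPn/negP => h; have [_ h0] := valring_unit Vu h; rewrite h0 eqxx in wu.
  have : valuation_ge w 1 (u * b - (- q)).
    apply: valuation_geB; last by rewrite /valuation_ge oppr_eq0 valuationN.
    by rewrite -[1]addr0; apply: valuation_geM => //; exact: integers_valring.
  by rewrite opprK e unit_valring ?oner_neq0 ?valuation1.
have unit0 x : x != 0 -> v x = 0 -> 0 <= w x.
  move=> x0 vx; have [|u [Ou u0 vu Oux]] := @valring_localization _ v x.
    by rewrite valringE // vx.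
  have := integers_valring w Oux; rewrite valringE ?mulf_neq0 // valuationM //.
  by rewrite (unit_w u) ?add0r.
have unit x : x != 0 -> v x = 0 -> w x = 0.
  move=> x0 vx; apply/eqP; rewrite eq_le unit0 // andbT -oppr_ge0 -valuationV.
  by apply: unit0; rewrite ?invr_eq0 // valuationV vx oppr0.
have [pi [Opi pi0 vpi]] := integer_uniformizer v.
have wpi : 1 <= w pi.
  have [_] : prime_ideal w pi by apply: vw; split=> //; rewrite /valuation_ge vpi lexx orbT.
  by rewrite /valuation_ge (negPf pi0).
have powE (u : finite_prime F) (n : int) : u (pi ^ n) = u pi * n.
  have nat m : u (pi ^+ m) = u pi * m%:Z.
    elim: m => [|m IH]; first by rewrite expr0 valuation1 mulr0.
    by rewrite exprS valuationM ?expf_neq0 // IH intS mulrDr mulr1.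
  by case: n => m; rewrite -?exprnP ?nat // NegzE -exprnN valuationV nat mulrN.
have prop x : x != 0 -> w x = w pi * v x.
  move=> x0; have := unit (x / pi ^ v x).
  rewrite mulf_neq0 ?invr_eq0 ?expfz_neq0 // => /(_ isT).
  rewrite !valuation_div ?expfz_neq0 // !powE vpi mul1r subrr => /(_ erefl) /eqP.
  by rewrite subr_eq0 => /eqP.
have wpi1 : w pi = 1.
  have [t t0 wt] := valuation_surj w; have := prop t t0; rewrite wt.
  move: wpi; move: (w pi) (v t) => m n h1 h2; have : 0 < n by rewrite -(pmulr_rgt0 n (lt_le_trans ltr01 h1)) -h2.
  by move=> n0; nia.
have {prop}fE : valuation v = valuation w.
  apply/funext => x; have [->|x0] := eqVneq x 0; first by rewrite !valuation0.
  by rewrite prop // wpi1 mul1r.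
case: v w fE {vw unit_w unit0 unit wpi powE wpi1 vpi} => [f f0 fM fD fs] [g g0 gM gD gs] /= fg.
case: g / fg g0 gM gD gs => g0 gM gD gs.
by rewrite (Prop_irrelevance f0 g0) (Prop_irrelevance fM gM) (Prop_irrelevance fD gD)
  (Prop_irrelevance fs gs).
Qed.

Lemma ideal_order_prime v w (I : ideal F) : carrier I = prime_ideal v ->
  ideal_order w I = (v == w)%:Z.
Proof.
move=> eI; apply: ideal_orderE; rewrite eI; case: eqVneq => [<-|vw].
  split; first by move=> x [].
  have [pi [Opi pi0 vpi]] := integer_uniformizer v; exists pi; split=> //.
  by split=> //; rewrite /valuation_ge vpi lexx orbT.
split; first by move=> x [Ox _]; exact: integers_valring.
apply: contrapT => no; move/eqP: vw; apply; apply: finite_prime_eq => x [Ox hx].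
split=> //; apply/negPn/negP => h; apply: no; exists x.
by have [x0 wx] := valring_unit (integers_valring w Ox) h; split.
Qed.

(** Modulo squares of ideals supported on [S], each prime of [S] is principal: a
    generator is a unit of [O_S] whose valuation is odd at one given prime of [S] and
    even at the others. *)
Lemma unit_with_parity (S : {fset finite_prime F}) v :
  class_subgroup_mod2_trivial S -> v \in S ->
  exists a, [/\ a != 0, forall w, w \notin S -> w a = 0 &
    forall w, exists m : int, w a = (v == w)%:Z - m *+ 2].
Proof.
move=> hS vS; pose P := prime_to_ideal v; have eP : carrier P = prime_ideal v by [].
have gen : Defs.span (fun c : class_group F => exists2 v : finite_prime F, v \in S &
    exists2 I : ideal F, carrier I = prime_ideal v & c = \pi_(class_group F) I)
    (\pi_(class_group F) P).
  by apply/asboolP; apply: spannedG; exists v => //; exists P.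
pose c : class_subgroup S := Sub (\pi_(class_group F) P) gen.
have [b hb] : exists d, c = d *+ 2.
  have := hS (\pi_(mod2 (class_subgroup S)) c).
  rewrite -[RHS](@pi_zeror _ _ _ _ _ (mod2 (class_subgroup S))) => /eqP.
  rewrite -Quotient.idealrBE subr0 => /asboolP.
  move/(_ (fun c => exists d, c = d *+ 2)); apply.
  - by exists 0; rewrite mul0rn.
  - by move=> _ _ [s ->] [t ->]; exists (s - t); rewrite mulrnBl.
  - by [].
have [J eJ hJ] : exists2 J : ideal F, val b = \pi_(class_group F) J &
    forall w, w \notin S -> ideal_order w J = 0.
  have /asboolP := valP b; move/(_ (fun c => exists2 J : ideal F, c = \pi_(class_group F) J &
    forall w, w \notin S -> ideal_order w J = 0)); apply.
  - by exists 0 => [|w _]; rewrite raddf0.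
  - move=> _ _ [I -> hI] [J -> hJ]; exists (I - J); first by rewrite raddfB.
    by move=> w wS; rewrite raddfB /= hI // hJ // subrr.
  move=> _ [w wS [I eI ->]]; exists I => // u uS; rewrite (ideal_order_prime _ eI).
  by case: eqVneq wS uS => // -> ->.
have : spanned (@principal F) (P - J *+ 2).
  apply/asboolP; rewrite -[asbool _]/(_ \in Defs.span (@principal F)) Quotient.idealrBE.
  apply/eqP; have := congr1 val hb; rewrite /= raddfMn /= eJ => ->.
  by rewrite mulr2n.
move=> /ideal_order_principal[a a0 ha]; exists a; split=> // w.
  move=> wS; rewrite -ha raddfB raddfMn /= hJ // mul0rn subr0 (ideal_order_prime _ eP).
  by case: eqVneq wS => // <-; rewrite vS.
by exists (ideal_order w J); rewrite -ha raddfB raddfMn /= (ideal_order_prime _ eP).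
Qed.
End IdealOrder.

(** * The comparison map *)

Section Comparison.
Variables (F : fieldExtType rat) (S : {fset finite_prime F}).

Definition comparison (z : H3_tors S) : preBloch_sum S :=
  fun v => torsion_map (@prime_component F S (val v)) z.

Fact comparison_additive : zmod_morphism comparison.
Proof.
move=> x y; apply: functional_extensionality_dep => v; apply: val_inj.
exact: (raddfB (@prime_component F S (val v))).
Qed.
HB.instance Definition _ :=
  GRing.isZmodMorphism.Build (H3_tors S) (preBloch_sum S) comparison comparison_additive.

Lemma torsion_val_zmul (A : zmodType) n (x : torsion A n) (m : int) : val (x *~ m) = val x *~ m.
Proof. exact: (raddfMz val). Qed.

Lemma torsion3_opp (A : zmodType) (x : torsion A 3) : - (x + x) = x.
Proof.
apply/eqP; rewrite eq_sym -subr_eq0 opprK addrA -mulr2n -mulrSr; apply/eqP/val_inj.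
rewrite (raddfMn val) raddf0; exact/eqP/(valP x).
Qed.

Lemma comparison_act g (gU : g \in unitmx) z :
  comparison (H3_act gU z) = preBloch_act (\det g) (comparison z).
Proof.
apply: functional_extensionality_dep => v; apply: val_inj.
rewrite torsion_val_zmul; exact: prime_component_act.
Qed.

Let image (y : preBloch_sum S) := exists z, comparison z = y.

Let imageB x y : image x -> image y -> image (x - y).
Proof. by move=> [z <-] [t <-]; exists (z - t); rewrite raddfB. Qed.

Let image0 : image 0. Proof. by exists 0; rewrite raddf0. Qed.
Let imageN x : image x -> image (- x).
Proof. by move=> h; rewrite -sub0r; exact: imageB. Qed.
Let imageD x y : image x -> image y -> image (x + y).
Proof. by move=> hx hy; rewrite -[y]opprK; apply: imageB => //; exact: imageN. Qed.
Let imageMz x (m : int) : image x -> image (x *~ m).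
Proof. by move=> [z <-]; exists (z *~ m); rewrite raddfMz. Qed.

Let image_act (a : Sint S) y : a \is a GRing.unit -> image y -> image (preBloch_act a y).
Proof.
move=> aU [z <-]; pose g : 'M[Sint S]_2 := diag_mx (\row_i (if i == 0 then a else 1)).
have dg : \det g = a by rewrite det_diag big_ord_recl big_ord1 !mxE mulr1.
have gU : g \in unitmx by rewrite unitmxE dg.
by exists (H3_act gU z); rewrite comparison_act dg.
Qed.

Lemma signz_parity (b : bool) (m : int) : (-1) ^ (b%:Z - m *+ 2) = (if b then -1 else 1) :> int.
Proof. by rewrite mulr2n opprD !signzD signz_sqr mulr1; case: b. Qed.

Lemma unit_of_Sint (a : F) : a != 0 -> (forall w : finite_prime F, w \notin S -> w a = 0) ->
  exists2 u : Sint S, u \is a GRing.unit & val u = a.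
Proof.
move=> a0 ha.
have Pa : Sint_pred S a by apply/Sint_predP => w /ha wa; rewrite valringE // wa.
have Pi : Sint_pred S a^-1.
  by apply/Sint_predP => w /ha wa; rewrite valringE ?invr_eq0 // valuationV wa.
by exists (Sub a Pa) => //; apply/andP; split.
Qed.

Hypothesis S_trivial : class_subgroup_mod2_trivial S.

(** With [a] odd at [w] and even at the other primes of [S], the element [y + a y] vanishes at
    [w] and is [2 y = - y] elsewhere: in the image, one coordinate can be erased. *)
Let image_erase (w : S) (y : preBloch_sum S) : image y ->
  exists2 x, image x & forall v : S, x v = if v == w then 0 else y v.
Proof.
move=> hy; have [a [a0 ha pa]] := unit_with_parity S_trivial (valP w).
have [u uU ua] := unit_of_Sint a0 ha.
exists (- (y + preBloch_act u y)); first by apply/imageN/imageD => //; exact: image_act.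
move=> v; have -> : (- (y + preBloch_act u y)) v
    = - (y v + y v *~ ((-1) ^ ((val v : finite_prime F) (val u)))) by [].
have [m vm] := pa (val v); rewrite ua vm signz_parity.
have -> : (val w == val v) = (v == w) by rewrite eq_sym; apply/eqP/eqP => [/val_inj|->].
by case: ifP => _; [rewrite mulrN1z subrr oppr0|rewrite mulr1z torsion3_opp].
Qed.

Let image_bloch_const : exists2 y, image y & forall v, val (y v) = bloch_const (residue (val v)).
Proof.
exists (comparison (Sub (lens_class S) (lens_class_torsion (order3K S)))); first by eexists.
by move=> v; exact: prime_component_lens.
Qed.

(* Starting from the class of the element of order 3, whose components are the
   constants, all coordinates but one are erased. *)
Let image_erase_seq (s : seq S) : exists2 y, image y & forall v : S,
  val (y v) = if v \in s then 0 else bloch_const (residue (val v)).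
Proof.
elim: s => [|w s [y hy yE]]; first by have [y hy yE] := image_bloch_const; exists y.
have [x hx xE] := image_erase w hy; exists x => // v.
by rewrite xE inE; case: eqP => //= _; rewrite yE.
Qed.

Let image_coordinate (w : S) (q : torsion (preBloch (residue (val w))) 3) :
  exists2 x, image x & x w = q /\ forall v : S, v != w -> x v = 0.
Proof.
have [r hr] : exists r : int, val q = bloch_const (residue (val w)) *~ r.
  by apply: residue_preBloch_torsion; exact/eqP/(valP q).
have [y hy yE] := image_erase_seq (enum (predC1 w)).
exists (y *~ r); first exact: imageMz.
have scale v : (y *~ r) v = y v *~ r.
  have nat n : (y *+ n) v = y v *+ n.
    by elim: n => [|n IH]; rewrite ?mulr0n // !mulrS -IH.
  by case: r {hr} => n; rewrite ?NegzE ?mulrNz -!pmulrn -nat.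
split=> [|v vw]; rewrite scale; apply: val_inj; rewrite torsion_val_zmul yE mem_enum inE.
  by rewrite eqxx hr.
by rewrite vw mul0rz.
Qed.

Lemma comparison_surjective (y : preBloch_sum S) : exists z, comparison z = y.
Proof.
have [x hx xE] : exists2 x, image x & forall v : S, v \in enum (predT : pred S) -> x v = y v.
  suff : exists2 x, image x & forall v : S, x v = if v \in enum (predT : pred S) then y v else 0.
    by move=> [x hx xE]; exists x => // v vS; rewrite xE vS.
  elim: (enum _) => [|w s [x hx xE]]; first by exists 0.
  have [ws|ws] := boolP (w \in s).
    by exists x => // v; rewrite xE inE; case: eqP => // ->; rewrite ws.
  have [t ht [tw t0]] := image_coordinate (y w); exists (x + t); first exact: imageD.
  move=> v; rewrite inE -[LHS]/(x v + t v) xE; case: (eqVneq v w) => [->|vw] /=.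
    by rewrite (negPf ws) add0r.
  by rewrite t0 // addr0.
suff <- : x = y by [].
by apply: functional_extensionality_dep => v; apply: xE; rewrite mem_enum.
Qed.
End Comparison.

Theorem theorem5p7 :
  exists Phi : comparison_family,
    (forall (F : fieldExtType rat) (S : {fset finite_prime F})
       (S0 : S != fset0) (hS : class_subgroup_mod2_trivial S),
       (forall y : preBloch_sum S, exists z : H3_tors S, Phi F S S0 hS z = y) /\
       (forall (a : Sint S) (g : 'M[Sint S]_2) (gU : g \in unitmx),
          \det g = a ->
          forall z : H3_tors S,
            Phi F S S0 hS (H3_act gU z) = preBloch_act a (Phi F S S0 hS z)))
    /\ natural Phi.
Proof.
exists (fun F S _ _ => (@comparison F S : {additive _ -> _})); split.
  move=> F S _ hS; split=> [y|a g gU <- z]; first exact: comparison_surjective.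
  exact: comparison_act.
move=> F F' S S' S0 S'0 hS hS' sigma sigma_bij _ rho rhoE v v' valE tau tauE z.
exact: (prime_component_map sigma_bij valE tauE rhoE (val z)).
Qed.
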